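(* Let $\{x^k\}$ be an infinite sequence generated by the algorithm RQO-free (described in the context). Suppose: (a) for every $x\in\mathcal F$ the vectors $\{\mathrm{grad}\,c_i(x): i\in\mathcal L(x)\}$ are linearly independent in $T_x\mathcal M$; (b) the sequence $\{x^k\}$ is bounded; (c) there are constants $a_1,a_2>0$ with $a_1\|\xi\|^2\le\langle\mathcal H_k[\xi],\xi\rangle\le a_2\|\xi\|^2$ for all $k$ and all $\xi\in T_{x^k}\mathcal M$; (d) for every $x\in\mathcal F\setminus\mathcal F_P$ there are no scalars $u_i\ge0$ $(i\in\mathcal I(x))$ and $v_i\ge0$ $(i\in\mathcal E(x))$ with $\sum_{i\in\mathcal E}\mathrm{grad}\,c_i(x)-\sum_{i\in\mathcal I(x)}u_i\,\mathrm{grad}\,c_i(x)-\sum_{i\in\mathcal E(x)}v_i\,\mathrm{grad}\,c_i(x)=0_x$. Let $\bar\rho$ be the eventual constant value of $\rho_k$. If there exists an infinite index set $\mathcal K\subseteq\mathbb N$ such that $\{(x^k,\lambda^{k0})\}_{\mathcal K}\to(x^*,\lambda^* )$, then either $(x^*,\lambda^* )$ is a KKT pair of problem (P$_{\bar\rho}$), or there exists an infinite index set $\mathcal K'\subseteq\mathcal K$ such that $\{\lambda^{(k-1)0}\}_{\mathcal K'}\to\lambda^{**}$ and $(x^*,\lambda^{**})$ is a KKT pair of problem (P$_{\bar\rho}$). Furthermore, $x^*$ is a KKT point of problem (P).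
   Context: Setting. $\mathcal{M}$ is a complete $n$-dimensional Riemannian manifold with metric $\langle\cdot,\cdot\rangle$ and norm $\|\cdot\|$ on each $T_x\mathcal M$; $R:T\mathcal{M}\to\mathcal{M}$ is a retraction (smooth, $R_x(0_x)=x$, $\mathrm{D}R_x(0_x)=\mathrm{id}$). $\mathcal I=\{1,\dots,m\}$, $\mathcal E=\{m+1,\dots,m+\ell\}\neq\emptyset$, $\mathcal L=\mathcal I\cup\mathcal E$; $f,c_i:\mathcal M\to\mathbb R$ ($i\in\mathcal L$) are twice continuously differentiable; $\mathrm{grad}$ is the Riemannian gradient. Problem (P): minimize $f(x)$ over $x\in\mathcal M$ subject to $c_i(x)\le0$ ($i\in\mathcal I$), $c_i(x)=0$ ($i\in\mathcal E$); its feasible set is $\mathcal F_P$. For $\rho>0$ let $F_\rho=f-\rho\sum_{i\in\mathcal E}c_i$; problem (P$_\rho$): minimize $F_\rho(x)$ over $x\in\mathcal M$ subject to $c_i(x)\le0$, $i\in\mathcal L$; its feasible set is $\mathcal F$, and $\mathrm{int}\mathcal F=\{x\in\mathcal M: c_i(x)<0\ \forall i\in\mathcal L\}$. Put $\mathcal I(x)=\{i\in\mathcal I:c_i(x)=0\}$, $\mathcal E(x)=\{i\in\mathcal E:c_i(x)=0\}$, $\mathcal L(x)=\{i\in\mathcal L:c_i(x)=0\}$. For $\lambda\in\mathbb R^{m+\ell}$, $\lambda_{\mathcal S}=(\lambda_i)_{i\in\mathcal S}$; $e$ is the all-ones vector; vector inequalities are componentwise. $(x,\lambda)$ is a KKT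 pair of (P) if $x\in\mathcal F_P$, $\mathrm{grad}f(x)+\sum_{i\in\mathcal L}\lambda_i\mathrm{grad}\,c_i(x)=0_x$, and $\lambda_i\ge0$, $\lambda_ic_i(x)=0$ for $i\in\mathcal I$. $(x,\lambda)$ is a KKT pair of (P$_\rho$) if $x\in\mathcal F$, $\mathrm{grad}F_\rho(x)+\sum_{i\in\mathcal L}\lambda_i\mathrm{grad}\,c_i(x)=0_x$, and $\lambda_i\ge0$, $\lambda_ic_i(x)=0$ for $i\in\mathcal L$. In a KKT pair, $x$ is a KKT point and $\lambda$ a KKT multiplier. Algorithm RQO-free. Parameters: $\nu>2$, $\tau\in(0,1)$, $\varrho\in(2,3)$, $\kappa\in(0,1)$, $\sigma\in(0,1/2)$, $\varsigma\in(0,1)$, $\tilde\rho>1$, $\rho_0,r_1,r_2,r_3,\bar\mu>0$, $\mu_i^0\in(0,\bar\mu]$ ($i\in\mathcal L$). Start with $x^0\in\mathrm{int}\mathcal F$ and a symmetric positive definite linear operator $\mathcal H_0$ on $T_{x^0}\mathcal M$. At iteration $k=0,1,\dots$ set, for $i\in\mathcal L$, $\alpha_i^k=1+c_i(x^k)/\sqrt{c_i(x^k)^2+(\mu_i^k)^2}$, $\beta_i^k=\bigl(1-\mu_i^k/\sqrt{c_i(x^k)^2+(\mu_i^k)^2}\bigr)^{1/2}$, $\delta_i^k=-\beta_i^k/c_i(x^k)$. For $v\in\mathbb R^{m+\ell}$ let $\mathrm{LS}_k(v)$ be the linear system in $(\eta,\lambda)\in T_{x^k}\mathcal M\times\mathbb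 R^{m+\ell}$: $\mathcal H_k[\eta]+\sum_{i\in\mathcal L}\lambda_i\mathrm{grad}\,c_i(x^k)=-\mathrm{grad}F_{\rho_k}(x^k)$ and $\alpha_i^k\langle\mathrm{grad}\,c_i(x^k),\eta\rangle-\sqrt2\beta_i^k\lambda_i=v_i$, $i\in\mathcal L$. 1. $(\eta^{k0},\lambda^{k0})$ solves $\mathrm{LS}_k(0)$. If $\|\eta^{k0}\|\le r_1$, and not $\lambda^{k0}_{\mathcal E}\ge r_2e$, and $\lambda^{k0}\ge-r_3e$, set $\rho_{k+1}=\tilde\rho\rho_k$, $x^{k+1}=x^k$, $\mathcal H_{k+1}=\mathcal H_k$, $\mu^{k+1}=\mu^k$ and go to iteration $k+1$. 2. Otherwise $(\eta^{k1},\lambda^{k1})$ solves $\mathrm{LS}_k(v^{k1})$ with $v_i^{k1}=\alpha_i^k(\min\{\lambda_i^{k0},0\})^3$; $(\eta^{k2},\lambda^{k2})$ solves $\mathrm{LS}_k(v^{k2})$ with $v^{k2}_i=v^{k1}_i-\alpha_i^k\|\eta^{k1}\|^\nu$. Set $\theta_k=1$ if $\langle\mathrm{grad}F_{\rho_k}(x^k),\eta^{k2}\rangle\le\tau\langle\mathrm{grad}F_{\rho_k}(x^k),\eta^{k1}\rangle$ and $\theta_k=\frac{(1-\tau)\langle\mathrm{grad}F_{\rho_k}(x^k),\eta^{k1}\rangle}{\langle\mathrm{grad}F_{\rho_k}(x^k),\eta^{k1}-\eta^{k2}\rangle}$ otherwise. Set $\eta^k=(1-\theta_k)\eta^{k1}+\theta_k\eta^{k2}$,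 $\lambda^k=(1-\theta_k)\lambda^{k1}+\theta_k\lambda^{k2}$. 3. Let $\mathcal L_k=\{i\in\mathcal L:c_i(x^k)\ge-\lambda_i^k\}$ and $\varpi_k=\max\{\|\eta^k\|^\varrho,\ \max_{i\in\mathcal L_k}|\frac{\alpha_i^k}{\sqrt2\delta_i^k\lambda_i^k}-1|^\kappa\|\eta^k\|^2\}$. Let $\tilde\eta^k$ be the solution of: minimize $\frac12\langle\eta,\mathcal H_k[\eta]\rangle$ over $\eta\in T_{x^k}\mathcal M$ subject to $c_i(R_{x^k}(\eta^k))+\langle\mathrm{grad}\,c_i(x^k),\eta\rangle=-\varpi_k$ for $i\in\mathcal L_k$. If there is no solution or $\|\tilde\eta^k\|>\|\eta^k\|$, set $\tilde\eta^k=0_{x^k}$. 4. (Arc search) $t_k$ is the first $t$ in $1,\varsigma,\varsigma^2,\dots$ with $F_{\rho_k}(R_{x^k}(t\eta^k+t^2\tilde\eta^k))\le F_{\rho_k}(x^k)+\sigma t\langle\mathrm{grad}F_{\rho_k}(x^k),\eta^k\rangle$ and $c_i(R_{x^k}(t\eta^k+t^2\tilde\eta^k))<0$ for all $i\in\mathcal L$. 5. Set $x^{k+1}=R_{x^k}(t_k\eta^k+t_k^2\tilde\eta^k)$, $\rho_{k+1}=\rho_k$, $\mu_i^{k+1}=\min\{\max\{\lambda_i^{k0},\|\eta^k\|\},\bar\mu\}$ ($i\in\mathcal L$), and choose any symmetric positive definite linear operator $\mathcal H_{k+1}$ on $T_{x^{k+1}}\mathcal M$. Conventions. $\{a_k\}_{\mathcal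 K}$ is the subsequence indexed by the infinite set $\mathcal K$. Under hypotheses (a)-(d) of the claim, $\rho_k$ is updated only finitely often, so $\rho_k=\bar\rho$ for all $k\ge\bar k$, for some $\bar k$ and $\bar\rho>0$. *)

(* Defs.v *)
From HB Require Import structures.
From mathcomp Require Import all_boot all_order all_algebra.
From mathcomp Require Import all_classical all_reals all_analysis.

Set Implicit Arguments.
Unset Strict Implicit.
Unset Printing Implicit Defensive.

Import Order.TTheory GRing.Theory Num.Theory.
Import numFieldNormedType.Exports.

Local Open Scope classical_set_scope.
Local Open Scope ring_scope.

(* C^k on an open set U, by iterated directional derivatives; this is the usual
   notion when V is finite dimensional, the only case used below. *)
Fixpoint Ck (R : realType) (V W : normedModType R) (k : nat) (U : set V)
    (h : V -> W) : Prop :=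
  if k is k'.+1 then
    (forall x, U x -> differentiable h x) /\ (forall v, Ck k' U ('D_v h))
  else forall x, U x -> {for x, continuous h}.

Definition smooth (R : realType) (V W : normedModType R) (U : set V)
    (h : V -> W) : Prop :=
  forall k, Ck k U h.

(* The atlas is indexed by the points of the manifold, [chart p] being a chart
   around p.  This loses no generality, and it singles out a chart at each x,
   through which T_x M is identified with R^n: throughout, a tangent vector at x
   is its coordinate vector in [chart x].  [chart p] and [chart_inv p] are total
   functions, meaningful only on [dom p] and [chart p @` dom p]. *)
Record smoothManifold (R : realType) (n : nat) := SmoothManifold {
  carrier :> topologicalType;
  dom : carrier -> set carrier;
  chart : carrier -> carrier -> 'rV[R]_n;
  chart_inv : carrier -> 'rV[R]_n -> carrier;
  mfd_hausdorff : hausdorff_space carrier;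
  mfd_second_countable : @second_countable carrier;
  dom_open : forall p, open (dom p);
  dom_self : forall p, dom p p;
  chart_open : forall p, open (chart p @` dom p);
  chartK : forall p x, dom p x -> chart_inv p (chart p x) = x;
  chart_continuous : forall p x, dom p x -> {for x, continuous (chart p)};
  chart_inv_continuous : forall p y, (chart p @` dom p) y ->
    {for y, continuous (chart_inv p)};
  transition_smooth : forall p q,
    smooth (chart p @` (dom p `&` dom q)) (chart q \o chart_inv p) }.

Arguments dom {R n s} _ _.
Arguments chart {R n s} _ _.
Arguments chart_inv {R n s} _ _.

(* The tangent vector at [chart_inv p y] with coordinates v in [chart p]. *)
Definition tangent_at (R : realType) (n : nat) (M : smoothManifold R n) (p : M)
    (y v : 'rV[R]_n) : 'rV[R]_n :=
  'd (chart (chart_inv p y) \o chart_inv p) y v.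

Record riemannianManifold (R : realType) (n : nat) := RiemannianManifold {
  manifold :> smoothManifold R n;
  metric : manifold -> 'rV[R]_n -> 'rV[R]_n -> R;
  metricC : forall x u v, metric x u v = metric x v u;
  metric_linear : forall x a u v w,
    metric x (a *: u + v) w = a * metric x u w + metric x v w;
  metric_gt0 : forall x u, u != 0 -> 0 < metric x u u;
  metric_smooth : forall p u v,
    smooth (chart p @` dom p)
      (fun y => metric (chart_inv p y) (tangent_at p y u) (tangent_at p y v)) }.

Arguments metric {R n r} _ _ _.

Section Riemannian.
Context {R : realType} {n : nat} {M : riemannianManifold R n}.
Implicit Types (x y p q : M) (u v : 'rV[R]_n) (h : M -> R).

Definition tnorm x u : R := Num.sqrt (metric x u u).

(* Every C^1 curve on [0, 1] is the restriction of a C^1 curve on R. *)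
Definition C1_curve (g : R -> M) : Prop :=
  continuous g /\ forall p, Ck 1 (g @^-1` dom p) (chart p \o g).

Definition velocity (g : R -> M) (t : R) : 'rV[R]_n :=
  derive1 (chart (g t) \o g) t.

Definition arc_length (g : R -> M) : \bar R :=
  (\int[lebesgue_measure]_(t in `[0%R, 1%R]) (tnorm (g t) (velocity g t))%:E)%E.

(* [pw_C1_path x y l]: a piecewise C^1 curve of length l goes from x to y. *)
Inductive pw_C1_path : M -> M -> \bar R -> Prop :=
| PwC1 (g : R -> M) : C1_curve g -> pw_C1_path (g 0) (g 1) (arc_length g)
| PwCat x y z a b : pw_C1_path x y a -> pw_C1_path y z b ->
    pw_C1_path x z (a + b)%E.

(* Equal to +oo between distinct connected components. *)
Definition rdist x y : \bar R := ereal_inf [set l | pw_C1_path x y l].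

Definition complete_manifold : Prop :=
  forall w : nat -> M,
    (forall e : R, 0 < e -> exists N : nat, forall i j : nat,
      (N <= i)%N -> (N <= j)%N -> (rdist (w i) (w j) < e%:E)%E) ->
    exists x, rdist (w i) x @[i --> \oo] --> 0%E.

Definition bounded_seq (w : nat -> M) : Prop :=
  exists p (B : R), forall k, (rdist p (w k) <= B%:E)%E.

Definition C2_mfd h : Prop :=
  forall p, Ck 2 (chart p @` dom p) (h \o chart_inv p).

Definition grad h x : 'rV[R]_n :=
  xget 0 [set u | forall v, metric x u v = 'd (h \o chart_inv x) (chart x x) v].

(* Smoothness of [retr] as a map TM -> M is expressed in the charts of TM induced
   by those of M, which send R^n x R^n to TM by
   z |-> (chart_inv p z.1, tangent_at p z.1 z.2). *)
Definition retr_in_chart (retr : M -> 'rV[R]_n -> M) p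
    (z : 'rV[R]_n * 'rV[R]_n) : M :=
  retr (chart_inv p z.1) (tangent_at p z.1 z.2).

Definition retraction (retr : M -> 'rV[R]_n -> M) : Prop :=
  [/\ forall p z, (chart p @` dom p) z.1 ->
        {for z, continuous (retr_in_chart retr p)},
      forall p q,
        smooth [set z | (chart p @` dom p) z.1 /\ dom q (retr_in_chart retr p z)]
               (chart q \o retr_in_chart retr p),
      forall x, retr x 0 = x &
      forall x v, 'd (chart x \o retr x) 0 v = v].

Definition sym_posdef x (H : 'End('rV[R]_n)) : Prop :=
  (forall u v, metric x (H u) v = metric x u (H v)) /\
  (forall u, u != 0 -> 0 < metric x (H u) u).

End Riemannian.

(* The indices are 'I_(m + l): [lshift l i] for the inequality constraints,
   [rshift m i] for the equality constraints. *)
Section Problems.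
Context {R : realType} {n m l : nat} {M : riemannianManifold R n}.
Context (f : M -> R) (c : 'I_(m + l) -> M -> R).

Definition feasible_P : set M :=
  [set x | (forall i : 'I_m, c (lshift l i) x <= 0) /\
           (forall i : 'I_l, c (rshift m i) x = 0)].

Definition feasible : set M := [set x | forall i, c i x <= 0].

Definition int_feasible : set M := [set x | forall i, c i x < 0].

Definition penalized (rho : R) (x : M) : R :=
  f x - rho * \sum_(i < l) c (rshift m i) x.

Definition KKT_P (x : M) (lam : 'rV[R]_(m + l)) : Prop :=
  [/\ feasible_P x,
      grad f x + \sum_i lam 0 i *: grad (c i) x = 0 &
      forall i : 'I_m, 0 <= lam 0 (lshift l i) /\
                       lam 0 (lshift l i) * c (lshift l i) x = 0].

Definition KKT_Prho (rho : R) (x : M) (lam : 'rV[R]_(m + l)) : Prop :=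
  [/\ feasible x,
      grad (penalized rho) x + \sum_i lam 0 i *: grad (c i) x = 0 &
      forall i, 0 <= lam 0 i /\ lam 0 i * c i x = 0].

Definition LICQ (x : M) : Prop :=
  free [seq grad (c i) x | i <- enum 'I_(m + l) & c i x == 0].

Definition no_dual_combination (x : M) : Prop :=
  ~ exists (u : 'I_m -> R) (v : 'I_l -> R),
    [/\ forall i, c (lshift l i) x = 0 -> 0 <= u i,
        forall i, c (rshift m i) x = 0 -> 0 <= v i &
        \sum_(i < l) grad (c (rshift m i)) x
        - \sum_(i < m | c (lshift l i) x == 0) u i *: grad (c (lshift l i)) x
        - \sum_(i < l | c (rshift m i) x == 0) v i *: grad (c (rshift m i)) x
        = 0].

End Problems.

Record rqo_params (R : realType) (m l : nat) := RqoParams {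
  nu : R; tau : R; varrho : R; kappa : R; sigma : R; varsigma : R;
  rho_factor : R; rho_init : R; r1 : R; r2 : R; r3 : R; mu_bar : R;
  mu_init : 'rV[R]_(m + l);
  nuP : 2 < nu;
  tauP : 0 < tau < 1;
  varrhoP : 2 < varrho < 3;
  kappaP : 0 < kappa < 1;
  sigmaP : 0 < sigma < 1 / 2;
  varsigmaP : 0 < varsigma < 1;
  rho_factorP : 1 < rho_factor;
  rho_initP : 0 < rho_init;
  r1P : 0 < r1;
  r2P : 0 < r2;
  r3P : 0 < r3;
  mu_barP : 0 < mu_bar;
  mu_initP : forall i, 0 < mu_init 0 i <= mu_bar }.

Record rqo_state (R : realType) (n d : nat) (M : riemannianManifold R n) :=
  RqoState {
    st_x : M;
    st_H : 'End('rV[R]_n);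
    st_rho : R;
    st_mu : 'rV[R]_d }.

Section Algorithm.
Context {R : realType} {n m l : nat} {M : riemannianManifold R n}.
Context (retr : M -> 'rV[R]_n -> M) (f : M -> R) (c : 'I_(m + l) -> M -> R).
Context (P : rqo_params R m l).
Implicit Types (s : rqo_state (m + l) M) (eta teta : 'rV[R]_n).
Implicit Types (lam v : 'rV[R]_(m + l)).

Definition alpha s i : R :=
  1 + c i (st_x s) / Num.sqrt (c i (st_x s) ^+ 2 + st_mu s 0 i ^+ 2).

Definition beta s i : R :=
  Num.sqrt (1 - st_mu s 0 i /
                Num.sqrt (c i (st_x s) ^+ 2 + st_mu s 0 i ^+ 2)).

Definition delta s i : R := - beta s i / c i (st_x s).

Definition gradF s : 'rV[R]_n := grad (penalized f c (st_rho s)) (st_x s).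

Definition LS s v eta lam : Prop :=
  st_H s eta + \sum_i lam 0 i *: grad (c i) (st_x s) = - gradF s /\
  forall i, alpha s i * metric (st_x s) (grad (c i) (st_x s)) eta
            - Num.sqrt 2 * beta s i * lam 0 i = v 0 i.

Definition penalty_test s eta0 lam0 : bool :=
  [&& tnorm (st_x s) eta0 <= r1 P,
      ~~ [forall i : 'I_l, r2 P <= lam0 0 (rshift m i)] &
      [forall i, - r3 P <= lam0 0 i]].

Definition v1 s lam0 : 'rV[R]_(m + l) :=
  \row_i (alpha s i * Num.min (lam0 0 i) 0 ^+ 3).

Definition v2 s lam0 eta1 : 'rV[R]_(m + l) :=
  \row_i (v1 s lam0 0 i - alpha s i * tnorm (st_x s) eta1 `^ nu P).

Definition theta s eta1 eta2 : R :=
  let g := metric (st_x s) (gradF s) in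
  if g eta2 <= tau P * g eta1 then 1
  else (1 - tau P) * g eta1 / g (eta1 - eta2).

Definition working_set s lam : pred 'I_(m + l) :=
  fun i => - lam 0 i <= c i (st_x s).

(* Both arguments of the outer maximum being nonnegative, the default value 0 of
   the inner one is harmless when the working set is empty. *)
Definition varpi s eta lam : R :=
  Num.max (tnorm (st_x s) eta `^ varrho P)
    (\big[Num.max/0]_(i | working_set s lam i)
       (`|alpha s i / (Num.sqrt 2 * delta s i * lam 0 i) - 1| `^ kappa P
        * tnorm (st_x s) eta ^+ 2)).

Definition correction_feasible s eta lam teta : Prop :=
  forall i, working_set s lam i ->
    c i (retr (st_x s) eta) + metric (st_x s) (grad (c i) (st_x s)) teta
    = - varpi s eta lam.

Definition correction_solution s eta lam teta : Prop :=
  correction_feasible s eta lam teta /\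
  forall xi, correction_feasible s eta lam xi ->
    2^-1 * metric (st_x s) teta (st_H s teta)
    <= 2^-1 * metric (st_x s) xi (st_H s xi).

Definition correction s eta lam teta : Prop :=
  (correction_solution s eta lam teta /\
     tnorm (st_x s) teta <= tnorm (st_x s) eta) \/
  ((forall xi, correction_solution s eta lam xi ->
      tnorm (st_x s) eta < tnorm (st_x s) xi) /\ teta = 0).

Definition arc s eta teta (t : R) : M :=
  retr (st_x s) (t *: eta + t ^+ 2 *: teta).

Definition arc_accept s eta teta (t : R) : Prop :=
  penalized f c (st_rho s) (arc s eta teta t)
    <= penalized f c (st_rho s) (st_x s)
       + sigma P * t * metric (st_x s) (gradF s) eta
  /\ int_feasible c (arc s eta teta t).

Definition arc_step s eta teta (t : R) : Prop :=
  exists j : nat,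
    [/\ t = varsigma P ^+ j,
        arc_accept s eta teta (varsigma P ^+ j) &
        forall i : nat, (i < j)%N -> ~ arc_accept s eta teta (varsigma P ^+ i)].

(* One iteration, from state s to state s', in which (eta0, lam0) is the solution
   of the first linear system. *)
Definition rqo_step s eta0 lam0 s' : Prop :=
  LS s 0 eta0 lam0 /\
  if penalty_test s eta0 lam0 then
    s' = RqoState (st_x s) (st_H s) (rho_factor P * st_rho s) (st_mu s)
  else
    exists eta1 lam1 eta2 lam2 teta (t : R),
      let th := theta s eta1 eta2 in
      let eta := (1 - th) *: eta1 + th *: eta2 in
      let lam := (1 - th) *: lam1 + th *: lam2 in
      [/\ LS s (v1 s lam0) eta1 lam1,
          LS s (v2 s lam0 eta1) eta2 lam2,
          correction s eta lam teta,
          arc_step s eta teta t &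
          [/\ st_x s' = arc s eta teta t,
              st_rho s' = st_rho s,
              forall i, st_mu s' 0 i =
                Num.min (Num.max (lam0 0 i) (tnorm (st_x s) eta)) (mu_bar P) &
              sym_posdef (st_x s') (st_H s')]].

Definition rqo_free (s : nat -> rqo_state (m + l) M) (eta0 : nat -> 'rV[R]_n)
    (lam0 : nat -> 'rV[R]_(m + l)) : Prop :=
  [/\ int_feasible c (st_x (s 0)),
      sym_posdef (st_x (s 0)) (st_H (s 0)),
      st_rho (s 0) = rho_init P,
      st_mu (s 0) = mu_init P &
      forall k, rqo_step (s k) (eta0 k) (lam0 k) (s k.+1)].

End Algorithm.

(* Main.v *)
Require Import Defs.
From mathcomp Require Import all_boot all_order all_algebra.
From mathcomp Require Import all_classical all_reals all_analysis.
From mathcomp Require Import ring lra.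

(** Each iteration that moves the iterate comes with a prediction, the opposite of
    the slope of the penalized objective along the second direction. Its exact
    value ([LS1_descent]) is a sum of nonnegative terms, which control the first
    direction and the negative parts of the first multipliers. Where predictions
    tend to zero, the complementarity rows then annihilate the multipliers of the
    inactive constraints, and limits of the first multipliers are KKT multipliers
    of the penalized problem; the penalty test having failed, the multipliers of
    the equality constraints have positive limits, so that complementarity makes
    the limit point feasible, and a KKT point, for the original problem
    ([stationary_limit]).

    The penalty parameter is updated finitely often ([penalty_bounded]): otherwise
    the multipliers, divided by a diverging normalization, converge to a dual
    combination ruled out by the hypotheses at infeasible points; at feasible
    points the constraint qualification forces the multipliers of the equality
    constraints to be of the order of the penalty parameter, and the penalty test
    fails. The same rescaling bounds the solutions of all the linear systems
    ([LS_bounded]).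

    From then on the values of one penalized objective decrease and converge. If
    the predictions and all the smoothing parameters stayed away from zero along
    the given subsequence, then so would the step lengths
    ([step_bounded_below]): the third direction pushes away from the nearly active
    constraints ([active_slope]), and the expansion of C^1 functions along the
    arcs of the search is uniform ([arc_expansion]). This would contradict the
    convergence of the values. If the predictions stay away from zero, some
    smoothing parameter is thus small, which by its definition means that the
    previous direction was small. The previous iterates then converge to the same limit,
    with vanishing predictions, and the first case applies to them
    ([previous_stationary]).

    The analysis on the manifold rests on two facts. Tangent vectors at different
    points are compared through their coordinates in the chart at the limit, where
    gradients, metric and retraction depend continuously on the base point. And
    bounded sequences converge along ultrafilters ([bounded_ultra_cvg]): this is the
    Hopf-Rinow theorem, obtained from the 1-Lipschitz parametrization of paths and
    from the fact that small balls of the distance are relatively compact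
    ([rdist_compact_nbhd]) and are neighbourhoods ([rdist_near]).

    Limits are taken along ultrafilters that contain the tail of the given
    subsequence: all the bounded quantities converge at once, and a property that
    does not hold eventually fails eventually. A subsequence is extracted only at
    the end ([ultra_subsequence]). *)

Set Implicit Arguments.
Unset Strict Implicit.
Unset Printing Implicit Defensive.

Import Order.TTheory GRing.Theory Num.Theory.
Import numFieldNormedType.Exports.

Local Open Scope classical_set_scope.
Local Open Scope ring_scope.

(** * Limits of matrices *)

Section MatrixLimits.
Context {R : realType} {T : Type} {F : set_system T} {FF : Filter F}.

Lemma cvg_mx m n (A : T -> 'M[R]_(m, n)) (B : 'M[R]_(m, n)) :
  (forall i j, A t i j @[t --> F] --> B i j) -> A t @[t --> F] --> B.
Proof.
move=> AB; apply/cvgrPdist_le => e e0; near=> t.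
rewrite [leLHS]/Num.Def.normr/= mx_normrE (bigmax_le _ (ltW e0))//= => i _.
rewrite !mxE; move: i; near: t; apply: filter_forall => -[i j] /=.
exact: ((cvgrPdist_le _ _).1 (AB i j)).
Unshelve. all: by end_near. Qed.

Lemma cvg_coord m n (A : T -> 'M[R]_(m, n)) (B : 'M[R]_(m, n)) i j :
  A t @[t --> F] --> B -> A t i j @[t --> F] --> B i j.
Proof.
by move=> AB; exact: (cvg_comp _ _ AB (@coord_continuous _ _ _ i j B)).
Qed.

Lemma cvg_sum_fin (I : finType) (P : pred I) (f : I -> T -> R) (a : I -> R) :
  (forall i, P i -> f i t @[t --> F] --> a i) ->
  \sum_(i | P i) f i t @[t --> F] --> \sum_(i | P i) a i.
Proof.
move=> fa; rewrite (_ : (fun t => _) = \sum_(i | P i) f i); last first.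
  by apply/funext => t; rewrite fct_sumE.
elim/big_ind2 : _ => [|? ? ? ?|i Pi]; [exact: cvg_cst|exact: cvgD|exact: fa].
Qed.

Lemma cvg_prod_fin (I : finType) (P : pred I) (f : I -> T -> R) (a : I -> R) :
  (forall i, P i -> f i t @[t --> F] --> a i) ->
  \prod_(i | P i) f i t @[t --> F] --> \prod_(i | P i) a i.
Proof.
move=> fa; rewrite (_ : (fun t => _) = \prod_(i | P i) f i); last first.
  by apply/funext => t; rewrite fct_prodE.
elim/big_ind2 : _ => [|? ? ? ?|i Pi]; [exact: cvg_cst|exact: cvgM|exact: fa].
Qed.

Lemma cvg_mulmx m n p (A : T -> 'M[R]_(m, n)) (B : T -> 'M[R]_(n, p))
    (a : 'M[R]_(m, n)) (b : 'M[R]_(n, p)) :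
  A t @[t --> F] --> a -> B t @[t --> F] --> b ->
  A t *m B t @[t --> F] --> a *m b.
Proof.
move=> Aa Bb; apply: cvg_mx => i j; rewrite mxE.
under eq_cvg do rewrite mxE.
by apply: cvg_sum_fin => k _; apply: cvgM; exact: cvg_coord.
Qed.

Lemma cvg_trmx m n (A : T -> 'M[R]_(m, n)) (a : 'M[R]_(m, n)) :
  A t @[t --> F] --> a -> (A t)^T @[t --> F] --> a^T.
Proof.
move=> Aa; apply: cvg_mx => i j; rewrite mxE; under eq_cvg do rewrite mxE.
exact: cvg_coord.
Qed.

Lemma cvg_det n (A : T -> 'M[R]_n) (a : 'M[R]_n) :
  A t @[t --> F] --> a -> \det (A t) @[t --> F] --> \det a.
Proof.
move=> Aa; rewrite /determinant; apply: cvg_sum_fin => s _.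
apply: cvgMl_tmp; apply: cvg_prod_fin => i _; exact: cvg_coord.
Qed.

(** Cramer's rule makes the entries of the inverse continuous. *)
Lemma cvg_invmx n (A : T -> 'M[R]_n) (a : 'M[R]_n) : a \in unitmx ->
  (\forall t \near F, A t \in unitmx) ->
  A t @[t --> F] --> a -> invmx (A t) @[t --> F] --> invmx a.
Proof.
move=> ua uA Aa.
have adjA : (\det (A t))^-1 *: \adj (A t) @[t --> F] --> (\det a)^-1 *: \adj a.
  apply: cvgZ.
    by apply: cvgV; [rewrite -unitfE -unitmxE|exact: cvg_det].
  apply: cvg_mx => i j; rewrite mxE; under eq_cvg do rewrite mxE.
  apply: cvgMl_tmp; apply: cvg_det; apply: cvg_mx => i' j'.
  by rewrite !mxE; under eq_cvg do rewrite !mxE; exact: cvg_coord.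
rewrite {2}/invmx ua; apply: cvg_trans adjA; apply: near_eq_cvg.
by near=> t; rewrite /invmx (near uA t).
Unshelve. all: by end_near. Qed.

End MatrixLimits.

(** * Charts and coordinates of tangent vectors *)

Section DiffGerm.
Context {R : realType}.

Lemma differentiable_near_eq (V W : normedModType R) (f g : V -> W) x :
  {near x, f =1 g} -> differentiable f x -> differentiable g x.
Proof.
move=> fg /diff_locallyP[df fE]; have fgx : f x = g x := nbhs_singleton fg.
have dfg : g \o shift x = cst (g x) + 'd f x +o_ 0 id.
  apply/eqaddoP => e e0; have /eqaddoP/(_ _ e0) := fE.
  have fg0 : \forall h \near (0 : V), f (h + x) = g (h + x).
    rewrite (near_shift x)/=; by apply: filterS fg => z; rewrite /= sub0r subrK.
  apply: filterS2 fg0 => h /= fgh.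
  by rewrite !fctE /= -fgx -fgh.
apply/diff_locallyP; have -> : 'd g x = 'd f x :> (V -> W) by exact: diff_unique.
by [].
Qed.

Lemma diff_near_eq (V W : normedModType R) (f g : V -> W) x v :
  {near x, f =1 g} -> differentiable f x -> 'd f x v = 'd g x v.
Proof.
move=> fg df; rewrite -!deriveE//; first exact: near_eq_derive.
exact: differentiable_near_eq df.
Qed.
End DiffGerm.

Section Charts.
Context {R : realType} {n : nat} {M : smoothManifold R n}.
Implicit Types (p q r x : M).

Lemma chart_invK p y : (chart p @` dom p) y -> chart p (chart_inv p y) = y.
Proof. by move=> [x px <-]; rewrite chartK. Qed.

Lemma dom_chart_inv p y : (chart p @` dom p) y -> dom p (chart_inv p y).
Proof. by move=> [x px <-]; rewrite chartK. Qed.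

Lemma near_dom p x : dom p x -> \forall z \near x, dom p z.
Proof. by move=> px; apply: open_nbhs_nbhs; split => //; exact: dom_open. Qed.

Lemma near_image p x : dom p x -> \forall y \near chart p x, (chart p @` dom p) y.
Proof.
move=> px; apply: open_nbhs_nbhs; split; first exact: chart_open.
by exists x.
Qed.

Lemma near_chart_inv p x (A : set M) : dom p x ->
  (\forall z \near x, A z) -> \forall y \near chart p x, A (chart_inv p y).
Proof.
move=> px xA; have ipx : (chart p @` dom p) (chart p x) by exists x.
have Ax : nbhs (chart_inv p (chart p x)) A by rewrite chartK.
exact: (chart_inv_continuous ipx Ax).
Qed.

Lemma transition_differentiable p q x : dom p x -> dom q x ->
  differentiable (chart q \o chart_inv p) (chart p x).
Proof.
move=> px qx; have [+ _] := @transition_smooth _ _ _ p q 1%N; apply.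
by exists x.
Qed.

(** The chain rule, [chart q] being [chart p] followed by a transition map: what is
    known of the differential in one chart transfers to all the others. *)
Lemma diff_chart_change (W : normedModType R) p q x (h : M -> W) v :
  dom p x -> dom q x ->
  differentiable (h \o chart_inv p) (chart p x) ->
  'd (h \o chart_inv q) (chart q x) v
  = 'd (h \o chart_inv p) (chart p x) ('d (chart p \o chart_inv q) (chart q x) v).
Proof.
move=> px qx dh.
have cx : (chart p \o chart_inv q) (chart q x) = chart p x.
  by rewrite /= chartK.
pose k := (h \o chart_inv p) \o (chart p \o chart_inv q).
have dt := transition_differentiable qx px.
have dh' : differentiable (h \o chart_inv p)
    ((chart p \o chart_inv q) (chart q x)) by rewrite cx.
transitivity ('d k (chart q x) v).
  apply/esym/diff_near_eq; last exact: differentiable_comp.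
  have := near_chart_inv qx (near_dom px).
  by apply: filterS => y py /=; rewrite /k /= chartK.
have kE := diff_comp dt dh'; rewrite cx in kE.
exact: (congr1 (fun F : _ -> W => F v) kE).
Qed.

(** The coordinates in [chart p] of a tangent vector at [x], itself given by its
    coordinates in [chart x]; the inverse of [tangent_at p (chart p x)]. *)
Definition coord_at p x (u : 'rV[R]_n) : 'rV[R]_n :=
  'd (chart p \o chart_inv x) (chart x x) u.

Lemma coord_atD p x u v : coord_at p x (u + v) = coord_at p x u + coord_at p x v.
Proof. exact: linearD. Qed.

Lemma coord_atZ p x a u : coord_at p x (a *: u) = a *: coord_at p x u.
Proof. exact: linearZ. Qed.

Lemma coord_atB p x u v : coord_at p x (u - v) = coord_at p x u - coord_at p x v.
Proof. exact: linearB. Qed.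

Lemma coord_at_sum p x (I : Type) (r : seq I) (P : pred I) (u : I -> 'rV[R]_n) :
  coord_at p x (\sum_(i <- r | P i) u i) = \sum_(i <- r | P i) coord_at p x (u i).
Proof. exact: linear_sum. Qed.

Lemma diff_chart_id p x v : dom p x ->
  'd (chart p \o chart_inv p) (chart p x) v = v.
Proof.
move=> px; rewrite -[RHS](_ : 'd id (chart p x) v = v); last first.
  by rewrite diff_val.
apply: diff_near_eq; last exact: transition_differentiable.
by have := near_image px; apply: filterS => y py /=; rewrite chart_invK.
Qed.

Lemma coord_atK p x u : dom p x ->
  tangent_at p (chart p x) (coord_at p x u) = u.
Proof.
move=> px; rewrite /tangent_at chartK// /coord_at.
rewrite -(@diff_chart_change _ p x x (chart x))//; first 1 last.
- exact: dom_self.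
- apply: transition_differentiable => //; exact: dom_self.
by rewrite diff_chart_id//; exact: dom_self.
Qed.

Lemma tangent_atK p x v : dom p x ->
  coord_at p x (tangent_at p (chart p x) v) = v.
Proof.
move=> px; rewrite /tangent_at chartK// /coord_at.
rewrite -(@diff_chart_change _ x p x (chart p))//; first 1 last.
- exact: dom_self.
- apply: transition_differentiable => //; exact: dom_self.
by rewrite diff_chart_id.
Qed.

Lemma coord_at_self x u : coord_at x x u = u.
Proof. by rewrite /coord_at diff_chart_id//; exact: dom_self. Qed.

Lemma diff_coord_at (W : normedModType R) p x (h : M -> W) u : dom p x ->
  differentiable (h \o chart_inv p) (chart p x) ->
  'd (h \o chart_inv x) (chart x x) u
  = 'd (h \o chart_inv p) (chart p x) (coord_at p x u).
Proof. by move=> px dh; apply: diff_chart_change => //; exact: dom_self. Qed.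

End Charts.

(** * The metric and gradients in charts *)

Section MetricAlgebra.
Context {R : realType} {n : nat} {M : riemannianManifold R n}.
Implicit Types (x : M) (u v w : 'rV[R]_n).

Lemma metricDl x u v w : metric x (u + v) w = metric x u w + metric x v w.
Proof. by rewrite -[u in LHS]scale1r metric_linear mul1r. Qed.

Lemma metric0l x w : metric x 0 w = 0.
Proof. by apply: (addrI (metric x 0 w)); rewrite -metricDl !addr0. Qed.

Lemma metricZl x a u w : metric x (a *: u) w = a * metric x u w.
Proof. by rewrite -[a *: u]addr0 metric_linear metric0l addr0. Qed.

Lemma metricNl x u w : metric x (- u) w = - metric x u w.
Proof. by rewrite -scaleN1r metricZl mulN1r. Qed.

Lemma metricBl x u v w : metric x (u - v) w = metric x u w - metric x v w.
Proof. by rewrite metricDl metricNl. Qed.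

Lemma metric_suml x (I : Type) (r : seq I) (P : pred I) (u : I -> 'rV[R]_n) w :
  metric x (\sum_(i <- r | P i) u i) w = \sum_(i <- r | P i) metric x (u i) w.
Proof.
by apply: (big_morph (fun u => metric x u w)) => [? ?|];
  rewrite ?metricDl ?metric0l.
Qed.

Lemma metricDr x u v w : metric x w (u + v) = metric x w u + metric x w v.
Proof. by rewrite metricC metricDl !(metricC x w). Qed.

Lemma metric0r x w : metric x w 0 = 0.
Proof. by rewrite metricC metric0l. Qed.

Lemma metricZr x a u w : metric x w (a *: u) = a * metric x w u.
Proof. by rewrite metricC metricZl metricC. Qed.

Lemma metricNr x u w : metric x w (- u) = - metric x w u.
Proof. by rewrite metricC metricNl metricC. Qed.

Lemma metricBr x u v w : metric x w (u - v) = metric x w u - metric x w v.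
Proof. by rewrite metricDr metricNr. Qed.

Lemma metric_ge0 x u : 0 <= metric x u u.
Proof.
by have [->|/metric_gt0 /ltW//] := eqVneq u 0; rewrite metric0l.
Qed.

Lemma metric_eq0 x u : metric x u u = 0 -> u = 0.
Proof. by move=> u0; apply/eqP/negP => /negP /(metric_gt0 x); rewrite u0 ltxx. Qed.

Lemma metric_inj x u v : (forall w, metric x u w = metric x v w) -> u = v.
Proof.
move=> uv; apply/eqP; rewrite -subr_eq0; apply/eqP.
by apply: (@metric_eq0 x); rewrite metricBl uv subrr.
Qed.

Lemma tnorm_ge0 x u : 0 <= tnorm x u.
Proof. exact: sqrtr_ge0. Qed.

Lemma tnorm_sqr x u : tnorm x u ^+ 2 = metric x u u.
Proof. by rewrite sqr_sqrtr// metric_ge0. Qed.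

Lemma tnorm0 x : tnorm x 0 = 0 :> R.
Proof. by rewrite /tnorm metric0l sqrtr0. Qed.

Lemma tnorm_eq0 x u : tnorm x u = 0 -> u = 0.
Proof. by move=> u0; apply: (@metric_eq0 x); rewrite -tnorm_sqr u0 expr0n. Qed.

Lemma tnormZ x a u : tnorm x (a *: u) = `|a| * tnorm x u.
Proof.
by rewrite /tnorm metricZl metricZr mulrA -expr2 sqrtrM ?sqr_ge0// sqrtr_sqr.
Qed.

Lemma tnormN x u : tnorm x (- u) = tnorm x u.
Proof. by rewrite /tnorm metricNl metricNr opprK. Qed.

Lemma metric_cauchy_schwarz x u v :
  `|metric x u v| <= tnorm x u * tnorm x v.
Proof.
have [->|u0] := eqVneq u 0; first by rewrite metric0l normr0 mulr_ge0 ?tnorm_ge0.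
rewrite -(@ler_pXn2r _ 2) ?nnegrE ?mulr_ge0 ?tnorm_ge0//.
rewrite exprMn !tnorm_sqr real_normK ?num_real//.
have uu := metric_gt0 x u0.
have := metric_ge0 x (metric x u u *: v - metric x u v *: u).
rewrite !(metricBl, metricBr, metricZl, metricZr) (metricC x v u).
set a := metric x u u in uu *; set b := metric x u v; set d := metric x v v.
rewrite (_ : _ - _ = a * (a * d - b ^+ 2)); last by ring.
by rewrite pmulr_rge0// subr_ge0.
Qed.

Lemma metric_le x u v : metric x u v <= tnorm x u * tnorm x v.
Proof. exact: le_trans (ler_norm _) (metric_cauchy_schwarz x u v). Qed.

Lemma tnormD x u v : tnorm x (u + v) <= tnorm x u + tnorm x v.
Proof.
rewrite -(@ler_pXn2r _ 2) ?nnegrE ?addr_ge0 ?tnorm_ge0//.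
rewrite tnorm_sqr sqrrD !tnorm_sqr metricDl !metricDr (metricC x v u).
by have := metric_le x u v; lra.
Qed.

Lemma tnorm_sum x (I : Type) (r : seq I) (P : pred I) (u : I -> 'rV[R]_n) :
  tnorm x (\sum_(i <- r | P i) u i) <= \sum_(i <- r | P i) tnorm x (u i).
Proof.
elim/big_ind2 : _ => // [|a b a' b' ab ab']; first by rewrite tnorm0.
by apply: le_trans (tnormD _ _ _) _; exact: lerD.
Qed.

End MetricAlgebra.

Definition C1_mfd {R : realType} {n : nat} {M : riemannianManifold R n}
    (h : M -> R) : Prop :=
  forall p, Ck 1 (chart p @` dom p) (h \o chart_inv p).

Section MetricCharts.
Context {R : realType} {n : nat} {M : riemannianManifold R n}.
Implicit Types (p x : M) (u v w : 'rV[R]_n) (h : M -> R).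

Local Notation e_ i := (@delta_mx R 1 n 0 i).

Definition gram p (y : 'rV[R]_n) : 'M[R]_n :=
  \matrix_(i, j) metric (chart_inv p y) (tangent_at p y (e_ i))
                                        (tangent_at p y (e_ j)).

Lemma gramE p y i j : gram p y i j =
  metric (chart_inv p y) (tangent_at p y (e_ i)) (tangent_at p y (e_ j)).
Proof. by rewrite mxE. Qed.

Lemma tangent_at_sum p (y w : 'rV[R]_n) :
  tangent_at p y w = \sum_i w 0 i *: tangent_at p y (e_ i).
Proof.
rewrite {1}(row_sum_delta w) /tangent_at linear_sum.
by apply: eq_bigr => i _; rewrite linearZ.
Qed.

Lemma metric_tangent_at p y v w :
  metric (chart_inv p y) (tangent_at p y v) (tangent_at p y w)
  = (v *m gram p y *m w^T) 0 0.
Proof.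
rewrite (tangent_at_sum p y v) metric_suml -mulmxA mxE.
apply: eq_bigr => i _; rewrite metricZl mxE; congr (_ * _).
rewrite (tangent_at_sum p y w) metricC metric_suml.
by apply: eq_bigr => j _; rewrite metricZl mulrC mxE metricC mxE.
Qed.

Lemma metric_coord p x u v : dom p x ->
  metric x u v = (coord_at p x u *m gram p (chart p x) *m (coord_at p x v)^T) 0 0.
Proof. by move=> px; rewrite -metric_tangent_at !coord_atK// chartK. Qed.

Lemma gram_unit p x : dom p x -> gram p (chart p x) \in unitmx.
Proof.
move=> px; rewrite -row_free_unit -kermx_eq0; apply/eqP/row_matrixP => i.
set w := row i _; have wG : w *m gram p (chart p x) = 0.
  by rewrite /w -row_mul mulmx_ker row0.
have := metric_tangent_at p (chart p x) w w.
rewrite wG mul0mx mxE => /metric_eq0 /(congr1 (coord_at p x)).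
by rewrite tangent_atK// row0 => ->; rewrite /coord_at linear0.
Qed.

Section Limits.
Context {T : Type} {F : set_system T} {FF : Filter F}.
Context (x : T -> M) (x0 : M).
Hypothesis xx0 : x t @[t --> F] --> x0.

Lemma chart_cvg p : dom p x0 -> chart p (x t) @[t --> F] --> chart p x0.
Proof.
by move=> px; apply: (cvg_comp _ _ xx0); exact: chart_continuous.
Qed.

Lemma near_dom_cvg p : dom p x0 -> \forall t \near F, dom p (x t).
Proof. by move=> px; apply: xx0; exact: near_dom. Qed.

Lemma gram_cvg p : dom p x0 ->
  gram p (chart p (x t)) @[t --> F] --> gram p (chart p x0).
Proof.
move=> px; apply: cvg_mx => i j.
have ip : (chart p @` dom p) (chart p x0) by exists x0.
have mc := @metric_smooth _ _ M p (e_ i) (e_ j) 0%N _ ip.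
have gE : (fun y => gram p y i j) = (fun y => metric (chart_inv p y)
    (tangent_at p y (e_ i)) (tangent_at p y (e_ j))).
  by apply/funext => y; exact: gramE.
have gc : {for chart p x0, continuous (fun y => gram p y i j)} by rewrite gE.
exact: (cvg_comp _ _ (chart_cvg px) gc).
Qed.

Lemma invgram_cvg p : dom p x0 ->
  invmx (gram p (chart p (x t))) @[t --> F] --> invmx (gram p (chart p x0)).
Proof.
move=> px; apply: cvg_invmx; [exact: gram_unit| |exact: gram_cvg].
by apply: filterS (near_dom_cvg px) => t; exact: gram_unit.
Qed.

End Limits.

Lemma C1_differentiable h p x : C1_mfd h -> dom p x ->
  differentiable (h \o chart_inv p) (chart p x).
Proof. by move=> /(_ p)[+ _] px; apply; exists x. Qed.

Lemma C1_derive_continuous h p x v : C1_mfd h -> dom p x ->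
  {for chart p x, continuous ('D_v (h \o chart_inv p))}.
Proof. by move=> /(_ p)[_ +] px => /(_ v); apply; exists x. Qed.

Lemma C2_C1_mfd h : C2_mfd h -> C1_mfd h.
Proof.
move=> hC2 p; have [hd hc] := hC2 p; split => // v y py.
by have [/(_ y py) + _] := hc v; exact: differentiable_continuous.
Qed.

(** Riesz representation: the Gram matrix of the metric is invertible. *)
Lemma grad_metric h x v : differentiable (h \o chart_inv x) (chart x x) ->
  metric x (grad h x) v = 'd (h \o chart_inv x) (chart x x) v.
Proof.
move=> dh; rewrite /grad.
pose L := 'd (h \o chart_inv x) (chart x x).
suff /(@xgetPex _ 0) : exists u, forall v, metric x u v = L v by apply.
pose d : 'rV[R]_n := \row_i L (e_ i).
exists (d *m invmx (gram x (chart x x))) => w.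
rewrite (@metric_coord x)//; last exact: dom_self.
rewrite !coord_at_self mulmxKV ?gram_unit//; last exact: dom_self.
rewrite {2}(row_sum_delta w) linear_sum mxE; apply: eq_bigr => i _.
by rewrite !mxE linearZ/= mulrC.
Qed.

(** The classical formula: the partial derivatives, raised by the inverse of the
    metric tensor. *)
Lemma coord_grad h p x : C1_mfd h -> dom p x ->
  coord_at p x (grad h x)
  = (\row_i 'D_(e_ i) (h \o chart_inv p) (chart p x))
    *m invmx (gram p (chart p x)).
Proof.
move=> hC px; apply: (canRL (mulmxK (gram_unit px))).
have dp := C1_differentiable hC px.
have dx := C1_differentiable hC (@dom_self _ _ _ x).
apply/rowP => j.
have := grad_metric (tangent_at p (chart p x) (e_ j)) dx.
rewrite (metric_coord _ _ px) tangent_atK// trmx_delta -colE mxE => ->.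
rewrite (diff_coord_at _ px dp) tangent_atK// mxE.
by rewrite deriveE.
Qed.

(** Vectors in different tangent spaces are compared through their coordinates
    in the chart at the limit point; there, gradients of C^1 functions form
    continuous vector fields. *)
Lemma coord_grad_cvg h (T : Type) (F : set_system T) {FF : Filter F}
    (x : T -> M) (x0 : M) : C1_mfd h -> x t @[t --> F] --> x0 ->
  coord_at x0 (x t) (grad h (x t)) @[t --> F] --> grad h x0.
Proof.
move=> hC xx0; have d0 := @dom_self _ _ _ x0.
rewrite -(coord_at_self x0 (grad h x0)) (coord_grad hC d0).
apply: (@cvg_trans _ ((\row_i 'D_(e_ i) (h \o chart_inv x0) (chart x0 (x t)))
    *m invmx (gram x0 (chart x0 (x t))) @[t --> F])).
  apply: near_eq_cvg; apply: filterS (near_dom_cvg xx0 d0) => t dt.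
  by rewrite coord_grad.
apply: cvg_mulmx; last exact: invgram_cvg.
apply: cvg_mx => i j; rewrite mxE; under eq_cvg do rewrite mxE.
have dc := @C1_derive_continuous h x0 x0 (e_ j) hC d0.
exact: (cvg_comp _ _ (chart_cvg xx0 d0) dc).
Qed.

(** The pairing is continuous on the tangent bundle, vectors being compared in the
    chart at the limit point. *)
Lemma metric_cvg (T : Type) (F : set_system T) {FF : Filter F}
    (x : T -> M) (x0 : M) (u v : T -> 'rV[R]_n) (u0 v0 : 'rV[R]_n) :
  x t @[t --> F] --> x0 ->
  coord_at x0 (x t) (u t) @[t --> F] --> u0 ->
  coord_at x0 (x t) (v t) @[t --> F] --> v0 ->
  metric (x t) (u t) (v t) @[t --> F] --> metric x0 u0 v0.
Proof.
move=> xx0 uu0 vv0; have d0 := @dom_self _ _ _ x0.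
rewrite (metric_coord u0 v0 d0) !coord_at_self.
apply: (@cvg_trans _ ((coord_at x0 (x t) (u t) *m gram x0 (chart x0 (x t))
    *m (coord_at x0 (x t) (v t))^T) 0 0 @[t --> F])).
  apply: near_eq_cvg; apply: filterS (near_dom_cvg xx0 d0) => t dt.
  by rewrite -metric_coord.
apply: cvg_coord; apply: cvg_mulmx; last exact: cvg_trmx.
by apply: cvg_mulmx => //; exact: gram_cvg.
Qed.

Lemma tnorm_cvg (T : Type) (F : set_system T) {FF : Filter F}
    (x : T -> M) (x0 : M) (u : T -> 'rV[R]_n) (u0 : 'rV[R]_n) :
  x t @[t --> F] --> x0 ->
  coord_at x0 (x t) (u t) @[t --> F] --> u0 ->
  tnorm (x t) (u t) @[t --> F] --> tnorm x0 u0.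
Proof.
move=> xx0 uu0; apply: continuous_cvg; first exact: sqrt_continuous.
exact: metric_cvg.
Qed.

(** Near [x0] the Riemannian norm dominates the norm of coordinates: the
    coordinate vector is recovered from its pairings with the coordinate frame
    by the inverse Gram matrix. *)
Lemma coord_at_bound (x0 : M) : exists2 C : R, 0 < C &
  \forall x \near x0, dom x0 x /\
    forall u, `|coord_at x0 x u| <= C * tnorm x u.
Proof.
have d0 := @dom_self _ _ _ x0.
pose K (x : M) : R := \sum_i \sum_j Num.sqrt (gram x0 (chart x0 x) j j)
  * `|invmx (gram x0 (chart x0 x)) j i|.
have Kc : K x @[x --> x0] --> K x0.
  apply: cvg_sum_fin => i _; apply: cvg_sum_fin => j _; apply: cvgM.
    apply: continuous_cvg; first exact: sqrt_continuous.
    by apply: cvg_coord; apply: gram_cvg => //; exact: cvg_id.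
  apply: cvg_norm; apply: cvg_coord.
  by apply: invgram_cvg => //; exact: cvg_id.
have K0 x : 0 <= K x.
  by apply: sumr_ge0 => i _; apply: sumr_ge0 => j _; rewrite mulr_ge0 ?sqrtr_ge0.
exists (K x0 + 1); first by rewrite ltr_wpDl.
near=> x; have dx : dom x0 x by near: x; exact: near_dom.
split=> // u; set w := coord_at x0 x u.
have Kx : K x <= K x0 + 1.
  by near: x; apply: (cvgr_le _ Kc); rewrite ltrDl.
apply: le_trans (ler_wpM2r (tnorm_ge0 _ _) Kx).
rewrite [leLHS]/Num.Def.normr/= mx_normrE.
apply: bigmax_le; first by rewrite mulr_ge0 ?tnorm_ge0.
move=> [i' i] _ /=; rewrite (ord1 i') {i'}.
apply: (@le_trans _ _ ((\sum_j Num.sqrt (gram x0 (chart x0 x) j j)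
    * `|invmx (gram x0 (chart x0 x)) j i|) * tnorm x u)); last first.
  apply: ler_wpM2r; first exact: tnorm_ge0.
  rewrite /K [leRHS](bigD1 i)//= lerDl.
  by apply: sumr_ge0 => k _; apply: sumr_ge0 => j _; rewrite mulr_ge0 ?sqrtr_ge0.
rewrite -{1}[w](mulmxK (gram_unit dx)) mxE.
apply: le_trans (ler_norm_sum _ _ _) _; rewrite mulr_suml; apply: ler_sum => j _.
rewrite normrM mulrAC ler_wpM2r//.
have -> : (w *m gram x0 (chart x0 x)) 0 j
    = metric x u (tangent_at x0 (chart x0 x) (e_ j)).
  by rewrite (metric_coord _ _ dx) tangent_atK// trmx_delta -colE [RHS]mxE.
apply: le_trans (metric_cauchy_schwarz _ _ _) _; rewrite mulrC ler_wpM2r ?tnorm_ge0//.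
by rewrite gramE chartK.
Unshelve. all: by end_near. Qed.

Lemma coord_at_cvg0 (T : Type) (F : set_system T) {FF : Filter F}
    (x : T -> M) (x0 : M) (u : T -> 'rV[R]_n) :
  x t @[t --> F] --> x0 -> tnorm (x t) (u t) @[t --> F] --> (0 : R) ->
  coord_at x0 (x t) (u t) @[t --> F] --> (0 : 'rV[R]_n).
Proof.
move=> xx0 u0; have [C C0 HC] := coord_at_bound x0.
have HF : \forall t \near F, dom x0 (x t) /\
  forall u, `|coord_at x0 (x t) u| <= C * tnorm (x t) u by exact: xx0 HC.
apply: norm_cvg0; apply: (@squeeze_cvgr _ _ _ _ (cst 0)
  (fun t => C * tnorm (x t) (u t))); [|exact: cvg_cst|].
  by apply: filterS HF => t [_ Ht]; rewrite normr_ge0 Ht.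
have H := cvgM (@cvg_cst R C T F _) u0; rewrite mulr0 in H; exact: H.
Qed.

Lemma C1_cvg h (T : Type) (F : set_system T) {FF : Filter F}
    (x : T -> M) (x0 : M) : C1_mfd h -> x t @[t --> F] --> x0 ->
  h (x t) @[t --> F] --> h x0.
Proof.
move=> hC xx0; have d0 := @dom_self _ _ _ x0.
have hc := differentiable_continuous (C1_differentiable hC d0).
have := cvg_comp _ _ (chart_cvg xx0 d0) hc; rewrite /= chartK//.
apply: cvg_trans; apply: near_eq_cvg.
by apply: filterS (near_dom_cvg xx0 d0) => t dt /=; rewrite chartK.
Qed.

End MetricCharts.

(** * Curves and arc length *)

Section CurveDerivatives.
Context {R : realType}.

Lemma is_derive_chain (V W : normedModType R) (h : V -> W) (g : R -> V) t d :
  differentiable h (g t) -> is_derive t (1 : R) g d ->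
  is_derive t (1 : R) (h \o g) ('d h (g t) d).
Proof.
move=> dh [dg <-]; have /derivable1_diffP dg' := dg.
have dhg : differentiable (h \o g) t by exact: differentiable_comp.
apply: DeriveDef; first exact/derivable1_diffP.
rewrite deriveE// deriveE//.
exact: (congr1 (fun F : R -> W => F 1) (diff_comp dg' dh)).
Qed.

Lemma is_derive_affine (V : normedModType R) (g : R -> V) (a b t : R) d :
  is_derive (a + b * t) (1 : R) g d ->
  is_derive t (1 : R) (g \o (fun s => a + b * s)) (b *: d).
Proof.
move=> [dg dgE]; have /derivable1_diffP dg' := dg.
have da : is_derive t (1 : R) (fun s : R => a + b * s) b.
  by apply: is_derive_eq; rewrite add0r mul1r [LHS]mulr1.
have := @is_derive_chain R V g (fun s : R => a + b * s) t b dg' da.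
rewrite -[X in 'd g _ X]mulr1 -[b * 1]/(b *: 1) linearZ/=.
by rewrite -(deriveE _ dg') dgE.
Qed.

Lemma le_of_derive (f : R -> R) (a b : R) : a <= b ->
  (forall t, a <= t <= b -> derivable f t 1 /\ 0 <= derive1 f t) -> f a <= f b.
Proof.
move=> ab fd; apply: (@ger0_derive1_ndecr _ f a b) => //.
- by move=> t; rewrite in_itv/= => /andP[at_ tb]; apply: (fd t _).1; rewrite !ltW.
- by move=> t; rewrite in_itv/= => /andP[at_ tb]; apply: (fd t _).2; rewrite !ltW.
- apply: derivable_within_continuous => t; rewrite in_itv/= => tab.
  exact: (fd t _).1.
Qed.

End CurveDerivatives.

Section Curves.
Context {R : realType} {n : nat} {M : riemannianManifold R n}.
Implicit Types (p x y : M) (g : R -> M).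

Lemma C1_curve_derivable g p t : C1_curve g -> dom p (g t) ->
  is_derive t (1 : R) (chart p \o g) (derive1 (chart p \o g) t).
Proof.
move=> [_ /(_ p)[gd _]] pt; rewrite derive1E.
by apply/derivableP/derivable1_diffP; exact: gd.
Qed.

Lemma C1_curve_continuous_derive g p t : C1_curve g -> dom p (g t) ->
  {for t, continuous (derive1 (chart p \o g))}.
Proof.
move=> [_ /(_ p)[_ gc]] pt.
have := gc (1 : R) t pt; rewrite (_ : 'D_(1 : R) (chart p \o g) = derive1 (chart p \o g))//.
by apply/funext => s; rewrite derive1E.
Qed.

Lemma near_dom_curve g p t : continuous g -> dom p (g t) ->
  \forall s \near t, dom p (g s).
Proof. by move=> gc pt; apply: gc; exact: near_dom. Qed.

(** One continuous derivative per chart suffices: the directional derivative in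
    direction [v : R] is [v] times it. *)
Lemma C1_curveI g : continuous g ->
  (forall p t, dom p (g t) -> exists d : R -> 'rV[R]_n,
     (\forall s \near t, is_derive s (1 : R) (chart p \o g) (d s)) /\
     {for t, continuous d}) ->
  C1_curve g.
Proof.
move=> gc gd; split => // p; split => [t pt|v t pt].
  have [d [/nbhs_singleton dt _]] := gd p t pt.
  by apply/derivable1_diffP; exact: ex_derive.
have [d [dt dc]] := gd p t pt.
have De : \forall s \near t, v *: d s = 'D_v (chart p \o g) s.
  apply: filterS dt => s ds.
  have ds' : differentiable (chart p \o g) s.
    by apply/derivable1_diffP; exact: ex_derive.
  rewrite deriveE// -[v in RHS]mulr1 -[v * 1]/(v *: 1) linearZ/=.
  by rewrite -deriveE// derive_val.
apply: (@cvg_trans _ (v *: d s @[s --> t])).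
  exact: near_eq_cvg.
rewrite /continuous_at -(nbhs_singleton De); exact: cvgZl_tmp dc.
Qed.

Lemma C1_curve_affine g (a b : R) : C1_curve g ->
  C1_curve (g \o (fun t => a + b * t)).
Proof.
move=> gC; have [gc _] := gC.
have ac : continuous (fun t : R => a + b * t).
  by move=> t; apply: cvgD; [exact: cvg_cst|apply: cvgMl_tmp; exact: cvg_id].
apply: C1_curveI => [t|p t pt].
  by apply: continuous_comp; [exact: ac|exact: gc].
exists (fun s => b *: derive1 (chart p \o g) (a + b * s)); split.
  have near_p : \forall s \near t, dom p (g (a + b * s)).
    exact: (ac t _ (near_dom_curve gc pt)).
  apply: filterS near_p => s ps.
  exact: (@is_derive_affine _ _ (chart p \o g) a b s _ (C1_curve_derivable gC ps)).
apply: cvgZl_tmp.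
exact: (cvg_comp _ _ (ac t) (C1_curve_continuous_derive gC pt)).
Qed.

(** The velocity is defined in the chart at the moving point itself; a transition
    map brings it to a fixed chart, where its continuity can be discussed. *)
Lemma coord_velocity g p t : C1_curve g -> dom p (g t) ->
  coord_at p (g t) (velocity g t) = derive1 (chart p \o g) t.
Proof.
move=> gC pt; have xt := @dom_self _ _ M (g t).
have dv := C1_curve_derivable gC xt.
have dc : differentiable (chart p \o chart_inv (g t)) ((chart (g t) \o g) t).
  exact: transition_differentiable.
have := is_derive_chain dc dv; rewrite -[X in is_derive _ _ _ X]/(coord_at p (g t) (velocity g t)).
set f := (X in is_derive _ _ X) => df.
rewrite derive1E; have [_ <-] := df; apply: near_eq_derive.
have := near_dom_curve gC.1 xt.
by apply: filterS => s ps; rewrite /f /= chartK.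
Qed.

Definition speed g t : R := tnorm (g t) (velocity g t).

Lemma speed_continuous g : C1_curve g -> continuous (speed g).
Proof.
move=> gC t; apply: tnorm_cvg; first exact: gC.1.
have xt := @dom_self _ _ M (g t).
apply: (@cvg_trans _ (derive1 (chart (g t) \o g) s @[s --> t])).
  apply: near_eq_cvg; apply: filterS (near_dom_curve gC.1 xt) => s ps.
  by rewrite coord_velocity.
exact: C1_curve_continuous_derive.
Qed.

(** Arc length as a function of the parameter; the base point -1 makes it
    differentiable on a neighbourhood of [0, 1]. *)
Lemma arc_length_param g : C1_curve g ->
  exists S : R -> R, forall t : R, -1 < t -> is_derive t (1 : R) S (speed g t).
Proof.
move=> gC; exists (fun u : R => (\int[lebesgue_measure]_(t in `[(-1)%R, u]) speed g t)%R).
move=> t t1; have sc := speed_continuous gC.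
have := @continuous_FTC1_closed R (speed g) (-1) t (t + 1).
rewrite ltrDl ltr01 => /(_ isT) H.
have [||dS SE] := H _ t1.
- apply: continuous_compact_integrable; first exact: segment_compact.
  exact: continuous_subspaceT.
- exact: sc.
by apply: DeriveDef; [exact: dS|rewrite -derive1E; exact: SE].
Qed.

Lemma arc_lengthE g (S : R -> R) : C1_curve g ->
  (forall t : R, 0 <= t <= 1 -> is_derive t (1 : R) S (speed g t)) ->
  arc_length g = (S 1 - S 0)%:E.
Proof.
move=> gC dS; rewrite /arc_length.
rewrite (@continuous_FTC2 _ (speed g) S)//.
- apply: continuous_subspaceT; exact: speed_continuous.
- have Sd t : 0 <= t <= 1 -> derivable S t 1 by move=> /dS [].
  have Sc t : 0 <= t <= 1 -> {for t, continuous S}.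
    by move=> /Sd /derivable1_diffP; exact: differentiable_continuous.
  split.
  + by move=> t; rewrite in_itv/= => /andP[? ?]; apply: Sd; rewrite !ltW.
  + by apply: cvg_at_right_filter; apply: Sc; rewrite lexx ler01.
  + by apply: cvg_at_left_filter; apply: Sc; rewrite lexx ler01.
- move=> t; rewrite in_itv/= => /andP[? ?].
  have [|_ SE] := dS t; first by rewrite !ltW.
  by rewrite derive1E SE.
Qed.

Lemma speed_ge0 g t : 0 <= speed g t.
Proof. exact: tnorm_ge0. Qed.

Lemma arc_length_le g B : C1_curve g ->
  (forall t, 0 <= t <= 1 -> speed g t <= B) -> (arc_length g <= B%:E)%E.
Proof.
move=> gC sB; have [S dS] := arc_length_param gC.
have dS' (t : R) : 0 <= t <= 1 -> is_derive t (1 : R) S (speed g t).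
  by move=> /andP[t0 _]; apply: dS; apply: lt_le_trans t0; rewrite ltrN10.
rewrite (arc_lengthE gC dS') lee_fin.
suff : B * 0 - S 0 <= B * 1 - S 1.
  by rewrite mulr0 mulr1; lra.
apply: (@le_of_derive _ (fun t : R => B * t - S t)) => // t t01.
have dSt := dS' t t01.
have : is_derive t (1 : R) (fun t : R => B * t - S t) (B - speed g t).
  by apply: is_derive_eq; rewrite scaler1.
by case=> ? dE; split => //; rewrite derive1E dE subr_ge0 sB.
Qed.

Lemma speed_affine g a b t : C1_curve g ->
  speed (g \o (fun t => a + b * t)) t = `|b| * speed g (a + b * t).
Proof.
move=> gC; rewrite /speed -tnormZ /=; congr (tnorm _ _).
rewrite /velocity /=; have xt := @dom_self _ _ M (g (a + b * t)).
have dg := C1_curve_derivable gC xt.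
rewrite derive1E; have [_ <-] := is_derive_affine dg.
by [].
Qed.

(** Reparametrization by an increasing or decreasing affine map; the sign [e] of
    its slope turns the primitive [S] of the speed into a primitive of the new
    speed. *)
Lemma arc_length_affine g (S : R -> R) a b : C1_curve g ->
  (forall t : R, -1 < t -> is_derive t (1 : R) S (speed g t)) ->
  0 <= a -> 0 <= b ->
  arc_length (g \o (fun t => a + (b - a) * t)) = `|S b - S a|%:E.
Proof.
move=> gC dS a0 b0; pose phi (t : R) := a + (b - a) * t.
have Cg : C1_curve (g \o phi) by exact: C1_curve_affine.
have phi_gt t : 0 <= t <= 1 -> -1 < phi t by rewrite /phi; nra.
pose e : R := if a <= b then 1 else -1.
have eE : `|b - a| = e * (b - a).
  rewrite /e; case: ifPn => [ab|]; first by rewrite ger0_norm ?subr_ge0// mul1r.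
  by rewrite -ltNge => ba; rewrite ltr0_norm ?subr_lt0// mulN1r.
have dT (t : R) : 0 <= t <= 1 ->
    is_derive t (1 : R) (fun t : R => e * S (phi t)) (speed (g \o phi) t).
  move=> t01; have dSp := is_derive_affine (dS _ (phi_gt t t01)).
  rewrite /phi speed_affine// eE -mulrA.
  have : is_derive t (1 : R) (e *: (S \o phi)) (e *: ((b - a) *: speed g (phi t))).
    exact: is_deriveZ.
  by [].
rewrite (arc_lengthE Cg dT) /phi mulr0 addr0 mulr1 addrCA subrr addr0 -mulrBr.
congr (_%:E).
have Smono (u v : R) : 0 <= u -> u <= v -> S u <= S v.
  move=> u0 uv; apply: (@le_of_derive _ S) => // t /andP[ut _].
  have [|dSt SE] := dS t; first by apply: lt_le_trans (le_trans u0 ut); rewrite ltrN10.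
  by split => //; rewrite derive1E SE speed_ge0.
rewrite /e; case: ifPn => [ab|].
  by rewrite mul1r ger0_norm// subr_ge0 Smono.
by rewrite -ltNge => /ltW ba; rewrite mulN1r ler0_norm// subr_le0 Smono.
Qed.

End Curves.

(** * Paths and the Riemannian distance *)

Section Paths.
Context {R : realType} {n : nat} {M : riemannianManifold R n}.
Implicit Types (p x y z : M) (g : R -> M).

(** A piece of a curve, possibly reversed, has the increment of the arc-length
    parameter as its length. *)
Lemma subcurve_path g (S : R -> R) a b : C1_curve g ->
  (forall t : R, -1 < t -> is_derive t (1 : R) S (speed g t)) ->
  0 <= a -> 0 <= b -> pw_C1_path (g a) (g b) `|S b - S a|%:E.
Proof.
move=> gC dS a0 b0; rewrite -(arc_length_affine gC dS a0 b0).
have := PwC1 (C1_curve_affine a (b - a) gC).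
by rewrite /= mulr0 addr0 mulr1 addrCA subrr addr0.
Qed.

Lemma arc_length_primitive g (S : R -> R) : C1_curve g ->
  (forall t : R, -1 < t -> is_derive t (1 : R) S (speed g t)) ->
  arc_length g = (S 1 - S 0)%:E /\
  (forall s t, 0 <= s -> s <= t -> S s <= S t).
Proof.
move=> gC dS; split.
  apply: arc_lengthE => // t /andP[t0 _]; apply: dS.
  by apply: lt_le_trans t0; rewrite ltrN10.
move=> s t s0 st; apply: (@le_of_derive _ S) => // u /andP[su _].
have [|dSu SE] := dS u; first by apply: lt_le_trans (le_trans s0 su); rewrite ltrN10.
by split => //; rewrite derive1E SE speed_ge0.
Qed.

Lemma path_sym x y l : pw_C1_path x y l -> pw_C1_path y x l.
Proof.
elim=> {x y l} [g gC|x y z a b _ yx _ zy]; last by rewrite addeC; exact: PwCat zy yx.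
have [S dS] := arc_length_param gC; have [-> Smono] := arc_length_primitive gC dS.
have := subcurve_path gC dS (@ler01 R) (lexx 0).
by rewrite distrC ger0_norm// subr_ge0 Smono.
Qed.

Lemma rdist_path x y (e : R) : (rdist x y < e%:E)%E ->
  exists2 l, pw_C1_path x y l & (l < e%:E)%E.
Proof. by move=> /ereal_inf_lt[l pl le]; exists l. Qed.

Lemma path_rdist x y l : pw_C1_path x y l -> (rdist x y <= l)%E.
Proof. exact: ereal_inf_lbound. Qed.

Lemma rdist_sym_lt x y (e : R) : (rdist x y < e%:E)%E -> (rdist y x < e%:E)%E.
Proof.
by move=> /rdist_path[l /path_sym/path_rdist pl le]; exact: le_lt_trans le.
Qed.

Lemma rdist_trans_lt x y z (a b : R) : (rdist x y < a%:E)%E ->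
  (rdist y z < b%:E)%E -> (rdist x z < (a + b)%:E)%E.
Proof.
move=> /rdist_path[l xy la] /rdist_path[k yz kb].
apply: le_lt_trans (path_rdist (PwCat xy yz)) _.
by rewrite EFinD lteD.
Qed.

Lemma rdist_le_lt x y (a b : R) : (rdist x y <= a%:E)%E -> a < b ->
  (rdist x y < b%:E)%E.
Proof. by move=> xy ab; apply: le_lt_trans xy _; rewrite lte_fin. Qed.

Lemma rdist_lt_le x y (a : R) :
  (forall e : R, 0 < e -> (rdist x y < (a + e)%:E)%E) -> (rdist x y <= a%:E)%E.
Proof.
move=> H; apply/lee_addgt0Pr => e e0; rewrite -EFinD; exact/ltW/H.
Qed.

Lemma rdist_trans_le x y z (a b : R) : (rdist x y <= a%:E)%E ->
  (rdist y z <= b%:E)%E -> (rdist x z <= (a + b)%:E)%E.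
Proof.
move=> xy yz; apply: rdist_lt_le => e e0.
rewrite (_ : a + b + e = (a + e / 2) + (b + e / 2)); last by lra.
by apply: rdist_trans_lt; [apply: rdist_le_lt xy _|apply: rdist_le_lt yz _];
  rewrite ltrDl divr_gt0.
Qed.

Lemma rdist_refl_le x : (rdist x x <= 0%:E)%E.
Proof.
have cC : C1_curve (fun _ : R => x).
  apply: C1_curveI => [t|p t px]; first exact: cvg_cst.
  exists (fun=> 0); split; last exact: cvg_cst.
  by near=> s; exact: is_derive_cst.
have [S dS] := arc_length_param cC.
by have := path_rdist (subcurve_path cC dS (lexx 0) (lexx 0)); rewrite subrr normr0.
Unshelve. all: by end_near. Qed.

(** Parametrization by arc length, up to points at distance zero; piecewise
    curves thereby become a single 1-Lipschitz map. *)
Lemma path_lipschitz x y l : pw_C1_path x y l ->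
  exists (L : R) (w : R -> M), [/\ 0 <= L, l = L%:E,
    (rdist x (w 0%R) <= 0%:E)%E, (rdist (w L) y <= 0%:E)%E &
    forall s t, 0 <= s -> s <= t -> t <= L -> (rdist (w s) (w t) <= (t - s)%:E)%E].
Proof.
elim=> {x y l} [g gC|x y z a b _ [L1 [w1 [L10 -> xw1 w1y w1L]]]
                        _ [L2 [w2 [L20 -> yw2 w2z w2L]]]].
  have [S dS] := arc_length_param gC; have [-> Smono] := arc_length_primitive gC dS.
  have S01 : S 0 <= S 1 by exact: Smono.
  have Sc : {within `[0, 1], continuous S}.
    apply: derivable_within_continuous => t; rewrite in_itv/= => /andP[t0 _].
    by have [] := dS t (lt_le_trans (ltrN10 R) t0).
  have tau_ex s : 0 <= s <= S 1 - S 0 -> exists t, 0 <= t <= 1 /\ S t = S 0 + s.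
    move=> /andP[s0 sL]; have [|t t01 St] := IVT ler01 Sc (v := S 0 + s).
      by rewrite min_l// max_r//; apply/andP; split; lra.
    by exists t; split => //; move: t01; rewrite in_itv.
  pose tau s := xget 0 [set t | 0 <= t <= 1 /\ S t = S 0 + s].
  have tauP s : 0 <= s <= S 1 - S 0 -> 0 <= tau s <= 1 /\ S (tau s) = S 0 + s.
    by move=> /tau_ex; exact: (@xgetPex _ 0).
  have dtau s t : 0 <= s <= 1 -> 0 <= t <= 1 ->
      (rdist (g s) (g t) <= `|S t - S s|%:E)%E.
    move=> /andP[s0 _] /andP[t0 _]; exact: path_rdist (subcurve_path gC dS s0 t0).
  have L0 : 0 <= S 1 - S 0 by rewrite subr_ge0.
  exists (S 1 - S 0), (g \o tau); split => //=.
  - have [|t01 tE] := tauP 0; first by rewrite lexx.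
    have := dtau 0 (tau 0); rewrite lexx ler01 => /(_ isT t01) {t01}.
    by rewrite tE addr0 subrr normr0.
  - have [|t01 tE] := tauP (S 1 - S 0); first by rewrite L0 lexx.
    have := dtau _ 1 t01; rewrite lexx ler01 => /(_ isT).
    by rewrite tE addrCA subrr addr0 subrr normr0.
  - move=> s t s0 st tL.
    have [|s01 sE] := tauP s; first by rewrite s0 (le_trans st).
    have [|t01 tE] := tauP t; first by rewrite (le_trans s0 st).
    have := dtau _ _ s01 t01; rewrite sE tE (_ : S 0 + t - _ = t - s); last by ring.
    by rewrite ger0_norm ?subr_ge0.
exists (L1 + L2), (fun s => if s <= L1 then w1 s else w2 (s - L1)); split.
- exact: addr_ge0.
- by rewrite EFinD.
- by rewrite L10.
- case: ifPn => [|_]; last by rewrite addrAC subrr add0r.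
  rewrite gerDl => L2le0; have L2E : L2 = 0 by apply/eqP; rewrite eq_le L2le0.
  rewrite L2E addr0 -[0%:E](_ : (0 + 0 + 0)%:E = _); last by rewrite !addr0.
  apply: rdist_trans_le w2z.
  by rewrite L2E; exact: rdist_trans_le w1y yw2.
- move=> s t s0 st tL; case: ifPn => sL1; case: ifPn => tL1.
  + exact: w1L.
  + rewrite -ltNge in tL1.
    rewrite (_ : t - s = (L1 - s) + 0 + 0 + (t - L1 - 0)); last by ring.
    apply: rdist_trans_le; last by apply: w2L; lra.
    apply: rdist_trans_le yw2; apply: rdist_trans_le w1y.
    by apply: w1L.
  + by move: sL1; rewrite (le_trans st tL1).
  + rewrite -ltNge in sL1.
    rewrite (_ : t - s = (t - L1) - (s - L1)); last by ring.
    by apply: w2L; lra.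
Qed.

End Paths.

(** * The distance induces the topology of the manifold *)

Section Bump.
Context {R : realType}.

Lemma is_derive_sqr (f : R -> R) (t d : R) : is_derive t (1 : R) f d ->
  is_derive t (1 : R) (fun s => f s ^+ 2) (2 * f t * d).
Proof.
move=> df; rewrite (_ : (fun s => f s ^+ 2) = f * f)//.
apply: (is_derive_eq (is_deriveM df df)).
by rewrite /GRing.scale/=; ring.
Qed.

(** The square makes the positive part continuously differentiable, so that it can
    be composed with a squared distance in a chart. *)
Definition sqpos (u : R) : R := Num.max 0 u ^+ 2.

Lemma is_derive_sqpos (u : R) : is_derive u (1 : R) sqpos (2 * Num.max 0 u).
Proof.
have [u0|u0|<-] := ltgtP 0 u.
- apply: (near_eq_is_derive (f := fun v : R => v ^+ 2)).
    near=> v; rewrite /sqpos max_r//; apply: ltW; near: v.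
    exact: lt_nbhsr.
  by have := is_derive_sqr (is_derive_id u (1 : R)); rewrite mulr1.
- apply: (near_eq_is_derive (f := fun v : R => 0)).
    near=> v; rewrite /sqpos max_l ?expr0n//; apply: ltW; near: v.
    exact: lt_nbhsl.
  by rewrite mulr0; exact: is_derive_cst.
- rewrite mulr0.
  have c0 : (fun h : R => h^-1 *: ((sqpos \o shift (0 : R)) (h *: (1 : R)) - sqpos 0))
     @ 0^' --> (0 : R).
    apply/cvgrPdist_le => e e0; near=> h.
    rewrite sub0r normrN /= addr0 [h *: _]mulr1 {2}/sqpos maxxx expr0n/= subr0.
    rewrite /GRing.scale/= normrM normfV.
    have h0 : h != 0 by near: h; exact: nbhs_dnbhs_neq.
    rewrite mulrC ler_pdivrMr ?normr_gt0//.
    apply: (@le_trans _ _ (`|h| * `|h|)).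
      rewrite -expr2 /sqpos normrX lerXn2r ?nnegrE//.
      by rewrite ger0_norm ?le_max ?lexx// ge_max normr_ge0 ler_norm.
    rewrite ler_wpM2r//; apply: ltW; near: h; exact: dnbhs0_lt.
  by apply: DeriveDef; [apply/cvg_ex; exists 0|exact: cvg_lim].
Unshelve. all: by end_near. Qed.

Lemma is_derive_coord n (y : R -> 'rV[R]_n) (t : R) d i :
  is_derive t (1 : R) y d -> is_derive t (1 : R) (fun s => y s 0 i) (d 0 i).
Proof.
move=> [dy dE]; have /derivable_mxP/(_ 0 i) dyi := dy.
by apply: DeriveDef => //; rewrite -dE derive_mx// mxE.
Qed.

Lemma is_derive_sqdist n (a : 'rV[R]_n) (y : R -> 'rV[R]_n) (t : R) d :
  is_derive t (1 : R) y d ->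
  is_derive t (1 : R) (fun s => \sum_i (a 0 i - y s 0 i) ^+ 2)
    (\sum_i (- (2 * (a 0 i - y t 0 i) * d 0 i))).
Proof.
move=> dy.
have di i : is_derive t (1 : R) (fun s => (a 0 i - y s 0 i) ^+ 2)
    (- (2 * (a 0 i - y t 0 i) * d 0 i)).
  have dyi := is_derive_coord i dy.
  have ds : is_derive t (1 : R) (fun s => a 0 i - y s 0 i) (- d 0 i).
    have := is_deriveB (is_derive_cst (a 0 i) t (1 : R)) dyi.
    by rewrite sub0r.
  by have := is_derive_sqr ds; rewrite mulrN.
have := is_derive_sum (fun i => di i).
by rewrite (_ : \sum_(i < n) _ = fun s => \sum_i (a 0 i - y s 0 i) ^+ 2)//
   ; apply/funext => s; rewrite fct_sumE.
Qed.

End Bump.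

Section DistanceTopology.
Context {R : realType} {n : nat} {M : riemannianManifold R n}.
Implicit Types (p x y z : M) (g : R -> M).

Lemma entry_le (v : 'rV[R]_n) i : `|v 0 i| <= `|v|.
Proof.
rewrite [leRHS]/Num.Def.normr/= mx_normrE.
exact: (le_bigmax _ _ (0, i)).
Qed.

Lemma norm_le_sqdist (a y : 'rV[R]_n) (r : R) : 0 < r ->
  \sum_i (a 0 i - y 0 i) ^+ 2 < r ^+ 2 -> `|a - y| <= r.
Proof.
move=> r0 qr; rewrite [leLHS]/Num.Def.normr/= mx_normrE.
apply: bigmax_le => [|[i' i] _]; first exact: ltW.
rewrite (ord1 i') !mxE /=; rewrite -(@ler_pXn2r _ 2) ?nnegrE ?(ltW r0)//.
rewrite real_normK ?num_real//; apply: le_trans (ltW qr).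
by rewrite (bigD1 i)//= lerDl; apply: sumr_ge0 => j _; exact: sqr_ge0.
Qed.

(** A bump function supported in a compact coordinate ball changes at most at a
    rate proportional to the speed of a curve; a short path from the centre
    therefore cannot leave the ball. *)
Lemma rdist_compact_nbhd (x0 : M) (V : set M) : nbhs x0 V ->
  exists (e : R) (K : set M), [/\ 0 < e, compact K, K `<=` V &
    forall x, (rdist x0 x < e%:E)%E -> K x].
Proof.
move=> V0; have d0 := @dom_self _ _ M x0.
have [C C0 HC] := coord_at_bound x0.
pose y0 := chart x0 x0.
have near_y0 : \forall y \near y0, (chart x0 @` dom x0) y /\
    ((dom x0 (chart_inv x0 y) /\ forall u,
      `|coord_at x0 (chart_inv x0 y) u| <= C * tnorm (chart_inv x0 y) u) /\
     V (chart_inv x0 y)).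
  apply: filterI; first exact: near_image.
  exact: (near_chart_inv d0 (filterI HC V0)).
have /nbhs_ballP[r0 /= r00 r0P] := near_y0.
pose r := r0 / 2.
have rpos : 0 < r by rewrite divr_gt0.
have rP (y : 'rV[R]_n) : `|y0 - y| <= r -> (chart x0 @` dom x0) y /\
    ((dom x0 (chart_inv x0 y) /\ forall u,
      `|coord_at x0 (chart_inv x0 y) u| <= C * tnorm (chart_inv x0 y) u) /\
     V (chart_inv x0 y)).
  move=> yr; apply: r0P; rewrite -ball_normE /=; apply: le_lt_trans yr _.
  by rewrite /r ltr_pdivrMr// ltr_pMr// ltr1n.
pose B := [set y : 'rV[R]_n | `|y0 - y| <= r].
pose K := chart_inv x0 @` B.
have Kc : compact K.
  apply: continuous_compact.
    apply: continuous_in_subspaceT => y /[!inE] /rP[yi _].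
    exact: chart_inv_continuous.
  apply: bounded_closed_compact.
    exists (`|y0| + r); split; first exact: num_real.
    move=> a ar y /= yr; apply: ltW; apply: le_lt_trans ar.
    rewrite -(subKr y0 y); apply: le_trans (ler_normB _ _) _.
    by rewrite lerD2l.
  rewrite (_ : B = closed_ball_ (fun y : 'rV[R]_n => `|y|) y0 r)//.
  exact: closed_closed_ball_.
have Kcl : closed K by apply: compact_closed => //; exact: mfd_hausdorff.
have KP x : K x <-> dom x0 x /\ `|y0 - chart x0 x| <= r.
  split=> [[y yr <-]|[dx xr]].
    by have [yi _] := rP _ yr; split; [exact: dom_chart_inv|rewrite chart_invK].
  by exists (chart x0 x) => //; exact: chartK.
pose q (y : 'rV[R]_n) : R := \sum_i (y0 0 i - y 0 i) ^+ 2.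
pose chi (x : M) : R := if `[< dom x0 x >] then sqpos (r ^+ 2 - q (chart x0 x)) else 0.
have q0 (y : 'rV[R]_n) : 0 <= q y by apply: sumr_ge0 => i _; exact: sqr_ge0.
have sqpos0 (u : R) : u <= 0 -> sqpos u = 0 :> R.
  by move=> u0; rewrite /sqpos max_l// expr0n.
have chiK x : ~ K x -> chi x = 0.
  move=> Kx; rewrite /chi; case: asboolP => // dx; apply: sqpos0.
  rewrite subr_le0 leNgt; apply/negP => /(norm_le_sqdist rpos) xr.
  by apply: Kx; apply/KP.
(* chain rule: 2 r^2 bounds the derivative of [sqpos], and each of the n terms of
   the derivative of [q] is at most 2 r times C times the speed *)
pose C' := 4 * r ^+ 3 * n%:R * C.
have C'0 : 0 <= C' by rewrite /C' !mulr_ge0// ?exprn_ge0 ?ltW.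
have dchi g t : C1_curve g -> exists2 d : R,
    is_derive t (1 : R) (chi \o g) d & `|d| <= C' * speed g t.
  move=> gC; have [Kg|Kg] := pselect (K (g t)); last first.
    exists 0; last by rewrite normr0 mulr_ge0 ?speed_ge0.
    apply: (near_eq_is_derive (f := fun _ : R => 0 : R)).
    have nK : nbhs (g t) (~` K).
      by apply: open_nbhs_nbhs; split => //; exact: closed_openC.
    have gK : \forall s \near t, (~` K) (g s) := gC.1 t _ nK.
    by apply: filterS gK => s /chiK.
  have /KP[dt gr] := Kg.
  have dy := C1_curve_derivable gC dt.
  have dq := is_derive_sqdist y0 dy.
  have dr := is_deriveB (is_derive_cst (r ^+ 2) t (1 : R)) dq.
  have := @is_derive1_comp _ sqpos _ t _ _ (is_derive_sqpos _) dr.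
  set d := (X in is_derive _ _ _ X) => dd.
  exists d.
    apply: near_eq_is_derive dd.
    apply: filterS (near_dom_curve gC.1 dt) => s ds.
    by rewrite /chi /= asboolT.
  have [_ [[_ /(_ (velocity g t))]]] := rP _ gr.
  rewrite chartK// coord_velocity// => vC _.
  rewrite /d sub0r normrM normrN.
  have h1 : `|2 * Num.max 0 (r ^+ 2 - q (chart x0 (g t)))| <= 2 * r ^+ 2.
    rewrite ger0_norm ?mulr_ge0 ?le_max ?lexx//.
    rewrite ler_wpM2l// ge_max sqr_ge0 /= gerBl//.
  have h2 : `|\sum_i - (2 * (y0 0 i - chart x0 (g t) 0 i)
       * derive1 (chart x0 \o g) t 0 i)| <= n%:R * (2 * r * (C * speed g t)).
    apply: le_trans (ler_norm_sum _ _ _) _.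
    rewrite (_ : n%:R * _ = \sum_(i < n) 2 * r * (C * speed g t)); last first.
      by rewrite sumr_const card_ord mulr_natl.
    apply: ler_sum => i _.
    rewrite normrN !normrM (ger0_norm (ler0n R 2)).
    apply: ler_pM => //.
      rewrite ler_wpM2l//; apply: le_trans gr.
      by have := entry_le (y0 - chart x0 (g t)) i; rewrite !mxE.
    exact: le_trans (entry_le _ _) vC.
  apply: le_trans (ler_pM (normr_ge0 _) (normr_ge0 _) h1 h2) _.
  rewrite le_eqVlt; apply/orP; left; apply/eqP; rewrite /C'; ring.
have path_chi x y l : pw_C1_path x y l ->
    exists L : R, [/\ 0 <= L, l = L%:E & `|chi y - chi x| <= C' * L].
  elim=> {x y l} [g gC|x y z a b _ [La [La0 -> xy]] _ [Lb [Lb0 -> yz]]]; last first.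
    exists (La + Lb); split => //; first exact: addr_ge0.
    rewrite -(subrKA (chi y)) mulrDr.
    by apply: le_trans (ler_normD _ _) _; rewrite addrC lerD.
  have [S dS] := arc_length_param gC; have [-> Smono] := arc_length_primitive gC dS.
  exists (S 1 - S 0); split => //; first by rewrite subr_ge0 Smono.
  (* e = 1 and e = -1 bound the variation of [chi] on both sides *)
  have mono (e : R) : `|e| <= 1 ->
      C' * S 0 - e * chi (g 0) <= C' * S 1 - e * chi (g 1).
    move=> e1; apply: (@le_of_derive _ (fun t : R => C' * S t - e * chi (g t)));
      first exact: ler01.
    move=> t /andP[t0 _]; have [d dchit dle] := dchi g t gC.
    have dSt := dS t (lt_le_trans (ltrN10 R) t0).
    have : is_derive t (1 : R) (fun t : R => C' * S t - e * chi (g t))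
        (C' * speed g t - e * d).
      have h1 := is_deriveZ C' dSt; have h2 := is_deriveZ e dchit.
      exact: is_deriveB h1 h2.
    case=> ? dE; split => //; rewrite derive1E dE subr_ge0.
    apply: le_trans dle; apply: le_trans (ler_norm _) _.
    by rewrite normrM ler_piMl.
  have m1 := mono 1; have mN := mono (-1).
  rewrite normrN normr1 lexx in m1 mN.
  have {}m1 := m1 isT; have {}mN := mN isT.
  rewrite ler_norml; apply/andP; split; lra.
have chi0 : chi x0 = (r ^+ 2) ^+ 2.
  rewrite /chi asboolT// /q big1 ?subr0; last by move=> i _; rewrite subrr expr0n.
  by rewrite /sqpos max_r ?sqr_ge0.
exists ((r ^+ 2) ^+ 2 / (C' + 1)), K; split => //.
- by rewrite divr_gt0 ?exprn_gt0// ltr_wpDl.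
- by move=> _ [y /rP[_ [_ Vy]] <-].
- move=> x /rdist_path[l /path_chi[L [L0 -> xL]]]; rewrite lte_fin.
  rewrite ltr_pdivlMr ?ltr_wpDl// => Llt.
  apply: contrapT => /chiK chix; move: xL; rewrite chix chi0 sub0r normrN.
  rewrite ger0_norm ?exprn_ge0 ?sqr_ge0//; nra.
Qed.

End DistanceTopology.

Section RdistContinuity.
Context {R : realType} {n : nat} {M : riemannianManifold R n}.
Implicit Types (p x : M) (g : R -> M).

Definition segment_curve (x0 : M) (y0 v : 'rV[R]_n) (t : R) : M :=
  chart_inv x0 (y0 + sin (pi / 2 * t) *: v).

Lemma sin_le1_norm (t : R) : `|sin t| <= 1.
Proof. by rewrite ler_norml sin_geN1 sin_le1. Qed.

Lemma is_derive_scalel (V : normedModType R) (k : R -> R) (v : V) (t d : R) :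
  is_derive t (1 : R) k d -> is_derive t (1 : R) (fun s => k s *: v) (d *: v).
Proof.
move=> [dk dkE]; have dkd : differentiable k t by exact/derivable1_diffP.
have dz : differentiable (fun s => k s *: v) t by exact: differentiableZl.
apply: DeriveDef; first exact/derivable1_diffP.
rewrite deriveE// -dkE deriveE//.
exact: (congr1 (fun F : R -> V => F 1) (diffZl v dkd)).
Qed.

Lemma is_derive_sin_line (y0 v : 'rV[R]_n) (t : R) :
  is_derive t (1 : R) (fun s : R => y0 + sin (pi / 2 * s) *: v)
    ((pi / 2 * cos (pi / 2 * t)) *: v).
Proof.
have ds : is_derive t (1 : R) (fun s : R => sin (pi / 2 * s)) (pi / 2 * cos (pi / 2 * t)).
  have dl : is_derive t (1 : R) (fun s : R => pi / 2 * s) (pi / 2).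
    have := is_deriveZ (pi / 2) (is_derive_id t (1 : R)).
    by rewrite [X in is_derive _ _ _ X]mulr1.
  have := @is_derive1_comp _ sin (fun s : R => pi / 2 * s) t _ _ (is_derive_sin _) dl.
  by rewrite [X in is_derive _ _ _ X]mulrC.
have := is_deriveD (is_derive_cst y0 t (1 : R)) (is_derive_scalel v ds).
by rewrite add0r.
Qed.

Lemma segment_curve_C1 (x0 : M) (y0 v : 'rV[R]_n) :
  (forall y : 'rV[R]_n, `|y0 - y| <= `|v| -> (chart x0 @` dom x0) y) ->
  C1_curve (segment_curve x0 y0 v).
Proof.
move=> v_im; pose z (t : R) := y0 + sin (pi / 2 * t) *: v.
have zim t : (chart x0 @` dom x0) (z t).
  apply: v_im; rewrite /z opprD addrA subrr sub0r normrN normrZ.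
  by rewrite ler_piMl// sin_le1_norm.
have zc : continuous z.
  move=> t; have [dz _] := is_derive_sin_line y0 v t.
  by apply: differentiable_continuous; exact/derivable1_diffP.
have gc : continuous (segment_curve x0 y0 v).
  move=> t; exact: (cvg_comp _ _ (zc t) (chart_inv_continuous (zim t))).
apply: C1_curveI => // p t pt.
pose D := 'D_v (chart p \o chart_inv x0).
exists (fun s => (pi / 2 * cos (pi / 2 * s)) *: D (z s)).
have Wim s : dom p (segment_curve x0 y0 v s) ->
    (chart x0 @` (dom x0 `&` dom p)) (z s).
  move=> ps; have [w dw wz] := zim s; exists w => //; split => //.
  by move: ps; rewrite /segment_curve -/(z s) -wz chartK.
have [td tc] := @transition_smooth _ _ _ x0 p 1%N.
split.
  apply: filterS (near_dom_curve gc pt) => s ps.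
  have dh := td _ (Wim s ps).
  have := is_derive_chain dh (is_derive_sin_line y0 v s).
  by rewrite linearZ/= /D deriveE.
rewrite /continuous_at; apply: cvgZ.
  apply: cvgMl_tmp; apply: continuous_cvg; first exact: continuous_cos.
  by apply: cvgMl_tmp; exact: cvg_id.
exact: (cvg_comp _ _ (zc t) (tc v _ (Wim t pt))).
Qed.

Lemma segment_curve_velocity (x0 : M) (y0 v : 'rV[R]_n) (t : R) :
  (chart x0 @` dom x0) (y0 + sin (pi / 2 * t) *: v) ->
  velocity (segment_curve x0 y0 v) t
  = tangent_at x0 (y0 + sin (pi / 2 * t) *: v) ((pi / 2 * cos (pi / 2 * t)) *: v).
Proof.
move=> zim; rewrite /velocity /tangent_at derive1E.
set g := segment_curve x0 y0 v.
have dg : dom x0 (g t) by exact: dom_chart_inv.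
have dh := @transition_differentiable _ _ _ x0 (g t) (g t) dg (dom_self _).
rewrite chart_invK// in dh.
have [_ <-] := is_derive_chain dh (is_derive_sin_line y0 v t).
by [].
Qed.

(** Points close in the chart are close for the Riemannian distance: join them by
    a coordinate segment. It is run through at the parameter sin(pi t / 2), which
    keeps the curve inside the chart for all real t. *)
Lemma rdist_near (x0 : M) (e : R) : 0 < e ->
  \forall x \near x0, (rdist x0 x < e%:E)%E.
Proof.
move=> e0; have d0 := @dom_self _ _ M x0; pose y0 := chart x0 x0.
pose G (x : M) : R := \sum_i \sum_j `|gram x0 (chart x0 x) i j|.
have Gc : G x @[x --> x0] --> G x0.
  apply: cvg_sum_fin => i _; apply: cvg_sum_fin => j _.
  by apply: cvg_norm; apply: cvg_coord; apply: gram_cvg => //; exact: cvg_id.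
have G0 x : 0 <= G x by apply: sumr_ge0 => i _; exact: sumr_ge0.
pose A := G x0 + 1.
have A0 : 0 < A by rewrite ltr_wpDl.
have GA : \forall x \near x0, G x <= A by apply: (cvgr_le _ Gc); rewrite ltrDl.
have near_y0 : \forall y \near y0, (chart x0 @` dom x0) y /\
    G (chart_inv x0 y) <= A.
  exact: filterI (near_image d0) (near_chart_inv d0 GA).
have /nbhs_ballP[r /= r0 rP] := near_y0.
(* the speed in the chart is at most pi / 2 times the norm of [v], by the
   parametrization, and the metric there is at most A times the squared norm *)
pose C := Num.sqrt A * (pi / 2).
have C0 : 0 <= C by rewrite mulr_ge0 ?sqrtr_ge0 ?divr_ge0 ?pi_ge0.
pose d := Num.min r (e / (C + 1)).
have dpos : 0 < d by rewrite lt_min r0 divr_gt0// ltr_wpDl.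
near=> x.
have dx : dom x0 x by near: x; exact: near_dom.
pose v := chart x0 x - y0.
have vd : `|v| < d.
  rewrite /v -normrN opprB; near: x.
  have /cvgrPdist_lt := chart_continuous d0; exact.
have v_im y : `|y0 - y| <= `|v| ->
    (chart x0 @` dom x0) y /\ G (chart_inv x0 y) <= A.
  move=> yv; apply: rP; rewrite -ball_normE /=; apply: le_lt_trans yv _.
  by apply: lt_le_trans vd _; rewrite /d ge_min lexx.
pose g := segment_curve x0 y0 v.
have gC : C1_curve g by apply: segment_curve_C1 => y /v_im [].
have g0 : g 0 = x0 by rewrite /g /segment_curve mulr0 sin0 scale0r addr0 chartK.
have g1 : g 1 = x.
  by rewrite /g /segment_curve mulr1 sin_pihalf scale1r addrC subrK chartK.
have := path_rdist (PwC1 gC); rewrite g0 g1 => H; apply: le_lt_trans H _.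
apply: (@le_lt_trans _ _ (C * `|v|)%:E); last first.
  rewrite lte_fin; apply: (@le_lt_trans _ _ ((C + 1) * `|v|)).
    by rewrite ler_wpM2r// lerDl.
  rewrite -ltr_pdivlMl ?ltr_wpDl// mulrC; apply: lt_le_trans vd _.
  by rewrite /d ge_min lexx orbT.
apply: arc_length_le => // t _.
pose z := y0 + sin (pi / 2 * t) *: v.
have [zim Gz] : (chart x0 @` dom x0) z /\ G (chart_inv x0 z) <= A.
  apply: v_im; rewrite /z opprD addrA subrr sub0r normrN normrZ.
  by rewrite ler_piMl// sin_le1_norm.
rewrite /speed segment_curve_velocity// -/z.
pose a := pi / 2 * cos (pi / 2 * t).
rewrite -/a /g /segment_curve -/z /tnorm metric_tangent_at.
have aw : `|a *: v| <= pi / 2 * `|v|.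
  rewrite normrZ ler_wpM2r// /a normrM ger0_norm ?divr_ge0 ?pi_ge0//.
  by rewrite ler_piMr ?divr_ge0 ?pi_ge0// ler_norml cos_geN1 cos_le1.
move: (a *: v) aw => w aw.
rewrite /C -mulrA -[leRHS]ger0_norm; last first.
  by rewrite mulr_ge0 ?sqrtr_ge0// mulr_ge0// divr_ge0 ?pi_ge0.
rewrite -sqrtr_sqr ler_sqrt ?sqr_ge0// exprMn sqr_sqrtr ?(ltW A0)//.
apply: (@le_trans _ _ (A * `|w| ^+ 2)); last first.
  by rewrite ler_wpM2l ?(ltW A0)// lerXn2r ?nnegrE ?mulr_ge0 ?divr_ge0 ?pi_ge0.
apply: (@le_trans _ _ (G (chart_inv x0 z) * `|w| ^+ 2)); last first.
  by rewrite ler_wpM2r// sqr_ge0.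
rewrite /G chart_invK// -mulmxA mxE mulr_suml; apply: ler_sum => i _.
rewrite !mxE mulr_sumr mulr_suml; apply: ler_sum => j _.
rewrite [w^T j 0]mxE; apply: le_trans (ler_norm _) _; rewrite !normrM.
rewrite mulrCA; apply: ler_wpM2l => //; rewrite expr2.
by apply: ler_pM => //; exact: entry_le.
Unshelve. all: by end_near. Qed.

End RdistContinuity.

(** * Bounded sets of complete manifolds *)

Section Ultra.

Lemma ultra_compact_cvg (X : topologicalType) (T : Type) (U : set_system T)
    {UU : UltraFilter U} (f : T -> X) (K : set X) :
  compact K -> (\forall t \near U, K (f t)) ->
  exists2 x, K x & f t @[t --> U] --> x.
Proof.
move=> Kc UK; have [x [Kx xcl]] := Kc (f @ U) _ UK.
exists x => // V xV; have [//|UnV] := in_ultra_setVsetC (f @^-1` V) UU.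
have UnV' : (f t @[t --> U]) (~` V) by [].
by have [y [nVy Vy]] := xcl (~` V) V UnV' xV; case: (nVy Vy).
Qed.

End Ultra.

Section HopfRinow.
Context {R : realType} {n : nat} {M : riemannianManifold R n}.
Implicit Types (p x z : M).

(** Waiting at the end point gives all the paths the same interval of parameters,
    although their lengths differ. *)
Lemma path_lipschitz_upto p x (L : R) : 0 < L -> (rdist p x < L%:E)%E ->
  exists w : R -> M, [/\ (rdist p (w 0%R) <= 0%:E)%E, w L = x &
    forall s t, 0 <= s -> s <= t -> (rdist (w s) (w t) <= (t - s)%:E)%E].
Proof.
move=> L0 /rdist_path[l /path_lipschitz[a [w [a0 -> pw wx wL]]]].
rewrite lte_fin => aL.
exists (fun s => if s <= a then w s else x); split.
- by rewrite a0.
- by rewrite leNgt aL.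
- move=> s t s0 st; case: ifPn => sa; case: ifPn => ta.
  + exact: wL.
  + rewrite -ltNge in ta.
    have := rdist_trans_le (wL s a s0 sa (lexx a)) wx; rewrite addr0.
    move=> H; apply: le_trans H _; rewrite lee_fin; lra.
  + by move: sa; rewrite (le_trans st ta).
  + apply: le_trans (rdist_refl_le x) _; rewrite lee_fin; lra.
Qed.

(** A closed bounded part of a complete Riemannian manifold is compact
    (Hopf-Rinow), in terms of ultrafilters. Each point [w t] is joined to [p] by
    a 1-Lipschitz map on [0, L]; the set of the times up to which these maps
    converge along the ultrafilter is closed by completeness and open by local
    compactness, hence contains [L]. *)
Theorem bounded_ultra_cvg (T : Type) (U : set_system T) {UU : UltraFilter U}
    (w : T -> M) p (B : R) : @complete_manifold R n M ->
  (forall t, (rdist p (w t) <= B%:E)%E) -> exists x, w t @[t --> U] --> x.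
Proof.
move=> Mc wB; pose L := `|B| + 1.
have L0 : 0 < L by rewrite ltr_wpDl.
have wL t : (rdist p (w t) < L%:E)%E.
  apply: rdist_le_lt (wB t) _; rewrite /L.
  by apply: le_lt_trans (ler_norm B) _; rewrite ltrDl.
have /choice[g gP] := fun t => path_lipschitz_upto L0 (wL t).
have gl t (s r e : R) : 0 <= s -> 0 <= r -> `|s - r| < e ->
    (rdist (g t s) (g t r) < e%:E)%E.
  have [_ _ glip] := gP t; move=> s0 r0 sre.
  have [sr|/ltW rs] := leP s r.
    apply: rdist_le_lt (glip s r s0 sr) _.
    by rewrite -(ger0_norm (_ : 0 <= r - s)) ?subr_ge0// distrC.
  apply: rdist_sym_lt; apply: rdist_le_lt (glip r s r0 rs) _.
  by rewrite -(ger0_norm (_ : 0 <= s - r)) ?subr_ge0.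
pose good (s : R) (z : M) := forall e : R, 0 < e ->
  \forall t \near U, (rdist z (g t s) < e%:E)%E.
pose A := [set s : R | 0 <= s <= L /\ forall r, 0 <= r <= s -> exists z, good r z].
have A0 : A 0.
  split; first by rewrite lexx ltW.
  move=> r; rewrite -eq_le => /eqP <-; exists p => e e0.
  apply: filterS filterT => t _; have [p0 _ _] := gP t.
  exact: rdist_le_lt p0 e0.
have supA : has_sup A by split; [exists 0|exists L => s [/andP[]]].
pose b := sup A.
have Ab s : A s -> s <= b by move=> As; exact: ub_le_sup (supA.2) _ As.
have b0 : 0 <= b by exact: Ab.
have bL : b <= L by apply: ge_sup; [exists 0|move=> s [/andP[]]].
have above (r : R) : r < b -> exists2 s, A s & r < s.
  rewrite -subr_gt0 => rb; have [s As] := sup_adherent rb supA.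
  by rewrite subKr; exists s.
have good_lt s : 0 <= s -> s < b -> exists z, good s z.
  by move=> s0 /above[r [_ rg] sr]; apply: rg; rewrite s0 ltW.
have [zb good_b] : exists z, good b z.
  have /choice[s_ sP] : forall j, exists s, [/\ 0 <= s, s <= b, b - j.+1%:R^-1 < s &
      exists z, good s z].
    move=> j; have [|s [/andP[s0 sL] sg] js] := above (b - j.+1%:R^-1).
      by rewrite ltrBlDr ltrDl invr_gt0.
    exists s; split => //; first by apply: Ab; split => //; rewrite s0.
    by apply: sg; rewrite s0 lexx.
  have /choice[z_ zP] : forall j, exists z, good (s_ j) z by move=> j; have [] := sP j.
  have s_near (e : R) : 0 < e -> exists N : nat, forall i, (N <= i)%N ->
      `|s_ i - b| < e.
    move=> e0; have [N _ HN] := near_infty_natSinv_lt (PosNum e0).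
    exists N => i /HN /= ie; have [_ sb bs _] := sP i.
    rewrite distrC ger0_norm ?subr_ge0//; apply: lt_trans ie.
    by rewrite ltrBlDl; move: bs; rewrite ltrBlDr.
  have zcauchy (e : R) : 0 < e -> exists N : nat, forall i j : nat,
      (N <= i)%N -> (N <= j)%N -> (rdist (z_ i) (z_ j) < e%:E)%E.
    move=> e0; have e4 : 0 < e / 4 by rewrite divr_gt0.
    have [N HN] := s_near _ e4; exists N => i j /HN si /HN sj.
    have [t [ti tj]] := filter_ex (filterI (zP i _ e4) (zP j _ e4)).
    have [si0 _ _ _] := sP i; have [sj0 _ _ _] := sP j.
    have ij : `|s_ i - s_ j| < e / 2.
      move: si sj; rewrite !ltr_norml => /andP[? ?] /andP[? ?].
      by apply/andP; split; lra.
    have := rdist_trans_lt (rdist_trans_lt ti (gl t _ _ _ si0 sj0 ij)) (rdist_sym_lt tj).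
    by rewrite (_ : e / 4 + e / 2 + e / 4 = e)//; lra.
  have [z zz] := Mc _ zcauchy; exists z => e e0.
  have e3 : 0 < e / 3 by rewrite divr_gt0.
  have [N HN] := s_near _ e3.
  have [j [jz Nj]] : exists j, (rdist (z_ j) z < (e / 3)%:E)%E /\ (N <= j)%N.
    have : \forall j \near \oo, (rdist (z_ j) z < (e / 3)%:E)%E.
      apply: (zz [set y | (y < (e / 3)%:E)%E]).
      by apply: open_nbhs_nbhs; split; [exact: open_ereal_lt_ereal|rewrite /= lte_fin].
    by move=> /(filterI (nbhs_infty_ge N))/filter_ex[j [Nj jz]]; exists j.
  apply: filterS (zP j _ e3) => t tj; have [sj0 _ _ _] := sP j.
  have := rdist_trans_lt (rdist_trans_lt (rdist_sym_lt jz) tj)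
    (gl t _ _ _ sj0 b0 (HN j Nj)).
  by rewrite (_ : e / 3 + e / 3 + e / 3 = e)//; lra.
have bE : b = L.
  apply/eqP; rewrite eq_le bL /= leNgt; apply/negP => bltL.
  have [e [K [e0 Kc _ eK]]] := rdist_compact_nbhd (@filterT _ (nbhs zb) _).
  have e2 : 0 < e / 2 by rewrite divr_gt0.
  pose s := Num.min L (b + e / 4).
  have bs : b < s by rewrite lt_min bltL ltrDl divr_gt0.
  suff : A s by move=> /Ab; rewrite leNgt bs.
  split; first by rewrite ge_min lexx andbT (le_trans b0)// ltW.
  move=> r /andP[r0 rs]; have [rb|br] := ltP r b; first exact: good_lt.
  have rbe : `|b - r| < e / 2.
    have : r <= b + e / 4 by apply: le_trans rs _; rewrite ge_min lexx orbT.
    by rewrite distrC ger0_norm ?subr_ge0//; lra.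
  have UK : \forall t \near U, K (g t r).
    apply: filterS (good_b _ e2) => t tb; apply: eK.
    have := rdist_trans_lt tb (gl t _ _ _ b0 r0 rbe).
    by rewrite -splitr.
  have [z Kz gz] := ultra_compact_cvg Kc UK.
  by exists z => d d0; exact: (gz _ (rdist_near z d0)).
rewrite bE in good_b; exists zb => V zV.
have [e [K [e0 _ KV eK]]] := rdist_compact_nbhd zV.
apply: filterS (good_b e e0) => t /eK/KV.
by have [_ -> _] := gP t.
Qed.

End HopfRinow.

(** * Retractions and arcs *)

Section Retraction.
Context {R : realType} {n : nat} {M : riemannianManifold R n}.
Variable retr : M -> 'rV[R]_n -> M.
Hypothesis retrP : retraction retr.
Implicit Types (p x : M) (u v w : 'rV[R]_n) (h : M -> R).

Local Notation e_ i := (@delta_mx R 1 n 0 i).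

Lemma is_derive_pair (V W : normedModType R) (f : R -> V) (g : R -> W) t df dg :
  is_derive t (1 : R) f df -> is_derive t (1 : R) g dg ->
  is_derive t (1 : R) (fun s => (f s, g s)) (df, dg).
Proof.
move=> [f1 <-] [g1 <-].
have fd : differentiable f t by exact/derivable1_diffP.
have gd : differentiable g t by exact/derivable1_diffP.
have fgd : differentiable (fun s => (f s, g s)) t by exact: differentiable_pair.
apply: DeriveDef; first exact/derivable1_diffP.
rewrite deriveE// !deriveE//.
exact: (congr1 (fun F : R -> V * W => F 1) (diff_pair fd gd)).
Qed.

Lemma retr_in_chartE p x v : dom p x ->
  retr_in_chart retr p (chart p x, coord_at p x v) = retr x v.
Proof. by move=> px; rewrite /retr_in_chart /= coord_atK// chartK. Qed.

Lemma retr_in_chart0 p x : dom p x -> retr_in_chart retr p (chart p x, 0) = x.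
Proof.
move=> px; rewrite -[X in (_, X)](_ : coord_at p x 0 = 0).
  by rewrite retr_in_chartE//; case: retrP.
by rewrite /coord_at linear0.
Qed.

Lemma cvg_to_pair (T : Type) (F : set_system T) {FF : Filter F} (A B : topologicalType)
    (f : T -> A) (g : T -> B) (a : A) (b : B) :
  f t @[t --> F] --> a -> g t @[t --> F] --> b ->
  (f t, g t) @[t --> F] --> (a, b).
Proof. exact: cvg_pair. Qed.

(** The retraction is continuous at the zero section, and vectors of vanishing
    Riemannian norm have vanishing coordinates in the chart at the limit. *)
Lemma retr_cvg (T : Type) (F : set_system T) {FF : Filter F}
    (x : T -> M) (v : T -> 'rV[R]_n) (x0 : M) :
  x t @[t --> F] --> x0 -> tnorm (x t) (v t) @[t --> F] --> (0 : R) ->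
  retr (x t) (v t) @[t --> F] --> x0.
Proof.
move=> xx0 v0; have d0 := @dom_self _ _ M x0.
have im0 : (chart x0 @` dom x0) (chart x0 x0) by exists x0.
have [rc _ _ _] := retrP.
have rc0 : retr_in_chart retr x0 @ (chart x0 x0, 0 : 'rV[R]_n) --> x0.
  rewrite -[X in _ --> X](retr_in_chart0 d0).
  exact: (rc x0 (chart x0 x0, 0) im0).
have H : retr_in_chart retr x0 (chart x0 (x t), coord_at x0 (x t) (v t))
    @[t --> F] --> x0.
  exact: (cvg_comp _ _ (cvg_to_pair (chart_cvg xx0 d0) (coord_at_cvg0 xx0 v0)) rc0).
apply: (cvg_trans _ H); apply: near_eq_cvg.
by apply: filterS (near_dom_cvg xx0 d0) => t dt /=; rewrite retr_in_chartE.
Qed.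

Lemma is_derive_quad (V : normedModType R) (a b : V) (s : R) :
  is_derive s (1 : R) (fun s : R => s *: a + s ^+ 2 *: b) (a + (2 * s) *: b).
Proof.
have h1 := is_derive_scalel a (is_derive_id s (1 : R)).
have h2 := is_derive_scalel b (is_derive_sqr (is_derive_id s (1 : R))).
have := is_deriveD h1 h2; rewrite scale1r mulr1; exact.
Qed.

(** At 0, the arc has velocity [u] since the differential of the retraction is
    the identity. *)
Lemma arc_derive0 h x u w : C1_mfd h ->
  is_derive (0 : R) (1 : R) (fun s => h (retr x (s *: u + s ^+ 2 *: w)))
    (metric x (grad h x) u).
Proof.
move=> hC; have xx := @dom_self _ _ M x.
have imx : (chart x @` dom x) (chart x x) by exists x.
have [rc rsm r0 rd] := retrP.
have dh := C1_differentiable hC xx.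
have re v : retr_in_chart retr x (chart x x, v) = retr x v.
  by rewrite -{1}(coord_at_self x v) retr_in_chartE.
have dr : differentiable (chart x \o retr x) 0.
  have [dsm _] := rsm x x 1%N.
  have := dsm (chart x x, 0); rewrite /= re r0 => /(_ (conj imx xx)) d1.
  have dp : differentiable (fun v : 'rV[R]_n => (chart x x, v)) 0.
    by apply: differentiable_pair.
  have := differentiable_comp dp d1.
  rewrite (_ : _ \o _ = chart x \o retr x)//.
  by apply/funext => v /=; rewrite re.
pose c (s : R) : 'rV[R]_n := s *: u + s ^+ 2 *: w.
have c0 : c 0 = 0 by rewrite /c scale0r expr0n scale0r addr0.
have dc : is_derive (0 : R) (1 : R) c u.
  by have := is_derive_quad u w 0; rewrite mulr0 scale0r addr0.
have dr' : differentiable (chart x \o retr x) (c 0) by rewrite c0.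
have := is_derive_chain dr' dc; rewrite c0 rd => dy.
have dh' : differentiable (h \o chart_inv x) (((chart x \o retr x) \o c) 0).
  by rewrite /= c0 r0.
have := is_derive_chain dh' dy; rewrite /= c0 r0 -grad_metric//.
apply: near_eq_is_derive.
have cc : {for (0 : R), continuous c}.
  by apply: differentiable_continuous; apply/derivable1_diffP; case: dc.
have rcx : retr x v @[v --> (0 : 'rV[R]_n)] --> x.
  have rc0 : retr_in_chart retr x @ (chart x x, 0 : 'rV[R]_n) --> x.
    rewrite -[X in _ --> X](retr_in_chart0 xx).
    exact: (rc x (chart x x, 0) imx).
  have H : retr_in_chart retr x (chart x x, v) @[v --> (0 : 'rV[R]_n)] --> x.
    have Hc : (fun _ : 'rV[R]_n => chart x x) @ nbhs (0 : 'rV[R]_n) --> chart x x.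
      move=> A /nbhs_singleton Ax.
      exact: (@filterE _ (nbhs (0 : 'rV[R]_n)) (nbhs_filter _)
                (fun _ => A (chart x x)) (fun _ => Ax)).
    have Hi : v @[v --> (0 : 'rV[R]_n)] --> (0 : 'rV[R]_n) by exact: cvg_id.
    exact: (cvg_comp _ _ (cvg_to_pair Hc Hi) rc0).
  by rewrite (_ : (fun v => _) = retr x) in H; last by apply/funext => v; exact: re.
have near_x : \forall s \near (0 : R), dom x (retr x (c s)).
  have := cc; rewrite /prop_for /continuous_at c0 => cc0.
  exact: (cc0 _ (rcx _ (near_dom xx))).
by apply: filterS near_x => s ds /=; rewrite chartK.
Qed.

End Retraction.

Section ArcExpansion.
Context {R : realType} {n : nat} {M : riemannianManifold R n}.
Variable retr : M -> 'rV[R]_n -> M.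
Hypothesis retrP : retraction retr.
Implicit Types (p x : M) (u v w : 'rV[R]_n) (h : M -> R).

Local Notation e_ i := (@delta_mx R 1 n 0 i).
Local Notation tb := ('rV[R]_n * 'rV[R]_n)%type.

Lemma vertical_sum (c : 'rV[R]_n) :
  ((0, c) : tb) = \sum_i c 0 i *: ((0, e_ i) : tb).
Proof.
rewrite {1}(row_sum_delta c).
apply: (big_ind2 (fun (a : 'rV[R]_n) (b : tb) => ((0, a) : tb) = b)) => //.
  by move=> a _ a' _ <- <-; congr pair; rewrite /= addr0.
by move=> i _; congr pair; rewrite /= scaler0.
Qed.

Lemma diff_vertical (F : tb -> 'rV[R]_n) (z : tb) (c : 'rV[R]_n) :
  'd F z (0, c) = \sum_i c 0 i *: 'd F z (0, e_ i).
Proof.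
rewrite vertical_sum linear_sum; apply: eq_bigr => i _; exact: linearZ.
Qed.

Lemma diff_row_sum (F : 'rV[R]_n -> R) (y v : 'rV[R]_n) :
  'd F y v = \sum_i v 0 i * 'd F y (e_ i).
Proof.
rewrite {1}(row_sum_delta v) linear_sum; apply: eq_bigr => i _; exact: linearZ.
Qed.

(** The derivatives along the fibres of [h \o retr], in coordinates. *)
Definition fibre_derive h (x0 : M) (z : tb) (i : 'I_n) : R :=
  \sum_j 'D_((0, e_ i) : tb) (chart x0 \o retr_in_chart retr x0) z 0 j
    * 'D_(e_ j) (h \o chart_inv x0)
        ((chart x0 \o retr_in_chart retr x0) z).

Definition arc_domain (x0 : M) : set tb :=
  [set z | (chart x0 @` dom x0) z.1 /\ dom x0 (retr_in_chart retr x0 z)].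

Lemma near_arc_domain (x0 : M) :
  \forall z \near ((chart x0 x0, 0) : tb), arc_domain x0 z.
Proof.
have d0 := @dom_self _ _ M x0; have [rc _ _ _] := retrP.
have im0 : (chart x0 @` dom x0) (chart x0 x0) by exists x0.
apply: filterI.
  have f1 : (fst : tb -> _) z @[z --> ((chart x0 x0, 0) : tb)] --> chart x0 x0.
    exact: cvg_fst.
  exact: (f1 _ (near_image d0)).
apply: (rc x0 (chart x0 x0, 0) im0).
rewrite retr_in_chart0//; exact: near_dom.
Qed.

Lemma fibre_derive_continuous h (x0 : M) i : C1_mfd h ->
  fibre_derive h x0 z i @[z --> ((chart x0 x0, 0) : tb)]
    --> fibre_derive h x0 (chart x0 x0, 0) i.
Proof.
move=> hC; have d0 := @dom_self _ _ M x0; have [rc rsm _ _] := retrP.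
have im0 : (chart x0 @` dom x0) (chart x0 x0) by exists x0.
have re0 := retr_in_chart0 retrP d0.
have W0 : arc_domain x0 (chart x0 x0, 0) := nbhs_singleton (near_arc_domain x0).
have [sd sc] := rsm x0 x0 1%N.
have Psi0 : (chart x0 \o retr_in_chart retr x0) (chart x0 x0, 0) = chart x0 x0.
  by rewrite /= re0.
apply: cvg_sum_fin => j _; apply: cvgM.
  by apply: cvg_coord; exact: (sc _ _ W0).
have Psic := differentiable_continuous (sd _ W0).
have dc := @C1_derive_continuous _ _ _ h x0 x0 (e_ j) hC d0.
rewrite -{1}Psi0 in dc.
exact: (cvg_comp _ _ Psic dc).
Qed.

(** The chain rule through the charts of the tangent bundle; the formula makes
    visible that the derivative depends continuously on the base point, on the
    directions and on the parameter. *)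
Lemma arc_derive h (x0 x : M) u w (s : R) : C1_mfd h -> dom x0 x ->
  arc_domain x0 (chart x0 x, s *: coord_at x0 x u + s ^+ 2 *: coord_at x0 x w) ->
  (\forall z \near
     ((chart x0 x, s *: coord_at x0 x u + s ^+ 2 *: coord_at x0 x w) : tb),
     arc_domain x0 z) ->
  is_derive s (1 : R) (fun s => h (retr x (s *: u + s ^+ 2 *: w)))
    (\sum_i (coord_at x0 x u + (2 * s) *: coord_at x0 x w) 0 i
      * fibre_derive h x0
         (chart x0 x, s *: coord_at x0 x u + s ^+ 2 *: coord_at x0 x w) i).
Proof.
move=> hC dx; set a := coord_at x0 x u; set b := coord_at x0 x w.
pose zeta (s : R) : tb := (chart x0 x, s *: a + s ^+ 2 *: b).
move=> Ws nearW; have [rc rsm _ _] := retrP; have [sd sc] := rsm x0 x0 1%N.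
pose Psi := chart x0 \o retr_in_chart retr x0.
have dz : is_derive s (1 : R) zeta (0, a + (2 * s) *: b).
  by apply: is_derive_pair; exact: is_derive_quad.
have dPsi : differentiable Psi (zeta s) by exact: sd.
have dh : differentiable (h \o chart_inv x0) ((Psi \o zeta) s).
  by apply: C1_differentiable => //; case: Ws.
have dPz := is_derive_chain dPsi dz.
have := is_derive_chain dh dPz.
set d1 := (X in is_derive _ _ _ X); set d2 := (X in _ -> is_derive _ _ _ X).
have -> : d1 = d2.
  rewrite /d1 /d2 diff_vertical linear_sum; apply: eq_bigr => i _.
  rewrite linearZ; congr (_ * _); rewrite diff_row_sum; apply: eq_bigr => j _.
  by rewrite -!deriveE.
apply: near_eq_is_derive.
have zc : {for s, continuous zeta}.
  by apply: differentiable_continuous; apply/derivable1_diffP; case: dz.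
have near_s : \forall r \near s, arc_domain x0 (zeta r) := zc _ nearW.
apply: filterS near_s => r [_ Wr].
rewrite /Psi /= chartK//; congr h.
by rewrite -(retr_in_chartE retr _ dx) coord_atD !coord_atZ.
Qed.

End ArcExpansion.

Section ArcExpansionUniform.
Context {R : realType} {n : nat} {M : riemannianManifold R n}.
Variable retr : M -> 'rV[R]_n -> M.
Hypothesis retrP : retraction retr.
Implicit Types (p x : M) (u v w : 'rV[R]_n) (h : M -> R).

Local Notation tb := ('rV[R]_n * 'rV[R]_n)%type.

(** First-order expansion of a C^1 function along the arcs of the line search,
    uniform in the base point and in the bounded directions: the derivative along
    an arc is continuous at the zero section. *)
Lemma arc_expansion h (x0 : M) (B e : R) : C1_mfd h -> 0 <= B -> 0 < e ->
  exists2 d : R, 0 < d & \forall x \near x0, forall u w t,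
    tnorm x u <= B -> tnorm x w <= B -> 0 <= t <= d ->
    `|h (retr x (t *: u + t ^+ 2 *: w)) - (h x + t * metric x (grad h x) u)|
      <= e * t.
Proof.
move=> hC B0 e0; have d0 := @dom_self _ _ M x0.
have [C C0 HC] := coord_at_bound x0.
pose B' := C * B; have B'0 : 0 <= B' by rewrite mulr_ge0// ltW.
pose z0 : tb := (chart x0 x0, 0).
pose Q := 1 + \sum_i `|fibre_derive retr h x0 z0 i|.
have Q1 : 1 <= Q by rewrite lerDl sumr_ge0.
pose N := n%:R * B' + 1.
have N1 : 1 <= N by rewrite lerDr mulr_ge0.
(* [Q] bounds the fibre derivatives near the zero section and [N] - 1 the sum of
   the absolute values of n coordinates; half of e pays for the variation e1 of
   the fibre derivatives, the other half for the second-order direction *)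
pose e1 := Num.min 1 (e / (4 * N)).
have e10 : 0 < e1 by rewrite lt_min ltr01 divr_gt0// mulr_gt0// (lt_le_trans _ N1).
have near_z0 : \forall z \near z0, nbhs z (arc_domain retr x0) /\
    forall i, `|fibre_derive retr h x0 z0 i - fibre_derive retr h x0 z i| <= e1.
  have H i : \forall z \near z0,
      `|fibre_derive retr h x0 z0 i - fibre_derive retr h x0 z i| <= e1.
    have fc := @fibre_derive_continuous _ _ _ _ retrP h x0 i hC.
    by move/cvgrPdist_le: fc => /(_ e1 e10).
  exact: filterI (nbhs_interior (near_arc_domain retrP x0)) (filter_forall _ H).
have /nbhs_ballP[r /= r0 rP] := near_z0.
pose d := Num.min (Num.min 1 (r / (2 * B' + 1))) (e / (4 * N * Q)).
have dpos : 0 < d.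
  rewrite !lt_min ltr01 !divr_gt0// ?mulr_gt0 ?(lt_le_trans _ N1) ?(lt_le_trans _ Q1)//.
  by rewrite ltr_wpDl// mulr_ge0.
exists d => //; near=> x => u w t uB wB /andP[t0 td].
have [dx coordB] : dom x0 x /\ forall v, `|coord_at x0 x v| <= C * tnorm x v.
  by near: x.
have yr : ball (chart x0 x0) r (chart x0 x).
  near: x; have /cvg_ball := chart_continuous d0; exact.
pose a := coord_at x0 x u; pose b := coord_at x0 x w.
have aB : `|a| <= B'.
  by apply: le_trans (coordB u) _; rewrite ler_wpM2l// ltW.
have bB : `|b| <= B'.
  by apply: le_trans (coordB w) _; rewrite ler_wpM2l// ltW.
pose zeta (s : R) : tb := (chart x0 x, s *: a + s ^+ 2 *: b).
have d1 : d <= 1 by rewrite /d !ge_min lexx.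
have dr : d <= r / (2 * B' + 1) by rewrite /d !ge_min lexx orbT.
have dN : d <= e / (4 * N * Q) by rewrite /d ge_min lexx orbT.
have zetaP s : 0 <= s <= t -> nbhs (zeta s) (arc_domain retr x0) /\
    forall i, `|fibre_derive retr h x0 z0 i - fibre_derive retr h x0 (zeta s) i| <= e1.
  move=> /andP[s0 st]; apply: rP; split => //=.
  rewrite -ball_normE /= sub0r normrN.
  have sd : s <= d by exact: le_trans td.
  apply: le_lt_trans (ler_normD _ _) _; rewrite !normrZ.
  rewrite (ger0_norm s0) -expr2.
  have s21 : s ^+ 2 <= s by rewrite expr2 ler_piMl// (le_trans sd).
  apply: (@le_lt_trans _ _ (s * (2 * B'))).
    rewrite (_ : s * (2 * B') = s * B' + s * B'); last by ring.
    apply: lerD; first exact: ler_wpM2l.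
    by apply: ler_pM => //; exact: sqr_ge0.
  apply: (@le_lt_trans _ _ (r / (2 * B' + 1) * (2 * B'))).
    by apply: ler_wpM2r; [rewrite mulr_ge0|exact: le_trans sd dr].
  have B1 : 0 < 2 * B' + 1 by rewrite ltr_wpDl// mulr_ge0.
  by rewrite mulrAC ltr_pdivrMr// ltr_pM2l// ltrDl.
pose dphi s := \sum_i (a + (2 * s) *: b) 0 i * fibre_derive retr h x0 (zeta s) i.
pose phi s := h (retr x (s *: u + s ^+ 2 *: w)).
have phid s : 0 <= s <= t -> is_derive s (1 : R) phi (dphi s).
  move=> /zetaP[nz _]; apply: (arc_derive retrP) => //.
  exact: (nbhs_singleton nz).
have phi0 : dphi 0 = metric x (grad h x) u.
  have [|_ <-] := phid 0; first by rewrite lexx.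
  by have [_ <-] := arc_derive0 retrP x u w hC.
have dphi_close s : 0 <= s <= t -> `|dphi s - dphi 0| <= e.
  move=> st; have /andP[s0 st'] := st.
  have [|_ P0] := zetaP 0; first by rewrite lexx.
  have [_ Ps] := zetaP s st.
  rewrite /dphi -sumrB mulr0 scale0r addr0.
  apply: (@le_trans _ _ (\sum_(i < n) (B' * (2 * e1) + 2 * d * B' * Q))).
    apply: le_trans (ler_norm_sum _ _ _) _; apply: ler_sum => i _.
    rewrite !mxE.
    set ps := fibre_derive retr h x0 (zeta s) i.
    set p0 := fibre_derive retr h x0 (zeta 0) i.
    have -> : (a 0 i + 2 * s * b 0 i) * ps - a 0 i * p0
        = a 0 i * (ps - p0) + 2 * s * b 0 i * ps by ring.
    apply: le_trans (ler_normD _ _) _; rewrite normrM !(normrM _ ps).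
    set pz := fibre_derive retr h x0 z0 i in P0 Ps *.
    have h1 : `|ps - p0| <= 2 * e1.
      rewrite -(subrKA pz); apply: le_trans (ler_normD _ _) _.
      rewrite mulr_natl mulr2n distrC; apply: lerD; [exact: Ps|exact: P0].
    have h2 : `|ps| <= Q.
      rewrite -(subrK pz ps); apply: le_trans (ler_normD _ _) _.
      apply: lerD.
        by rewrite distrC; apply: le_trans (Ps i) _; rewrite /e1 ge_min lexx.
      by rewrite (bigD1 i)//= lerDl sumr_ge0.
    apply: lerD; first by apply: ler_pM => //; exact: le_trans (entry_le _ _) aB.
    apply: ler_pM => //; rewrite !normrM ger0_norm// ger0_norm//.
    apply: ler_pM => //; first by rewrite mulr_ge0.
      by rewrite ler_wpM2l// (le_trans st').
    exact: le_trans (entry_le _ _) bB.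
  rewrite sumr_const card_ord -[X in X <= _]mulr_natl.
  rewrite (_ : _ * _ = (N - 1) * (2 * e1 + 2 * d * Q)); last by rewrite /N; ring.
  have e1N : N * e1 <= e / 4.
    apply: (@le_trans _ _ (N * (e / (4 * N)))).
      by rewrite ler_wpM2l ?(le_trans ler01)// /e1 ge_min lexx orbT.
    rewrite le_eqVlt; apply/orP; left; apply/eqP; field.
    by rewrite gt_eqF// (lt_le_trans _ N1).
  have dNQ : N * (d * Q) <= e / 4.
    apply: (@le_trans _ _ (N * (e / (4 * N * Q) * Q))).
      by rewrite ler_wpM2l ?(le_trans ler01)// ler_wpM2r ?(le_trans ler01).
    rewrite le_eqVlt; apply/orP; left; apply/eqP; field.
    by rewrite !gt_eqF// ?(lt_le_trans _ N1)// (lt_le_trans _ Q1).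
  have : 0 <= d * Q by rewrite mulr_ge0 ?ltW// (lt_le_trans _ Q1).
  by have := ltW e10; nra.
have phi00 : phi 0 = h x.
  by rewrite /phi scale0r expr0n scale0r addr0; case: retrP => _ _ -> _.
have mono (c : R) : `|c| <= 1 ->
    0 <= e * t + c * (phi t - (h x + t * dphi 0)).
  move=> c1; pose k (s : R) := (e - c * dphi 0) * s + c * phi s.
  suff : k 0 <= k t by rewrite /k mulr0 phi00; lra.
  apply: (@le_of_derive _ k); first exact: t0.
  move=> s st.
  have dk : is_derive s (1 : R) k ((e - c * dphi 0) + c * dphi s).
    have k1 := is_deriveZ (e - c * dphi 0) (is_derive_id s (1 : R)).
    have k2 := is_deriveZ c (phid s st).
    have := is_deriveD k1 k2; by rewrite [_ *: (1 : R)]mulr1.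
  case: dk => ? dkE; split => //; rewrite derive1E dkE.
  have := dphi_close s st.
  have : `|c * (dphi s - dphi 0)| <= `|dphi s - dphi 0|.
    by rewrite normrM ler_piMl.
  move=> /le_trans /[apply]; rewrite ler_norml => /andP[+ _].
  by move: (dphi s) (dphi 0) => q0 q1 cq; lra.
have m1 := mono 1; have mN := mono (-1).
rewrite normrN normr1 lexx in m1 mN.
have {}m1 := m1 isT; have {}mN := mN isT.
rewrite -phi0 -/(phi t) ler_norml.
by move: (phi t) (dphi 0) m1 mN => q0 q1 m1 mN; apply/andP; split; lra.
Unshelve. all: by end_near. Qed.

End ArcExpansionUniform.

(** * The linear systems of one iteration *)

Section IterationAlgebra.
Context {R : realType} {n m l : nat} {M : riemannianManifold R n}.
Context (retr : M -> 'rV[R]_n -> M) (f : M -> R) (c : 'I_(m + l) -> M -> R).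
Context (P : rqo_params R m l).
Implicit Types (s : rqo_state (m + l) M) (eta teta xi : 'rV[R]_n).
Implicit Types (lam v : 'rV[R]_(m + l)).

(** The invariant of the iterations. Strict feasibility and positive smoothing
    parameters make [alpha] and [beta] positive. *)
Definition valid_state s : Prop :=
  [/\ int_feasible c (st_x s), forall i, 0 < st_mu s 0 i <= mu_bar P,
      0 < st_rho s & sym_posdef (st_x s) (st_H s)].

Local Notation rad s i := (Num.sqrt (c i (st_x s) ^+ 2 + st_mu s 0 i ^+ 2)).

Section Smoothing.
Context (s : rqo_state (m + l) M) (i : 'I_(m + l)).
Hypothesis (c_lt0 : c i (st_x s) < 0) (mu_gt0 : 0 < st_mu s 0 i).

Lemma rad_sqr : rad s i ^+ 2 = c i (st_x s) ^+ 2 + st_mu s 0 i ^+ 2.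
Proof. by rewrite sqr_sqrtr// addr_ge0 ?sqr_ge0. Qed.

Lemma rad_gt0 : 0 < rad s i.
Proof. by rewrite sqrtr_gt0 ltr_wpDl ?sqr_ge0// exprn_gt0. Qed.

Lemma rad_gt_c : - c i (st_x s) < rad s i.
Proof.
rewrite -(@ltr_pXn2r _ 2) ?nnegrE ?sqrtr_ge0 ?oppr_ge0 ?(ltW c_lt0)//.
by rewrite rad_sqr sqrrN ltrDl exprn_gt0.
Qed.

Lemma rad_gt_mu : st_mu s 0 i < rad s i.
Proof.
rewrite -(@ltr_pXn2r _ 2) ?nnegrE ?sqrtr_ge0 ?(ltW mu_gt0)//.
by rewrite rad_sqr ltrDr -sqrrN exprn_gt0// oppr_gt0.
Qed.

Lemma rad_le : rad s i <= - c i (st_x s) + st_mu s 0 i.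
Proof.
have c0 : 0 <= - c i (st_x s) by rewrite oppr_ge0 ltW.
rewrite -(@ler_pXn2r _ 2) ?nnegrE ?sqrtr_ge0 ?addr_ge0 ?(ltW mu_gt0)//.
by rewrite rad_sqr; have := mulr_ge0 c0 (ltW mu_gt0); nra.
Qed.

Lemma alpha_gt0 : 0 < alpha c s i.
Proof.
rewrite /alpha -ltrBlDl sub0r -[_ / _]opprK ltrN2 -mulNr.
by rewrite ltr_pdivrMr ?rad_gt0// mul1r rad_gt_c.
Qed.

Lemma alpha_le1 : alpha c s i <= 1.
Proof. by rewrite /alpha gerDl pmulr_lle0 ?invr_gt0 ?rad_gt0// ltW. Qed.

Lemma beta_sqr : beta c s i ^+ 2 = 1 - st_mu s 0 i / rad s i.
Proof.
rewrite sqr_sqrtr// subr_ge0 ler_pdivrMr ?rad_gt0// mul1r.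
exact/ltW/rad_gt_mu.
Qed.

Lemma beta_gt0 : 0 < beta c s i.
Proof.
rewrite sqrtr_gt0 subr_gt0 ltr_pdivrMr ?rad_gt0// mul1r.
exact: rad_gt_mu.
Qed.

Lemma beta_le1 : beta c s i <= 1.
Proof.
rewrite -(@ler_pXn2r _ 2) ?nnegrE ?(ltW beta_gt0)// expr1n beta_sqr.
by rewrite gerBl divr_ge0 ?ltW ?rad_gt0.
Qed.

(** The square of [beta] is c^2 / (r (r + mu)) with r^2 = c^2 + mu^2. *)
Lemma beta_sqrE :
  beta c s i ^+ 2 * (rad s i * (rad s i + st_mu s 0 i)) = c i (st_x s) ^+ 2.
Proof.
have r0 := rad_gt0; rewrite beta_sqr.
transitivity (rad s i ^+ 2 - st_mu s 0 i ^+ 2); last by rewrite rad_sqr addrK.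
by field; rewrite gt_eqF.
Qed.

(** Away from the boundary [beta] stays away from zero. *)
Lemma beta_lower (d D B : R) : 0 < d -> d <= - c i (st_x s) ->
  - c i (st_x s) <= D -> st_mu s 0 i <= B ->
  d ^+ 2 / ((D + B) * (D + B + B)) <= beta c s i ^+ 2.
Proof.
move=> d0 dc cD muB.
have D0 : 0 < D by lra.
have B0 : 0 < B by exact: lt_le_trans mu_gt0 muB.
have DB : 0 < (D + B) * (D + B + B) by rewrite mulr_gt0// !addr_gt0.
rewrite ler_pdivrMr//.
have r0 := rad_gt0; have rDB : rad s i <= D + B by have := rad_le; lra.
apply: (@le_trans _ _ (c i (st_x s) ^+ 2)).
  by rewrite -(sqrrN (c i _)) lerXn2r ?nnegrE//; lra.
rewrite -[leLHS]beta_sqrE; apply: ler_wpM2l; first exact: sqr_ge0.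
apply: ler_pM => //; last exact: lerD.
by rewrite addr_ge0 ?(ltW r0) ?(ltW mu_gt0).
Qed.

(** Near the boundary [beta] is small, unless the smoothing parameter is small
    too. *)
Lemma beta_upper (u : R) : 0 < u -> u <= st_mu s 0 i ->
  beta c s i <= - c i (st_x s) / u.
Proof.
move=> u0 umu; rewrite ler_pdivlMr//.
rewrite -(@ler_pXn2r _ 2) ?nnegrE ?mulr_ge0 ?(ltW beta_gt0) ?(ltW u0) ?oppr_ge0 ?(ltW c_lt0)//.
rewrite exprMn sqrrN; apply: (@le_trans _ _ (beta c s i ^+ 2
  * (rad s i * (rad s i + st_mu s 0 i)))); last by rewrite beta_sqrE.
apply: ler_wpM2l; first exact: sqr_ge0.
by have := rad_gt_mu; move: (rad s i) mu_gt0 => r mu0 mur; nra.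
Qed.

Lemma alpha_lower (u : R) : 0 < u -> u <= st_mu s 0 i ->
  1 + c i (st_x s) / u <= alpha c s i.
Proof.
move=> u0 umu; rewrite /alpha lerD2l -[_ / u]opprK -[_ / rad s i]opprK lerN2 -!mulNr.
apply: ler_wpM2l; first by rewrite oppr_ge0 ltW.
rewrite lef_pV2 ?posrE ?rad_gt0//; have := rad_gt_mu; lra.
Qed.

End Smoothing.

Section LinearSystem.
Context (s : rqo_state (m + l) M).
Hypothesis sv : valid_state s.

Local Notation x := (st_x s).
Local Notation g := (gradF f c s).
Local Notation a i := (grad (c i) x).

Lemma valid_alpha_gt0 i : 0 < alpha c s i.
Proof. by case: sv => c0 mu0 _ _; apply: alpha_gt0 => //; case/andP: (mu0 i). Qed.

Lemma valid_beta_gt0 i : 0 < beta c s i.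
Proof. by case: sv => c0 mu0 _ _; apply: beta_gt0 => //; case/andP: (mu0 i). Qed.

Lemma valid_alpha_le1 i : alpha c s i <= 1.
Proof. by case: sv => c0 mu0 _ _; apply: alpha_le1 => //; case/andP: (mu0 i). Qed.

Lemma LS_pair v eta lam xi : LS f c s v eta lam ->
  metric x (st_H s eta) xi + \sum_i lam 0 i * metric x (a i) xi
  = - metric x g xi.
Proof.
move=> [/(congr1 (fun u => metric x u xi)) + _].
rewrite metricDl metric_suml metricNl => <-; congr (_ + _).
by apply: eq_bigr => i _; rewrite metricZl.
Qed.

Lemma LS_slope v eta lam i : LS f c s v eta lam ->
  metric x (a i) eta
  = v 0 i / alpha c s i + Num.sqrt 2 * beta c s i / alpha c s i * lam 0 i.
Proof.
move=> [_ /(_ i) <-]; have := valid_alpha_gt0 i => a0.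
by field; rewrite gt_eqF.
Qed.

(** Pairing the first system with the solution of another one, and conversely;
    the operator and the diagonal blocks being symmetric, only the right-hand
    side of the complementarity rows survives. *)
Lemma LS_cross v eta0 lam0 eta lam : LS f c s 0 eta0 lam0 ->
  LS f c s v eta lam ->
  metric x g eta = metric x g eta0 - \sum_i lam0 0 i * (v 0 i / alpha c s i).
Proof.
move=> LS0 LSv; have [_ _ _ [Hsym _]] := sv.
have p1 := LS_pair eta LS0; have p2 := LS_pair eta0 LSv.
have Hs : metric x (st_H s eta0) eta = metric x (st_H s eta) eta0.
  by rewrite Hsym metricC.
suff : \sum_i lam0 0 i * metric x (a i) eta
    = \sum_i lam 0 i * metric x (a i) eta0
      + \sum_i lam0 0 i * (v 0 i / alpha c s i) by lra.
rewrite -big_split /=; apply: eq_bigr => i _.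
by rewrite (LS_slope i LS0) (LS_slope i LSv) mxE; ring.
Qed.

Lemma LS0_descent eta0 lam0 : LS f c s 0 eta0 lam0 ->
  - metric x g eta0 = metric x (st_H s eta0) eta0
    + \sum_i Num.sqrt 2 * beta c s i / alpha c s i * lam0 0 i ^+ 2.
Proof.
move=> LS0; rewrite -(LS_pair eta0 LS0); congr (_ + _).
by apply: eq_bigr => i _; rewrite (LS_slope i LS0) mxE; ring.
Qed.

Lemma min0_pow4 (y : R) : y * Num.min y 0 ^+ 3 = Num.min y 0 ^+ 4.
Proof.
rewrite /Num.min; case: ifPn => [_|]; first by rewrite exprS.
by rewrite !expr0n /= mulr0.
Qed.

(** The cubic right-hand side of the second system is what adds the fourth powers
    of the negative parts of the multipliers to the prediction. *)
Lemma LS1_descent eta0 lam0 eta1 lam1 : LS f c s 0 eta0 lam0 ->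
  LS f c s (v1 c s lam0) eta1 lam1 ->
  - metric x g eta1 = metric x (st_H s eta0) eta0
    + \sum_i Num.sqrt 2 * beta c s i / alpha c s i * lam0 0 i ^+ 2
    + \sum_i Num.min (lam0 0 i) 0 ^+ 4.
Proof.
move=> LS0 LS1; rewrite -(LS0_descent LS0) (LS_cross LS0 LS1) opprB addrC.
congr (_ + _); apply: eq_bigr => i _; rewrite mxE.
rewrite -min0_pow4 mulrAC divff ?mul1r// gt_eqF//; exact: valid_alpha_gt0.
Qed.

Lemma coef_ge0 i : 0 <= Num.sqrt 2 * beta c s i / alpha c s i.
Proof.
by rewrite divr_ge0 ?mulr_ge0 ?sqrtr_ge0 ?ltW ?valid_beta_gt0 ?valid_alpha_gt0.
Qed.

Lemma posdef_ge0 xi : 0 <= metric x (st_H s xi) xi.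
Proof.
have [_ _ _ [_ Hpos]] := sv; have [->|/Hpos /ltW//] := eqVneq xi 0.
by rewrite metric0r.
Qed.

Section Predicted.
Context (eta0 eta1 : 'rV[R]_n) (lam0 lam1 : 'rV[R]_(m + l)).
Hypothesis (LS0 : LS f c s 0 eta0 lam0).
Hypothesis (LS1 : LS f c s (v1 c s lam0) eta1 lam1).

Let sum2_ge0 :
  0 <= \sum_i Num.sqrt 2 * beta c s i / alpha c s i * lam0 0 i ^+ 2.
Proof. by apply: sumr_ge0 => i _; rewrite mulr_ge0 ?coef_ge0 ?sqr_ge0. Qed.

Let sum4_ge0 : 0 <= \sum_i Num.min (lam0 0 i) 0 ^+ 4.
Proof. by apply: sumr_ge0 => i _; rewrite exprn_even_ge0. Qed.

Lemma predicted_ge0 : 0 <= - metric x g eta1.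
Proof. by rewrite (LS1_descent LS0 LS1) !addr_ge0 ?posdef_ge0. Qed.

Lemma predicted_ge_H : metric x (st_H s eta0) eta0 <= - metric x g eta1.
Proof. by rewrite (LS1_descent LS0 LS1) -addrA lerDl addr_ge0. Qed.

Lemma predicted_ge_min i : Num.min (lam0 0 i) 0 ^+ 4 <= - metric x g eta1.
Proof.
rewrite (LS1_descent LS0 LS1) [\sum_i _ ^+ 4](bigD1 i)//=.
rewrite [leRHS]addrCA lerDl; apply: addr_ge0.
  by rewrite addr_ge0// posdef_ge0.
by apply: sumr_ge0 => j _; rewrite exprn_even_ge0.
Qed.

Lemma predicted_ge_sqr i :
  Num.sqrt 2 * beta c s i / alpha c s i * lam0 0 i ^+ 2 <= - metric x g eta1.
Proof.
rewrite (LS1_descent LS0 LS1) [X in _ <= _ + X + _](bigD1 i)//=.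
rewrite -!addrA addrCA lerDl; rewrite !addr_ge0 ?posdef_ge0//.
by apply: sumr_ge0 => j _; rewrite mulr_ge0 ?coef_ge0 ?sqr_ge0.
Qed.

(** The operator is positive definite and the weights of the squared multipliers
    are positive. *)
Lemma predicted_eq0 : metric x g eta1 = 0 -> eta0 = 0 /\ lam0 = 0.
Proof.
move=> g0; have := predicted_ge_H; rewrite g0 oppr0 => H0.
split.
  have [_ _ _ [_ Hpos]] := sv; apply/eqP/negP => /negP/Hpos.
  by rewrite ltNge H0.
apply/rowP => i; rewrite mxE; have := predicted_ge_sqr i.
rewrite g0 oppr0 => li; have k0 : 0 < Num.sqrt 2 * beta c s i / alpha c s i.
  apply: divr_gt0; last exact: valid_alpha_gt0.
  by apply: mulr_gt0; [rewrite sqrtr_gt0 ltr0n|exact: valid_beta_gt0].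
move: li; rewrite pmulr_rle0// => li; apply/eqP; rewrite -sqrf_eq0 eq_le li.
exact: sqr_ge0.
Qed.

Section Theta.
Context (eta2 : 'rV[R]_n).
Local Notation th := (theta f c P s eta1 eta2).
Local Notation eta := ((1 - th) *: eta1 + th *: eta2).

(** In the second case the mixing parameter is chosen to reach equality. *)
Lemma theta_descent : metric x g eta <= tau P * metric x g eta1.
Proof.
rewrite metricDr !metricZr /theta; case: ifPn => [le12|].
  by rewrite subrr mul0r add0r mul1r.
rewrite -ltNge => lt12; rewrite metricBr.
have p0 := predicted_ge0; have /andP[t0 t1] := tauP P.
set g1 := metric x g eta1 in p0 lt12 *; set g2 := metric x g eta2 in lt12 *.
have g12 : g1 - g2 < 0 by nra.
rewrite le_eqVlt; apply/orP; left; apply/eqP; field.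
by rewrite lt_eqF.
Qed.

Lemma theta_bounds : 0 <= th <= 1.
Proof.
rewrite /theta; case: ifPn => [le12|]; first by rewrite ler01 lexx.
rewrite -ltNge => lt12; rewrite metricBr.
have p0 := predicted_ge0; have /andP[t0 t1] := tauP P.
set g1 := metric x g eta1 in p0 lt12 *; set g2 := metric x g eta2 in lt12 *.
have g12 : g1 - g2 < 0 by nra.
apply/andP; split; first by rewrite nmulr_lge0 ?invr_lt0//; nra.
rewrite ler_ndivrMr// mul1r; nra.
Qed.

(** The second direction keeps a definite share of the mixture as long as the
    prediction does not vanish. *)
Lemma theta_lower (e G : R) : 0 < e -> e <= - metric x g eta1 ->
  `|metric x g (eta1 - eta2)| <= G -> Num.min 1 ((1 - tau P) * e / G) <= th.
Proof.
move=> e0 e1 G12; rewrite ge_min /theta; case: ifPn => [_|]; first by rewrite lexx.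
rewrite -ltNge => lt12; rewrite metricBr; rewrite metricBr in G12.
have p0 := predicted_ge0; have /andP[t0 t1] := tauP P.
set g1 := metric x g eta1 in e1 p0 lt12 G12 *.
set g2 := metric x g eta2 in lt12 G12 *.
have g12 : g1 - g2 < 0 by nra.
apply/orP; right.
rewrite ltr0_norm// in G12.
rewrite -[(_ * g1) / _](_ : (1 - tau P) * - g1 / - (g1 - g2) = _); last first.
  by field; rewrite lt_eqF.
apply: ler_pM; rewrite ?mulr_ge0 ?subr_ge0 ?(ltW t1) ?(ltW e0)//.
- by rewrite invr_ge0; lra.
- by rewrite ler_wpM2l// subr_ge0 ltW.
- by rewrite lef_pV2 ?posrE//; lra.
Qed.

End Theta.
End Predicted.
End LinearSystem.

End IterationAlgebra.

(** * Limits along ultrafilters *)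

Section UltraLimits.
Context {R : realType} {T : Type} {U : set_system T} {UU : UltraFilter U}.

Lemma ultra_bounded_cvg (a : T -> R) (B : R) :
  (\forall t \near U, `|a t| <= B) -> exists L : R, a t @[t --> U] --> L.
Proof.
move=> aB; have UK : \forall t \near U, `[- B, B]%classic (a t).
  by apply: filterS aB => t; rewrite ler_norml /= in_itv.
have [L _ aL] := ultra_compact_cvg (@segment_compact R (- B) B) UK.
by exists L.
Qed.

Lemma ultra_bounded_rV_cvg n (a : T -> 'rV[R]_n) (B : R) :
  (forall i, \forall t \near U, `|a t 0 i| <= B) ->
  exists L : 'rV[R]_n, a t @[t --> U] --> L.
Proof.
move=> aB; have /choice[L aL] : forall i, exists L : R, a t 0 i @[t --> U] --> L.
  by move=> i; exact: ultra_bounded_cvg (aB i).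
exists (\row_i L i); apply: cvg_mx => i j; rewrite (ord1 i) mxE; exact: aL.
Qed.

Lemma ultra_notP (A : set T) : ~ U A -> \forall t \near U, ~ A t.
Proof. by move=> nUA; have [] := in_ultra_setVsetC A UU. Qed.

Lemma squeeze0 (a b : T -> R) : b t @[t --> U] --> (0 : R) ->
  (\forall t \near U, `|a t| <= b t) -> a t @[t --> U] --> (0 : R).
Proof.
move=> b0 ab; apply: norm_cvg0.
apply: (@squeeze_cvgr _ _ _ _ (cst 0) b) => //; last exact: cvg_cst.
by apply: filterS ab => t ->; rewrite normr_ge0.
Qed.

Definition diverges (N : T -> R) : Prop := forall B, \forall t \near U, B < N t.

Lemma diverges_inv (N : T -> R) (C : R) : diverges N ->
  C / N t @[t --> U] --> (0 : R).
Proof.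
move=> Ninf; apply/cvgrPdist_le => e e0; near=> t.
have Nt : Num.max 0 (`|C| / e) < N t by near: t; exact: Ninf.
move: Nt; rewrite gt_max => /andP[N0 Nt].
rewrite sub0r normrN normrM normfV (gtr0_norm N0) ler_pdivrMr//.
by rewrite -ler_pdivrMl// mulrC ltW.
Unshelve. all: by end_near. Qed.

Lemma not_diverges_bounded (N : T -> R) : ~ diverges N ->
  exists B : R, \forall t \near U, N t <= B.
Proof.
move=> /existsNP[B /ultra_notP NB]; exists B.
by apply: filterS NB => t /negP; rewrite -leNgt.
Qed.

End UltraLimits.

Section LICQFacts.
Context {R : realType} {n m l : nat} {M : riemannianManifold R n}.
Context (f : M -> R) (c : 'I_(m + l) -> M -> R).

(** The constraint qualification concerns the list of the active gradients; here
    it is read on families of coefficients indexed by all the constraints. *)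
Lemma LICQ_eq0 x (a : 'I_(m + l) -> R) : LICQ c x ->
  (forall i, c i x != 0 -> a i = 0) ->
  \sum_i a i *: grad (c i) x = 0 -> forall i, a i = 0.
Proof.
move=> li a0 suma i; have [ci|/a0//] := eqVneq (c i x) 0.
pose act := [seq j <- enum 'I_(m + l) | c j x == 0].
have iin : i \in act by rewrite mem_filter ci eqxx mem_enum.
pose r := [seq grad (c j) x | j <- act].
have rE (j : nat) : (j < size act)%N -> r`_j = grad (c (nth i act j)) x.
  by move=> js; rewrite /r (nth_map i).
have /freeP free_r : free (in_tuple r) by exact: li.
have is0 : \sum_(j < size r) a (nth i act j) *: (in_tuple r)`_j = 0.
  rewrite -[RHS]suma [in RHS](bigID (fun j => c j x == 0)) /= [X in _ = _ + X]big1 ?addr0; last first.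
    by move=> j /a0 ->; rewrite scale0r.
  transitivity (\sum_(j <- act) a j *: grad (c j) x); last first.
    by rewrite /act big_filter big_enum_cond.
  rewrite [RHS](big_nth i) -(big_mkord xpredT (fun j => a (nth i act j) *: r`_j)).
  rewrite size_map !big_nat; apply: eq_bigr => j /andP[_ js].
  by rewrite rE.
have js : (index i act < size r)%N by rewrite size_map index_mem.
by have := free_r _ is0 (Ordinal js); rewrite /= nth_index.
Qed.

Lemma grad_penalized rho x : C1_mfd f -> (forall i, C1_mfd (c i)) ->
  grad (penalized f c rho) x
  = grad f x - rho *: \sum_(i < l) grad (c (rshift m i)) x.
Proof.
move=> fC cC; have xx := @dom_self _ _ M x.
have df := C1_differentiable fC xx.
have dc i := C1_differentiable (cC i) xx.
pose S : 'rV[R]_n -> R := \sum_(i < l) (c (rshift m i) \o chart_inv x).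
have pE : penalized f c rho \o chart_inv x = (f \o chart_inv x) - rho *: S.
  apply/funext => y; rewrite /penalized /= /S [in RHS]fctE /= fct_sumE.
  by [].
have dS : differentiable S (chart x x).
  by apply: differentiable_sum => i; exact: dc.
have dp : differentiable (penalized f c rho \o chart_inv x) (chart x x).
  rewrite pE; apply: differentiableB => //; exact: differentiableZ.
apply: (@metric_inj _ _ _ x) => v.
have ep := etrans (grad_metric v dp) (esym (deriveE v dp)).
have ef := etrans (grad_metric v df) (esym (deriveE v df)).
have ec i := etrans (grad_metric v (dc i)) (esym (deriveE v (dc i))).
have Sv : derivable S (chart x x) v by exact: diff_derivable.
have fv : derivable (f \o chart_inv x) (chart x x) v by exact: diff_derivable.
have eS : 'D_v S (chart x x)
    = \sum_(i < l) 'D_v (c (rshift m i) \o chart_inv x) (chart x x).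
  by apply: derive_sum => i; apply: diff_derivable; exact: dc.
have eD : 'D_v (penalized f c rho \o chart_inv x) (chart x x)
    = 'D_v (f \o chart_inv x) (chart x x) - rho *: 'D_v S (chart x x).
  have rSv : derivable (rho *: S) (chart x x) v by exact: derivableZ.
  rewrite pE; apply: (etrans (deriveB fv rSv)).
  congr (_ - _); exact: deriveZ.
apply: (etrans ep); apply: (etrans eD); apply: esym.
rewrite metricBl metricZl metric_suml; congr (_ - _); first exact: ef.
rewrite eS; congr (_ * _); apply: eq_bigr => i _; exact: ec.
Qed.

End LICQFacts.

Section OperatorBound.
Context {R : realType} {n : nat} {M : riemannianManifold R n}.

(** A symmetric operator between 0 and [a] has norm at most [a]: expand the form
    at [H xi - a xi]. *)
Lemma tnorm_operator_le (x : M) (H : 'End('rV[R]_n)) (a : R) xi : 0 < a ->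
  (forall u v, metric x (H u) v = metric x u (H v)) ->
  (forall u, 0 <= metric x (H u) u <= a * tnorm x u ^+ 2) ->
  tnorm x (H xi) <= a * tnorm x xi.
Proof.
move=> a0 Hs Hb; rewrite -(@ler_pXn2r _ 2) ?nnegrE ?mulr_ge0 ?tnorm_ge0 ?(ltW a0)//.
have /andP[h0 _] := Hb (H xi - a *: xi).
have /andP[_ h1] := Hb (H xi); have /andP[_ h2] := Hb xi.
move: h0; rewrite linearB linearZ /= !(metricBl, metricBr, metricZl, metricZr).
rewrite (Hs (H xi) xi) -!tnorm_sqr => h0.
rewrite exprMn; nra.
Qed.

End OperatorBound.

(** * Boundedness of multipliers and of the penalty parameter *)

Section AsymptoticSystems.
Context {R : realType} {n m l : nat} {M : riemannianManifold R n}.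
Context (f : M -> R) (c : 'I_(m + l) -> M -> R) (P : rqo_params R m l).
Hypotheses (fC : C1_mfd f) (cC : forall i, C1_mfd (c i)).
Context {T : Type} {U : set_system T} {UU : UltraFilter U}.
Context (st : T -> rqo_state (m + l) M) (x0 : M) (a1 a2 : R).
Hypothesis st_valid : forall t, valid_state c P (st t).
Hypotheses (a1_gt0 : 0 < a1) (a2_gt0 : 0 < a2).
Hypothesis H_bounds : forall t xi,
  a1 * tnorm (st_x (st t)) xi ^+ 2
    <= metric (st_x (st t)) (st_H (st t) xi) xi
    <= a2 * tnorm (st_x (st t)) xi ^+ 2.
Hypothesis x_cvg : st_x (st t) @[t --> U] --> x0.

Local Notation x t := (st_x (st t)).

Lemma c_cvg i : c i (x t) @[t --> U] --> c i x0.
Proof. exact: C1_cvg (cC i) x_cvg. Qed.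

Lemma limit_feasible : feasible c x0.
Proof.
move=> i; apply: (cvgr_to_le (@c_cvg i)).
by apply: filterE => t; have [c0 _ _ _] := st_valid t; apply: ltW.
Qed.

(** The lower bound on [beta] is uniform, the smoothing parameters being at most
    [mu_bar]. *)
Lemma inactive_beta i : c i x0 != 0 ->
  exists2 b : R, 0 < b & \forall t \near U, b <= beta c (st t) i.
Proof.
move=> ci0; have ci : 0 < - c i x0.
  by rewrite oppr_gt0 lt_neqAle ci0 limit_feasible.
set d := - c i x0 in ci.
have mB := mu_barP P; pose D := 2 * d; pose d2 := d / 2.
pose b := d2 ^+ 2 / ((D + mu_bar P) * (D + mu_bar P + mu_bar P)).
have d2pos : 0 < d2 by rewrite divr_gt0.
exists b.
  by rewrite divr_gt0 ?exprn_gt0// mulr_gt0// !addr_gt0// mulr_gt0.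
have cN : - c i (x t) @[t --> U] --> d by apply: cvgN; exact: (@c_cvg i).
near=> t; have [c0 mu0 _ _] := st_valid t; have /andP[mu1 mu2] := mu0 i.
have b1 := beta_lower (c0 i) mu1 d2pos (_ : d2 <= - c i (x t))
  (_ : - c i (x t) <= D) mu2.
apply: (@le_trans _ _ (beta c (st t) i ^+ 2)).
  apply: b1.
    by near: t; apply: (cvgr_ge _ cN); rewrite /d2 ltr_pdivrMr//; lra.
  by near: t; apply: (cvgr_le _ cN); rewrite /D; lra.
by rewrite expr2 ler_piMl ?beta_le1// (ltW (beta_gt0 _ _)).
Unshelve. all: by end_near. Qed.

Lemma grad_bounded h : C1_mfd h ->
  exists2 G : R, 0 < G & \forall t \near U, tnorm (x t) (grad h (x t)) <= G.
Proof.
move=> hC; exists (tnorm x0 (grad h x0) + 1); first by rewrite ltr_wpDl ?tnorm_ge0.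
have H : tnorm (x t) (grad h (x t)) @[t --> U] --> tnorm x0 (grad h x0).
  exact: tnorm_cvg x_cvg (coord_grad_cvg hC x_cvg).
by apply: (cvgr_le _ H); rewrite ltrDl.
Qed.

Lemma st_operator_le t xi : tnorm (x t) (st_H (st t) xi) <= a2 * tnorm (x t) xi.
Proof.
have [_ _ _ [Hs _]] := st_valid t.
apply: tnorm_operator_le => // u; have /andP[h1 ->] := H_bounds t u.
by rewrite (le_trans _ h1)// mulr_ge0 ?sqr_ge0 ?ltW.
Qed.

(** Rescaled by a divergent normalization, the multipliers converge to a linear
    dependency between the active gradients and the penalty gradient: the other
    terms of the stationarity equation stay bounded, and complementarity kills
    the multipliers of the inactive constraints. *)
Lemma asymptotic_multipliers (N : T -> R) (W : R) (v : T -> 'rV[R]_(m + l))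
    (w : T -> 'I_(m + l) -> R)
    (eta : T -> 'rV[R]_n) (lam : T -> 'rV[R]_(m + l))
    (lamhat : 'I_(m + l) -> R) (rhohat : R) :
  (\forall t \near U, LS f c (st t) (v t) (eta t) (lam t)) ->
  (\forall t \near U, forall i, v t 0 i = alpha c (st t) i * w t i
      /\ `|w t i| <= W) ->
  diverges (U := U) N ->
  tnorm (x t) (eta t) / N t @[t --> U] --> (0 : R) ->
  (forall i, lam t 0 i / N t @[t --> U] --> lamhat i) ->
  st_rho (st t) / N t @[t --> U] --> rhohat ->
  (forall i, c i x0 != 0 -> lamhat i = 0) /\
  \sum_i lamhat i *: grad (c i) x0
    = rhohat *: \sum_(i < l) grad (c (rshift m i)) x0.
Proof.
move=> LSv vw Ninf eta0 lam_cvg rho_cvg.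
have Npos : \forall t \near U, 0 < N t by exact: Ninf.
split=> [i ci0|].
  have [b b0 bb] := inactive_beta ci0; have [A A0 AA] := grad_bounded (cC i).
  have lim0 : lam t 0 i / N t @[t --> U] --> (0 : R).
    apply: (@squeeze0 _ _ _ _ _
      (fun t => A / b * (tnorm (x t) (eta t) / N t) + (W / b) / N t)).
      rewrite -[0](_ : A / b * 0 + 0 = _); last by rewrite mulr0 addr0.
      apply: cvgD; last exact: diverges_inv.
      by apply: cvgMl_tmp.
    near=> t; have Nt : 0 < N t by near: t.
    have LSt : LS f c (st t) (v t) (eta t) (lam t) by near: t.
    have [vE wW] : v t 0 i = alpha c (st t) i * w t i /\ `|w t i| <= W.
      by have : forall i, v t 0 i = alpha c (st t) i * w t i
        /\ `|w t i| <= W by near: t.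
    have bt : b <= beta c (st t) i by near: t.
    have At : tnorm (x t) (grad (c i) (x t)) <= A by near: t.
    have [_ /(_ i)] := LSt; rewrite vE => row_i.
    have al0 := valid_alpha_gt0 (st_valid t) i.
    have al1 := valid_alpha_le1 (st_valid t) i.
    set y := metric _ _ (eta t) in row_i.
    have yA : `|y| <= A * tnorm (x t) (eta t).
      apply: le_trans (metric_cauchy_schwarz _ _ _) _.
      by rewrite ler_wpM2r ?tnorm_ge0.
    have s2 : 1 <= Num.sqrt (2 : R).
      by rewrite -[leLHS]sqrtr1; apply: ler_wsqrtr; rewrite ler1n.
    have bl : b * `|lam t 0 i| <= A * tnorm (x t) (eta t) + W.
      apply: (@le_trans _ _ (`|alpha c (st t) i * (y - w t i)|)).
        rewrite (_ : _ * (y - w t i)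
          = Num.sqrt 2 * beta c (st t) i * lam t 0 i); last by rewrite mulrBr; lra.
        rewrite normrM ler_wpM2r// ger0_norm ?mulr_ge0 ?sqrtr_ge0//.
        apply: le_trans bt _; rewrite ler_peMl//.
        exact: sqrtr_ge0.
      rewrite normrM (gtr0_norm al0).
      apply: (@le_trans _ _ (1 * `|y - w t i|)); first by rewrite ler_wpM2r.
      rewrite mul1r; apply: le_trans (ler_normB _ _) _; exact: lerD.
    rewrite normrM normfV (gtr0_norm Nt).
    rewrite (_ : _ + _ = (A * tnorm (x t) (eta t) + W) / b / N t); last first.
      by field; rewrite !gt_eqF.
    by rewrite ler_pM2r ?invr_gt0// ler_pdivlMr// mulrC.
  exact: cvg_unique (lam_cvg i) lim0.
pose X t : 'rV[R]_n := \sum_i (lam t 0 i / N t) *: grad (c i) (x t)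
  - (st_rho (st t) / N t) *: \sum_(i < l) grad (c (rshift m i)) (x t).
have [Gf Gf0 GfG] := grad_bounded fC.
have X0 : tnorm (x t) (X t) @[t --> U] --> (0 : R).
  apply: (@squeeze0 _ _ _ _ _
    (fun t => Gf / N t + a2 * (tnorm (x t) (eta t) / N t))).
    rewrite -[0](_ : 0 + a2 * 0 = _); last by rewrite mulr0 addr0.
    apply: cvgD; first exact: diverges_inv.
    by apply: cvgMl_tmp.
  near=> t; have Nt : 0 < N t by near: t.
  have LSt : LS f c (st t) (v t) (eta t) (lam t) by near: t.
  have Gt : tnorm (x t) (grad f (x t)) <= Gf by near: t.
  have XE : X t = (N t)^-1 *: - (grad f (x t) + st_H (st t) (eta t)).
    have [row _] := LSt.
    rewrite /gradF grad_penalized// opprB in row.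
    have rowE : \sum_i lam t 0 i *: grad (c i) (x t)
        - st_rho (st t) *: \sum_(i < l) grad (c (rshift m i)) (x t)
        = - (grad f (x t) + st_H (st t) (eta t)).
      move/(canRL (addKr _)): row => ->.
      by rewrite -addrA addrAC subrr add0r opprD addrC.
    rewrite -rowE scalerBr scaler_sumr scalerA mulrC; congr (_ - _).
    by apply: eq_bigr => i _; rewrite scalerA mulrC.
  rewrite ger0_norm ?tnorm_ge0// XE tnormZ tnormN gtr0_norm ?invr_gt0//.
  rewrite mulrC mulrA -mulrDl ler_pM2r ?invr_gt0//.
  apply: le_trans (tnormD _ _ _) _; apply: lerD => //; exact: st_operator_le.
have Xc0 : coord_at x0 (x t) (X t) @[t --> U] --> (0 : 'rV[R]_n).
  exact: coord_at_cvg0.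
have Xc : coord_at x0 (x t) (X t) @[t --> U] --> \sum_i lamhat i *: grad (c i) x0
    - rhohat *: \sum_(i < l) grad (c (rshift m i)) x0.
  have gc i : coord_at x0 (x t) (grad (c i) (x t)) @[t --> U] --> grad (c i) x0.
    exact: (coord_grad_cvg (cC i) x_cvg).
  rewrite (_ : (fun t => _) = fun t => \sum_i (lam t 0 i / N t) *:
      coord_at x0 (x t) (grad (c i) (x t)) - (st_rho (st t) / N t) *:
      \sum_(i < l) coord_at x0 (x t) (grad (c (rshift m i)) (x t))); last first.
    apply/funext => t; rewrite /X coord_atB coord_atZ !coord_at_sum.
    by congr (_ - _); apply: eq_bigr => i _; rewrite coord_atZ.
  apply: cvg_mx => i j; rewrite !mxE !summxE.
  under eq_cvg do rewrite !mxE !summxE.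
  apply: cvgB.
    apply: cvg_sum_fin => k _; rewrite mxE; under eq_cvg do rewrite mxE.
    by apply: cvgM; [exact: lam_cvg|exact: (cvg_coord (gc k))].
  apply: cvgM => //; apply: cvg_sum_fin => k _.
  exact: (cvg_coord (gc (rshift m k))).
apply/eqP; rewrite -subr_eq0; apply/eqP.
exact: (cvg_unique _ Xc Xc0).
Unshelve. all: by end_near. Qed.

End AsymptoticSystems.

Section MultiplierBounds.
Context {R : realType} {n m l : nat} {M : riemannianManifold R n}.
Context (f : M -> R) (c : 'I_(m + l) -> M -> R) (P : rqo_params R m l).
Hypotheses (fC : C1_mfd f) (cC : forall i, C1_mfd (c i)).
Context {T : Type} {U : set_system T} {UU : UltraFilter U}.
Context (st : T -> rqo_state (m + l) M) (x0 : M) (a1 a2 : R).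
Hypothesis st_valid : forall t, valid_state c P (st t).
Hypotheses (a1_gt0 : 0 < a1) (a2_gt0 : 0 < a2).
Hypothesis H_bounds : forall t xi,
  a1 * tnorm (st_x (st t)) xi ^+ 2
    <= metric (st_x (st t)) (st_H (st t) xi) xi
    <= a2 * tnorm (st_x (st t)) xi ^+ 2.
Hypothesis x_cvg : st_x (st t) @[t --> U] --> x0.
Hypothesis licq : LICQ c x0.

Local Notation x t := (st_x (st t)).

Lemma gradF_bounded (rho : R) :
  (\forall t \near U, st_rho (st t) = rho) ->
  exists2 G : R, 0 < G & \forall t \near U, tnorm (x t) (gradF f c (st t)) <= G.
Proof.
move=> rhoE; have [Gf Gf0 fG] := grad_bounded x_cvg fC.
have /choice[G GP] : forall i, exists G : R, 0 < G /\
    \forall t \near U, tnorm (x t) (grad (c i) (x t)) <= G.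
  by move=> i; have [G G0 cG] := grad_bounded x_cvg (cC i); exists G.
exists (Gf + `|rho| * \sum_(i < l) G (rshift m i)).
  rewrite ltr_pwDl// mulr_ge0// sumr_ge0// => i _.
  by have [/ltW] := GP (rshift m i).
near=> t; rewrite /gradF grad_penalized//.
have -> : st_rho (st t) = rho by near: t.
apply: le_trans (tnormD _ _ _) _; rewrite tnormN tnormZ; apply: lerD; first by near: t.
apply: ler_wpM2l => //; apply: le_trans (tnorm_sum _ _ _ _) _.
apply: ler_sum => i _; move: i; near: t.
apply: filter_forall => i; exact: (GP (rshift m i)).2.
Unshelve. all: by end_near. Qed.

(** Unbounded solutions could be rescaled to norm 1: coercivity kills the limit of
    the directions, and the limit of the multipliers is then a nontrivial
    dependency between active gradients. *)
Lemma LS_bounded (rho W : R) (v : T -> 'rV[R]_(m + l))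
    (w : T -> 'I_(m + l) -> R)
    (eta : T -> 'rV[R]_n) (lam : T -> 'rV[R]_(m + l)) :
  (\forall t \near U, st_rho (st t) = rho) ->
  (\forall t \near U, LS f c (st t) (v t) (eta t) (lam t)) ->
  (\forall t \near U, forall i, v t 0 i = alpha c (st t) i * w t i
      /\ `|w t i| <= W) -> 0 <= W ->
  exists B : R, \forall t \near U, tnorm (x t) (eta t) <= B /\
    forall i, `|lam t 0 i| <= B.
Proof.
move=> rhoE LSv vw W0.
pose N t := tnorm (x t) (eta t) + \sum_i `|lam t 0 i|.
have eta_le t : tnorm (x t) (eta t) <= N t by rewrite lerDl sumr_ge0.
have lam_le t i : `|lam t 0 i| <= N t.
  rewrite /N (bigD1 i)//= addrCA lerDl addr_ge0 ?tnorm_ge0//.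
  by rewrite sumr_ge0.
have [Ninf|/not_diverges_bounded[B NB]] := pselect (diverges (U := U) N); last first.
  exists B; apply: filterS NB => t tB; split; first exact: le_trans (eta_le t) tB.
  by move=> i; exact: le_trans (lam_le t i) tB.
exfalso; have Npos : \forall t \near U, 0 < N t by exact: Ninf.
have ratio (a : T -> R) : (forall t, `|a t| <= N t) ->
    exists L : R, a t / N t @[t --> U] --> L.
  move=> aN; apply: (@ultra_bounded_cvg _ _ _ _ _ 1).
  near=> t; have Nt : 0 < N t by near: t.
  by rewrite normrM normfV (gtr0_norm Nt) ler_pdivrMr// mul1r.
have /choice[lamhat lam_cvg] : forall i, exists L : R, lam t 0 i / N t @[t --> U] --> L.
  by move=> i; apply: ratio => t; exact: lam_le.
have [nuh nu_cvg] : exists L : R, tnorm (x t) (eta t) / N t @[t --> U] --> L.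
  by apply: ratio => t; rewrite ger0_norm ?tnorm_ge0.
have [G G0 GG] := gradF_bounded rhoE.
have nu2 : (tnorm (x t) (eta t) / N t) * (tnorm (x t) (eta t) / N t)
    @[t --> U] --> (0 : R).
  apply: (@squeeze0 _ _ _ _ _ (fun t => ((G + W) / a1) / N t)).
    exact: diverges_inv.
  near=> t; have Nt : 0 < N t by near: t.
  have LSt : LS f c (st t) (v t) (eta t) (lam t) by near: t.
  have vwt : forall i, v t 0 i = alpha c (st t) i * w t i /\ `|w t i| <= W by near: t.
  have Gt : tnorm (x t) (gradF f c (st t)) <= G by near: t.
  have := LS_pair (eta t) LSt; have /andP[Ht _] := H_bounds t (eta t).
  have sum_ge : - (W * \sum_i `|lam t 0 i|)
      <= \sum_i lam t 0 i * metric (x t) (grad (c i) (x t)) (eta t).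
    rewrite mulr_sumr -sumrN; apply: ler_sum => i _.
    rewrite (LS_slope (st_valid t) i LSt); have [-> wW] := vwt i.
    rewrite [alpha _ _ _ * _]mulrC mulfK; last first.
      by rewrite gt_eqF// (valid_alpha_gt0 (st_valid t)).
    rewrite mulrDr; apply: (@le_trans _ _ (lam t 0 i * w t i)).
      have : `|lam t 0 i * w t i| <= W * `|lam t 0 i|.
        by rewrite normrM mulrC ler_wpM2r.
      by rewrite ler_norml => /andP[].
    rewrite lerDl mulrCA -expr2 mulr_ge0 ?sqr_ge0//.
    exact: (coef_ge0 (st_valid t)).
  move=> pair.
  have gle : - metric (x t) (gradF f c (st t)) (eta t) <= G * tnorm (x t) (eta t).
    apply: le_trans (ler_norm _) _; rewrite normrN.
    apply: le_trans (metric_cauchy_schwarz _ _ _) _.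
    by rewrite ler_wpM2r ?tnorm_ge0.
  have key : a1 * tnorm (x t) (eta t) ^+ 2 <= (G + W) * N t.
    have h1 : G * tnorm (x t) (eta t) <= G * N t by rewrite ler_wpM2l// ltW.
    have h2 : W * \sum_i `|lam t 0 i| <= W * N t.
      by rewrite ler_wpM2l// /N lerDr tnorm_ge0.
    by rewrite mulrDl; lra.
  rewrite ger0_norm; last first.
    by rewrite mulr_ge0// divr_ge0 ?tnorm_ge0 ?ltW.
  have aN : a1 * N t ^+ 2 != 0 by rewrite gt_eqF// mulr_gt0// exprn_gt0.
  have -> : (G + W) / a1 / N t = (G + W) * N t / (a1 * N t ^+ 2).
    by field; rewrite !gt_eqF.
  have -> : tnorm (x t) (eta t) / N t * (tnorm (x t) (eta t) / N t)
      = a1 * tnorm (x t) (eta t) ^+ 2 / (a1 * N t ^+ 2).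
    by field; rewrite !gt_eqF.
  by rewrite ler_pM2r// invr_gt0 mulr_gt0// exprn_gt0.
have nuh0 : nuh = 0.
  have nuM : tnorm (x t) (eta t) / N t * (tnorm (x t) (eta t) / N t)
    @[t --> U] --> nuh * nuh by exact: cvgM.
  have : nuh * nuh = 0 by exact: (cvg_unique _ nuM nu2).
  by move/eqP; rewrite mulf_eq0 orbb => /eqP.
rewrite nuh0 in nu_cvg.
have rho_cvg : st_rho (st t) / N t @[t --> U] --> (0 : R).
  apply: (cvg_trans _ (diverges_inv rho Ninf)); apply: near_eq_cvg.
  by apply: filterS rhoE => t ->.
have [act0] := asymptotic_multipliers fC cC st_valid a1_gt0 a2_gt0 H_bounds x_cvg
  LSv vw Ninf nu_cvg lam_cvg rho_cvg.
rewrite scale0r => /(LICQ_eq0 licq act0) lamhat0.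
have total : tnorm (x t) (eta t) / N t + \sum_i `|lam t 0 i / N t|
    @[t --> U] --> (0 + \sum_i `|lamhat i| : R).
  apply: cvgD => //; apply: cvg_sum_fin => i _; exact: cvg_norm.
rewrite big1 ?addr0 in total; last by move=> i _; rewrite lamhat0 normr0.
have total1 : tnorm (x t) (eta t) / N t + \sum_i `|lam t 0 i / N t|
    @[t --> U] --> (1 : R).
  apply: (cvg_trans _ (@cvg_cst _ (1 : R) T U _)); apply: near_eq_cvg.
  near=> t; have Nt : 0 < N t by near: t.
  under eq_bigr do rewrite normrM normfV (gtr0_norm Nt).
  by rewrite -mulr_suml -mulrDl divff// gt_eqF.
have : 1 = 0 :> R by exact: (cvg_unique _ total1 total).
by move/eqP; rewrite oner_eq0.
Unshelve. all: by end_near. Qed.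

Lemma sum_penalty (g : 'I_(m + l) -> 'rV[R]_n) (b : R) :
  \sum_(i < m + l) (if (m <= i)%N then b else 0) *: g i
  = b *: \sum_(i < l) g (rshift m i).
Proof.
rewrite big_split_ord /= big1 ?add0r; last first.
  by move=> i _; rewrite leqNgt ltn_ord scale0r.
by rewrite scaler_sumr; apply: eq_bigr => i _; rewrite leq_addr.
Qed.

(** Were the penalty parameter unbounded, the rescaled multipliers of the first
    system would converge to a nonnegative dual combination. Infeasible limits
    are excluded by hypothesis; at a feasible limit the constraint qualification
    identifies the multipliers of the equality constraints with the penalty
    parameter, so that they are eventually large and the test fails. *)
Lemma penalty_bounded (eta0 : T -> 'rV[R]_n) (lam0 : T -> 'rV[R]_(m + l)) :
  (~ feasible_P c x0 -> no_dual_combination c x0) ->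
  (\forall t \near U, LS f c (st t) 0 (eta0 t) (lam0 t)) ->
  (\forall t \near U, penalty_test P (st t) (eta0 t) (lam0 t)) ->
  ~ diverges (U := U) (fun t => st_rho (st t)).
Proof.
move=> nodual LS0 test rhoinf.
have rho0 t : 0 < st_rho (st t) by have [] := st_valid t.
pose N t := st_rho (st t) + \sum_i `|lam0 t 0 i|.
have N0 t : 0 < N t by rewrite ltr_pwDl ?sumr_ge0.
have rho_le t : st_rho (st t) <= N t by rewrite lerDl sumr_ge0.
have lam_le t i : `|lam0 t 0 i| <= N t.
  rewrite /N (bigD1 i)//= addrCA lerDl addr_ge0 ?(ltW (rho0 t))//.
  by rewrite sumr_ge0.
have Ninf : diverges (U := U) N.
  move=> B; apply: filterS (rhoinf B) => t Bt; exact: lt_le_trans (rho_le t).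
have ratio (a : T -> R) : (forall t, `|a t| <= N t) ->
    exists L : R, a t / N t @[t --> U] --> L.
  move=> aN; apply: (@ultra_bounded_cvg _ _ _ _ _ 1).
  near=> t; by rewrite normrM normfV (gtr0_norm (N0 t)) ler_pdivrMr// mul1r.
have /choice[lamhat lam_cvg] : forall i, exists L : R, lam0 t 0 i / N t @[t --> U] --> L.
  by move=> i; apply: ratio => t; exact: lam_le.
have [rhohat rho_cvg] : exists L : R, st_rho (st t) / N t @[t --> U] --> L.
  by apply: ratio => t; rewrite gtr0_norm.
have eta_cvg : tnorm (x t) (eta0 t) / N t @[t --> U] --> (0 : R).
  apply: (squeeze0 (diverges_inv (r1 P) Ninf)).
  near=> t; have /and3P[eta_r1 _ _] : penalty_test P (st t) (eta0 t) (lam0 t) by near: t.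
  rewrite ger0_norm ?divr_ge0 ?tnorm_ge0 ?(ltW (N0 t))//.
  by rewrite ler_pM2r ?invr_gt0.
have vw0 : \forall t \near U, forall i, (0 : 'rV[R]_(m + l)) 0 i
    = alpha c (st t) i * 0 /\ `|0 : R| <= 0.
  by apply: filterE => t i; rewrite mxE mulr0 normr0.
have [act0 dual] := asymptotic_multipliers (w := fun _ _ => 0) fC cC st_valid
  a1_gt0 a2_gt0 H_bounds x_cvg LS0 vw0 Ninf eta_cvg lam_cvg rho_cvg.
have lamhat_ge0 i : 0 <= lamhat i.
  have r3lim : - r3 P / N t @[t --> U] --> (0 : R) by exact: diverges_inv.
  have diff_cvg : lam0 t 0 i / N t - (- r3 P / N t) @[t --> U] --> lamhat i - 0.
    exact: (cvgB (lam_cvg i) r3lim).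
  rewrite subr0 in diff_cvg.
  apply: (cvgr_to_ge diff_cvg); near=> t; rewrite subr_ge0 /=.
  rewrite ler_pM2r ?invr_gt0//.
  have /and3P[_ _ /forallP] : penalty_test P (st t) (eta0 t) (lam0 t) by near: t.
  exact.
have rhohat_ge0 : 0 <= rhohat.
  apply: (cvgr_to_ge rho_cvg); near=> t; by rewrite divr_ge0// ltW.
(* the normalization: limits of ratios summing to 1 *)
have total : rhohat + \sum_i lamhat i = 1.
  have t1 : st_rho (st t) / N t + \sum_i `|lam0 t 0 i / N t|
      @[t --> U] --> rhohat + \sum_i `|lamhat i|.
    apply: cvgD => //; apply: cvg_sum_fin => i _; exact: cvg_norm.
  have t2 : st_rho (st t) / N t + \sum_i `|lam0 t 0 i / N t| @[t --> U] --> (1 : R).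
    apply: (cvg_trans _ (@cvg_cst _ (1 : R) T U _)); apply: near_eq_cvg.
    near=> t.
    under eq_bigr do rewrite normrM normfV (gtr0_norm (N0 t)).
    by rewrite -mulr_suml -mulrDl divff// gt_eqF// N0.
  have <- : rhohat + \sum_i `|lamhat i| = 1 by exact: (cvg_unique _ t1 t2).
  congr (_ + _).
  by apply: eq_bigr => i _; rewrite ger0_norm.
have rhohat_gt0 : 0 < rhohat.
  rewrite lt_neqAle rhohat_ge0 andbT eq_sym; apply/eqP => rh0.
  move: dual; rewrite rh0 scale0r => /(LICQ_eq0 licq act0) lam_eq0.
  move: total; rewrite rh0 add0r big1// => /eqP.
  by rewrite eq_sym oner_eq0.
have [x0P|x0P] := pselect (feasible_P c x0).
- (* all the equality constraints are active at a feasible point, hence the dual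
     relation is a dependency between active gradients *)
  pose b i := lamhat i - (if (m <= i)%N then rhohat else 0).
  have bsum : \sum_i b i *: grad (c i) x0 = 0.
    rewrite (eq_bigr (fun i => lamhat i *: grad (c i) x0
      - (if (m <= i)%N then rhohat else 0) *: grad (c i) x0)); last first.
      by move=> i _; rewrite scalerBl.
    by rewrite sumrB dual sum_penalty subrr.
  have bact i : c i x0 != 0 -> b i = 0.
    rewrite /b; case: (split_ordP i) => j -> cj0; rewrite act0//=.
      by rewrite leqNgt ltn_ord subrr.
    by have [_ /(_ j) cj] := x0P; rewrite cj eqxx in cj0.
  have lamE j : lamhat (rshift m j) = rhohat.
    have := LICQ_eq0 licq bact bsum (rshift m j).
    by rewrite /b leq_addr => /eqP; rewrite subr_eq0 => /eqP.
  have large : \forall t \near U, forall j : 'I_l, r2 P <= lam0 t 0 (rshift m j).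
    apply: filter_forall => j.
    have half : \forall t \near U, rhohat / 2 <= lam0 t 0 (rshift m j) / N t.
      apply: (cvgr_ge _ (lam_cvg (rshift m j))); rewrite lamE.
      by rewrite ltr_pdivrMr// ltr_pMr// ltr1n.
    near=> t; have h1 : rhohat / 2 <= lam0 t 0 (rshift m j) / N t by near: t.
    have h2 : r2 P / (rhohat / 2) < N t by near: t; exact: Ninf.
    rewrite ltr_pdivrMr ?divr_gt0// in h2; rewrite ler_pdivlMr// in h1.
    by apply: ltW; apply: lt_le_trans h1; rewrite mulrC.
  have [t [lt /and3P[_ /negP nl _]]] := filter_ex (filterI large test).
  by apply: nl; apply/forallP.
- apply: (nodual x0P).
  exists (fun i => lamhat (lshift l i) / rhohat), (fun i => lamhat (rshift m i) / rhohat).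
  split.
  + by move=> i _; rewrite divr_ge0.
  + by move=> i _; rewrite divr_ge0.
  + apply: (scalerI (lt0r_neq0 rhohat_gt0)).
    rewrite scaler0 !scalerBr -dual big_split_ord /=.
    rewrite [X in X + _ - _ - _](bigID (fun i => c (lshift l i) x0 == 0)) /=.
    rewrite [X in _ + X + _ - _ - _]big1 ?addr0; last first.
      by move=> i /act0 ->; rewrite scale0r.
    rewrite [X in _ + X - _ - _](bigID (fun i => c (rshift m i) x0 == 0)) /=.
    rewrite [X in _ + (_ + X) - _ - _]big1 ?addr0; last first.
      by move=> i /act0 ->; rewrite scale0r.
    rewrite !scaler_sumr.
    rewrite [X in _ - X - _](eq_bigr (fun i => lamhat (lshift l i) *: grad (c (lshift l i)) x0)); last first.
      by move=> i _; rewrite scalerA mulrC divfK ?gt_eqF.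
    rewrite [X in _ - X](eq_bigr (fun i => lamhat (rshift m i) *: grad (c (rshift m i)) x0)); last first.
      by move=> i _; rewrite scalerA mulrC divfK ?gt_eqF.
    by rewrite addrAC addrK subrr.
Unshelve. all: by end_near. Qed.

End MultiplierBounds.

(** * Iterations of the algorithm *)

Section PenalizedC1.
Context {R : realType} {n m l : nat} {M : riemannianManifold R n}.
Context (f : M -> R) (c : 'I_(m + l) -> M -> R).

Lemma penalized_C1 rho : C1_mfd f -> (forall i, C1_mfd (c i)) ->
  C1_mfd (penalized f c rho).
Proof.
move=> fC cC p.
pose S : 'rV[R]_n -> R := \sum_(i < l) (c (rshift m i) \o chart_inv p).
have pE : penalized f c rho \o chart_inv p = (f \o chart_inv p) - rho *: S.
  by apply/funext => y; rewrite /penalized /= /S [in RHS]fctE /= fct_sumE.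
have [fd fc] := fC p; have cd i := (cC i p).1; have cc i := (cC i p).2.
have Sd y : (chart p @` dom p) y -> differentiable S y.
  by move=> py; apply: differentiable_sum => i; exact: cd.
have pd y : (chart p @` dom p) y -> differentiable (penalized f c rho \o chart_inv p) y.
  move=> py; rewrite pE; apply: differentiableB; first exact: fd.
  by apply: differentiableZ; exact: Sd.
split => // v y py.
have Dsum z : (chart p @` dom p) z -> 'D_v (penalized f c rho \o chart_inv p) z
    = 'D_v (f \o chart_inv p) z
      - rho * \sum_(i < l) 'D_v (c (rshift m i) \o chart_inv p) z.
  move=> pz; have Sv : derivable S z v by apply: diff_derivable; exact: Sd.
  have rSv : derivable (rho *: S) z v by exact: derivableZ.
  have fv : derivable (f \o chart_inv p) z v by apply: diff_derivable; exact: fd.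
  rewrite pE; apply: (etrans (deriveB fv rSv)); congr (_ - _).
  apply: (etrans (deriveZ _ Sv)); congr (_ * _).
  by apply: derive_sum => i; apply: diff_derivable; exact: cd.
have im_near : \forall z \near y, (chart p @` dom p) z.
  by apply: open_nbhs_nbhs; split => //; exact: chart_open.
pose D z := 'D_v (f \o chart_inv p) z
  - rho * \sum_(i < l) 'D_v (c (rshift m i) \o chart_inv p) z.
have Dc : D z @[z --> y] --> D y.
  have fcy : 'D_v (f \o chart_inv p) z @[z --> y] --> 'D_v (f \o chart_inv p) y.
    exact: (fc v y py).
  have scy : \sum_(i < l) 'D_v (c (rshift m i) \o chart_inv p) z @[z --> y]
      --> \sum_(i < l) 'D_v (c (rshift m i) \o chart_inv p) y.
    apply: (@cvg_sum_fin _ _ (nbhs y) (nbhs_filter y)) => i _.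
    exact: (cc (rshift m i) v y py).
  apply: (cvgB fcy); exact: cvgMl_tmp.
suff : 'D_v (penalized f c rho \o chart_inv p) z @[z --> y]
    --> 'D_v (penalized f c rho \o chart_inv p) y by [].
rewrite (Dsum y py); apply: (cvg_trans _ Dc).
apply: near_eq_cvg; first exact: (nbhs_filter y).
by apply: (@filterS _ (nbhs y) (nbhs_filter y) _ _ _ im_near) => z /Dsum ->.
Qed.

End PenalizedC1.

Section Steps.
Context {R : realType} {n m l : nat} {M : riemannianManifold R n}.
Context (retr : M -> 'rV[R]_n -> M) (f : M -> R) (c : 'I_(m + l) -> M -> R).
Context (P : rqo_params R m l).
Hypothesis l_gt0 : (0 < l)%N.
Implicit Types (s : rqo_state (m + l) M).

(** The witnesses of a moving iteration, bundled so that they can be chosen as a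
    sequence. *)
Record step_data := StepData {
  sd_eta1 : 'rV[R]_n; sd_lam1 : 'rV[R]_(m + l);
  sd_eta2 : 'rV[R]_n; sd_lam2 : 'rV[R]_(m + l);
  sd_teta : 'rV[R]_n; sd_t : R }.

Definition sd_theta s (D : step_data) : R :=
  theta f c P s (sd_eta1 D) (sd_eta2 D).

Definition sd_eta s (D : step_data) : 'rV[R]_n :=
  (1 - sd_theta s D) *: sd_eta1 D + sd_theta s D *: sd_eta2 D.

Definition sd_lam s (D : step_data) : 'rV[R]_(m + l) :=
  (1 - sd_theta s D) *: sd_lam1 D + sd_theta s D *: sd_lam2 D.

Definition moving_step s (eta0 : 'rV[R]_n) (lam0 : 'rV[R]_(m + l)) (D : step_data) s' :
    Prop :=
  [/\ LS f c s (v1 c s lam0) (sd_eta1 D) (sd_lam1 D),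
      LS f c s (v2 c P s lam0 (sd_eta1 D)) (sd_eta2 D) (sd_lam2 D),
      tnorm (st_x s) (sd_teta D) <= tnorm (st_x s) (sd_eta s D),
      arc_step retr f c P s (sd_eta s D) (sd_teta D) (sd_t D) &
      [/\ st_x s' = Defs.arc retr s (sd_eta s D) (sd_teta D) (sd_t D),
          st_rho s' = st_rho s,
          forall i, st_mu s' 0 i =
            Num.min (Num.max (lam0 0 i) (tnorm (st_x s) (sd_eta s D))) (mu_bar P) &
          sym_posdef (st_x s') (st_H s')]].

Lemma rqo_step_moving s eta0 lam0 s' :
  rqo_step retr f c P s eta0 lam0 s' -> ~~ penalty_test P s eta0 lam0 ->
  exists D, moving_step s eta0 lam0 D s'.
Proof.
move=> [_ +] ntest; rewrite (negbTE ntest).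
move=> [eta1 [lam1 [eta2 [lam2 [teta [t]]]]]] /= [LS1 LS2 cor arcs next].
exists (StepData eta1 lam1 eta2 lam2 teta t); split => //.
by case: cor => [[_ //]|[_ ->]]; rewrite tnorm0 tnorm_ge0.
Qed.

Lemma penalty_test_zero s : penalty_test P s 0 0.
Proof.
rewrite /penalty_test tnorm0 (ltW (r1P P)) /=; apply/andP; split.
  by apply/forallPn; exists (Ordinal l_gt0); rewrite mxE -ltNge r2P.
by apply/forallP => i; rewrite mxE oppr_le0 ltW// r3P.
Qed.

(** A null direction would annihilate the prediction, hence the solution of the
    first system; but the null solution passes the penalty test. The new smoothing
    parameters are therefore positive. *)
Lemma moving_direction_neq0 s eta0 lam0 D s' : valid_state c P s ->
  LS f c s 0 eta0 lam0 -> ~~ penalty_test P s eta0 lam0 ->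
  moving_step s eta0 lam0 D s' -> 0 < tnorm (st_x s) (sd_eta s D).
Proof.
move=> sv LS0 ntest [LS1 _ _ _ _]; rewrite lt_neqAle tnorm_ge0 andbT eq_sym.
apply/eqP => /tnorm_eq0 eta00.
have := theta_descent sv LS0 LS1 (sd_eta2 D).
rewrite -/(sd_theta s D) -/(sd_eta s D) eta00 metric0r => h.
have p0 := predicted_ge0 sv LS0 LS1; have /andP[t0 _] := tauP P.
have : metric (st_x s) (gradF f c s) (sd_eta1 D) = 0.
  by apply/eqP; rewrite eq_le -oppr_ge0 p0 /= -(pmulr_rge0 _ t0).
move=> /(predicted_eq0 sv LS0 LS1)[eta0E lam0E].
by move: ntest; rewrite eta0E lam0E penalty_test_zero.
Qed.

Lemma step_valid s eta0 lam0 s' : valid_state c P s ->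
  rqo_step retr f c P s eta0 lam0 s' -> valid_state c P s'.
Proof.
move=> sv step; have [test|ntest] := boolP (penalty_test P s eta0 lam0).
  move: step => [_]; rewrite test => ->; have [s1 s2 s3 s4] := sv.
  by split => //=; rewrite mulr_gt0// (lt_trans ltr01)// rho_factorP.
have [D mD] := rqo_step_moving step ntest.
have eta_pos := moving_direction_neq0 sv step.1 ntest mD.
have [_ _ _ [j [tE [_ acc] _]] [xE xr xmu xH]] := mD.
have [_ _ s3 _] := sv; split => //; last by rewrite xr.
- by rewrite xE tE.
- move=> i; rewrite xmu ge_min lexx orbT andbT.
  by rewrite lt_min mu_barP andbT lt_max eta_pos orbT.
Qed.

Lemma moving_decrease s eta0 lam0 D s' : valid_state c P s ->
  LS f c s 0 eta0 lam0 -> moving_step s eta0 lam0 D s' ->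
  [/\ 0 < sd_t D,
      metric (st_x s) (gradF f c s) (sd_eta s D)
        <= tau P * metric (st_x s) (gradF f c s) (sd_eta1 D) &
      penalized f c (st_rho s) (st_x s')
        <= penalized f c (st_rho s) (st_x s)
           + sigma P * sd_t D * metric (st_x s) (gradF f c s) (sd_eta s D)].
Proof.
move=> sv LS0 [LS1 _ _ [j [tE [dec _] _]] [-> _ _ _]]; split.
- by rewrite tE exprn_gt0//; case/andP: (varsigmaP P).
- exact: theta_descent LS0 LS1 _.
- by rewrite tE.
Qed.

Section Run.
Context (s : nat -> rqo_state (m + l) M) (eta0 : nat -> 'rV[R]_n).
Context (lam0 : nat -> 'rV[R]_(m + l)).
Hypothesis run : rqo_free retr f c P s eta0 lam0.

Lemma run_step k : rqo_step retr f c P (s k) (eta0 k) (lam0 k) (s k.+1).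
Proof. by have [_ _ _ _] := run. Qed.

Lemma run_valid k : valid_state c P (s k).
Proof.
elim: k => [|k ih]; last exact: step_valid (run_step k).
have [x0 H0 rho0 mu0 _] := run; split => //; first by rewrite mu0; exact: mu_initP.
by rewrite rho0 rho_initP.
Qed.

Lemma run_rho k : st_rho (s k.+1) = if penalty_test P (s k) (eta0 k) (lam0 k)
  then rho_factor P * st_rho (s k) else st_rho (s k).
Proof.
have st := run_step k; case: ifPn => [test|ntest].
  by move: st => [_]; rewrite test => ->.
by have [D [_ _ _ _ [_ -> _ _]]] := rqo_step_moving st ntest.
Qed.

Lemma run_rho_ge j k : (j <= k)%N -> st_rho (s j) <= st_rho (s k).
Proof.
move=> /subnK <-; elim: (k - j)%N => [|i ih]; first by rewrite add0n.
rewrite addSn run_rho; case: ifPn => // _; apply: le_trans ih _.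
have [_ _ rho0 _] := run_valid (i + j).
by rewrite ler_peMl ?(ltW rho0)// ltW// rho_factorP.
Qed.

(** Each update multiplies the penalty parameter by a factor exceeding 1, so
    infinitely many updates make it unbounded. *)
Lemma run_rho_unbounded :
  (forall k, exists2 j, (k <= j)%N & penalty_test P (s j) (eta0 j) (lam0 j)) ->
  forall B, exists k, B < st_rho (s k).
Proof.
move=> often B; have fac := rho_factorP P.
have pow i : exists k, rho_factor P ^+ i * st_rho (s 0) <= st_rho (s k).
  elim: i => [|i [k ih]]; first by exists 0; rewrite expr0 mul1r.
  have [j kj test] := often k; exists j.+1; rewrite run_rho test exprS -mulrA.
  apply: ler_wpM2l; first by rewrite ltW// (lt_trans ltr01).
  exact: le_trans ih (run_rho_ge kj).
have [_ _ r0 _] := run_valid 0.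
have [i Bi] : exists i, B / st_rho (s 0) < rho_factor P ^+ i.
  pose q := rho_factor P - 1; have q0 : 0 < q by rewrite subr_gt0.
  have bern i : 1 + i%:R * q <= rho_factor P ^+ i.
    elim: i => [|i ih]; first by rewrite mul0r addr0 expr0.
    have iq : 0 <= i%:R * q * q by rewrite !mulr_ge0 ?ler0n ?(ltW q0).
    rewrite exprS; apply: le_trans (_ : (1 + q) * (1 + i%:R * q) <= _).
      by rewrite -natr1 mulrDl; lra.
    have -> : 1 + q = rho_factor P by rewrite /q addrC subrK.
    by apply: ler_wpM2l => //; rewrite ltW// (lt_trans ltr01).
  pose i := (Num.truncn (B / st_rho (s 0) / q)).+1.
  exists i; apply: lt_le_trans (bern i).
  have : B / st_rho (s 0) / q < i%:R by exact: truncnS_gt.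
  by rewrite ltr_pdivrMr//; lra.
have [k Hk] := pow i; exists k; apply: lt_le_trans Hk.
by rewrite -ltr_pdivrMr.
Qed.

End Run.
End Steps.

(** * Vanishing predictions *)

Section StationaryLimits.
Context {R : realType} {n m l : nat} {M : riemannianManifold R n}.
Context (f : M -> R) (c : 'I_(m + l) -> M -> R) (P : rqo_params R m l).
Hypotheses (fC : C1_mfd f) (cC : forall i, C1_mfd (c i)).
Context {T : Type} {U : set_system T} {UU : UltraFilter U}.
Context (st : T -> rqo_state (m + l) M) (x0 : M) (a1 a2 rho : R).
Hypothesis st_valid : forall t, valid_state c P (st t).
Hypotheses (a1_gt0 : 0 < a1) (a2_gt0 : 0 < a2).
Hypothesis H_bounds : forall t xi,
  a1 * tnorm (st_x (st t)) xi ^+ 2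
    <= metric (st_x (st t)) (st_H (st t) xi) xi
    <= a2 * tnorm (st_x (st t)) xi ^+ 2.
Hypothesis x_cvg : st_x (st t) @[t --> U] --> x0.
Hypothesis rhoE : \forall t \near U, st_rho (st t) = rho.

Local Notation x t := (st_x (st t)).

(** A vanishing prediction makes the limit a KKT pair: the first direction, the
    negative parts of the multipliers and the inactive multipliers all vanish. The
    penalty test then fails only because of its second condition, which bounds
    the multipliers of the equality constraints away from zero; complementarity
    gives feasibility for the original problem. *)
Lemma stationary_limit (eta0 eta1 : T -> 'rV[R]_n)
    (lam0 lam1 : T -> 'rV[R]_(m + l)) (ls : 'rV[R]_(m + l)) :
  (\forall t \near U, LS f c (st t) 0 (eta0 t) (lam0 t)) ->
  (\forall t \near U, LS f c (st t) (v1 c (st t) (lam0 t)) (eta1 t) (lam1 t)) ->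
  (\forall t \near U, ~~ penalty_test P (st t) (eta0 t) (lam0 t)) ->
  lam0 t @[t --> U] --> ls ->
  - metric (x t) (gradF f c (st t)) (eta1 t) @[t --> U] --> (0 : R) ->
  KKT_Prho f c rho x0 ls /\ exists lam, KKT_P f c x0 lam.
Proof.
move=> LS0 LS1 ntest lam_cvg phi0.
have lami i : lam0 t 0 i @[t --> U] --> ls 0 i by exact: cvg_coord.
have eta2 : tnorm (x t) (eta0 t) * tnorm (x t) (eta0 t) @[t --> U] --> (0 : R).
  have phi1 : a1^-1 * - metric (x t) (gradF f c (st t)) (eta1 t) @[t --> U] --> (0 : R).
    by rewrite -[0](mulr0 a1^-1); exact: cvgMl_tmp.
  apply: (squeeze0 phi1); near=> t.
  have LS0t : LS f c (st t) 0 (eta0 t) (lam0 t) by near: t.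
  have LS1t : LS f c (st t) (v1 c (st t) (lam0 t)) (eta1 t) (lam1 t) by near: t.
  rewrite ger0_norm ?mulr_ge0 ?tnorm_ge0// ler_pdivlMl// -expr2.
  have /andP[h1 _] := H_bounds t (eta0 t); apply: le_trans h1 _.
  exact: (predicted_ge_H (st_valid t) LS0t LS1t).
have eta_cvg : tnorm (x t) (eta0 t) @[t --> U] --> (0 : R).
  apply/cvgrPdist_lt => e e0; have e20 : 0 < e ^+ 2 by rewrite exprn_gt0.
  have /cvgrPdist_lt/(_ _ e20) := eta2; apply: filterS => t.
  rewrite !sub0r !normrN -expr2 normrX => h.
  by rewrite -(@ltr_pXn2r _ 2) ?nnegrE ?(ltW e0).
have ls_ge0 i : 0 <= ls 0 i.
  rewrite leNgt; apply/negP => ls0.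
  pose q := (ls 0 i / 2) ^+ 4.
  have q0 : 0 < q by rewrite exprn_even_gt0//= lt_eqF// pmulr_llt0// invr_gt0.
  have half : \forall t \near U, lam0 t 0 i <= ls 0 i / 2.
    by apply: (cvgr_le _ (lami i)); rewrite ltr_pdivlMr//; lra.
  have small : \forall t \near U,
      - metric (x t) (gradF f c (st t)) (eta1 t) < q by exact: (cvgr_lt _ phi0).
  have [t [[th ts] [LS0t LS1t]]] := filter_ex (filterI (filterI half small) (filterI LS0 LS1)).
  have := le_lt_trans (predicted_ge_min (st_valid t) LS0t LS1t i) ts.
  rewrite ltNge /q => /negP; apply.
  have l2 : ls 0 i / 2 <= 0 by rewrite pmulr_lle0 ?invr_gt0// ltW.
  have lt0 : lam0 t 0 i <= 0 by exact: le_trans l2.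
  have pow4 (z : R) : z ^+ 4 = (- z) ^+ 4 by ring.
  rewrite min_l// (pow4 (ls 0 i / 2)) (pow4 (lam0 t 0 i)).
  by rewrite lerXn2r ?nnegrE ?oppr_ge0 ?lerN2.
have ls_act i : c i x0 != 0 -> ls 0 i = 0.
  move=> ci0; have [b b0 bb] := inactive_beta cC st_valid x_cvg ci0.
  have [A A0 AA] := grad_bounded x_cvg (cC i).
  have lim0 : lam0 t 0 i @[t --> U] --> (0 : R).
    have bnd : (A / b) * tnorm (x t) (eta0 t) @[t --> U] --> (0 : R).
      by rewrite -[0](mulr0 (A / b)); exact: cvgMl_tmp.
    apply: (squeeze0 bnd); near=> t.
    have LS0t : LS f c (st t) 0 (eta0 t) (lam0 t) by near: t.
    have bt : b <= beta c (st t) i by near: t.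
    have At : tnorm (x t) (grad (c i) (x t)) <= A by near: t.
    have [_ /(_ i)] := LS0t; rewrite mxE => row_i.
    have al0 := valid_alpha_gt0 (st_valid t) i.
    have al1 := valid_alpha_le1 (st_valid t) i.
    set y := metric _ _ (eta0 t) in row_i.
    have yA : `|y| <= A * tnorm (x t) (eta0 t).
      apply: le_trans (metric_cauchy_schwarz _ _ _) _.
      by rewrite ler_wpM2r ?tnorm_ge0.
    have s2 : 1 <= Num.sqrt (2 : R).
      by rewrite -[leLHS]sqrtr1; apply: ler_wsqrtr; rewrite ler1n.
    rewrite mulrAC ler_pdivlMr// mulrC.
    apply: (@le_trans _ _ (`|alpha c (st t) i * y|)).
      rewrite (_ : _ * y = Num.sqrt 2 * beta c (st t) i * lam0 t 0 i); last by lra.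
      rewrite normrM ler_wpM2r// ger0_norm ?mulr_ge0 ?sqrtr_ge0//.
      apply: le_trans bt _; rewrite ler_peMl//.
      exact: sqrtr_ge0.
    by rewrite normrM (gtr0_norm al0); apply: le_trans yA; rewrite ler_piMl.
  exact: (cvg_unique _ (lami i) lim0).
have x0f : feasible c x0 by exact: (limit_feasible cC st_valid x_cvg).
have pC := penalized_C1 rho fC cC.
have stat : grad (penalized f c rho) x0 + \sum_i ls 0 i *: grad (c i) x0 = 0.
  pose X t : 'rV[R]_n := grad (penalized f c rho) (x t)
    + \sum_i lam0 t 0 i *: grad (c i) (x t).
  have X0 : tnorm (x t) (X t) @[t --> U] --> (0 : R).
    have bnd : a2 * tnorm (x t) (eta0 t) @[t --> U] --> (0 : R).
      by rewrite -[0](mulr0 a2); exact: cvgMl_tmp.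
    apply: (squeeze0 bnd); near=> t.
    have [row _] : LS f c (st t) 0 (eta0 t) (lam0 t) by near: t.
    have rt : st_rho (st t) = rho by near: t.
    have -> : X t = - st_H (st t) (eta0 t).
      rewrite /X -rt -/(gradF f c (st t)).
      move/(canRL (addKr _)): row => ->.
      by rewrite addrCA subrr addr0.
    rewrite tnormN ger0_norm ?tnorm_ge0//.
    exact: (st_operator_le st_valid a1_gt0 a2_gt0 H_bounds).
  have Xc0 : coord_at x0 (x t) (X t) @[t --> U] --> (0 : 'rV[R]_n).
    exact: coord_at_cvg0.
  have Xc : coord_at x0 (x t) (X t) @[t --> U]
      --> grad (penalized f c rho) x0 + \sum_i ls 0 i *: grad (c i) x0.
    have gc i : coord_at x0 (x t) (grad (c i) (x t)) @[t --> U] --> grad (c i) x0.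
      exact: (coord_grad_cvg (cC i) x_cvg).
    have gp : coord_at x0 (x t) (grad (penalized f c rho) (x t)) @[t --> U]
        --> grad (penalized f c rho) x0 by exact: (coord_grad_cvg pC x_cvg).
    rewrite (_ : (fun t => _) = fun t =>
        coord_at x0 (x t) (grad (penalized f c rho) (x t))
        + \sum_i lam0 t 0 i *: coord_at x0 (x t) (grad (c i) (x t))); last first.
      apply/funext => t; rewrite /X coord_atD coord_at_sum.
      by congr (_ + _); apply: eq_bigr => i _; rewrite coord_atZ.
    apply: cvgD => //; apply: cvg_mx => i j; rewrite summxE.
    under eq_cvg do rewrite summxE.
    apply: cvg_sum_fin => k _; rewrite mxE; under eq_cvg do rewrite mxE.
    by apply: cvgM; [exact: lami|exact: (cvg_coord (gc k))].
  exact: (cvg_unique _ Xc Xc0).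
have comp i : ls 0 i * c i x0 = 0.
  by have [->|/ls_act ->] := eqVneq (c i x0) 0; rewrite ?mulr0 ?mul0r.
split.
  have sgn i : 0 <= ls 0 i /\ ls 0 i * c i x0 = 0 by split; [exact: ls_ge0|exact: comp].
  exact: (And3 x0f stat sgn).
have eq_mult j : r2 P <= ls 0 (rshift m j).
  apply: (cvgr_to_ge (lami (rshift m j))); near=> t.
  have : ~~ penalty_test P (st t) (eta0 t) (lam0 t) by near: t.
  rewrite /penalty_test !negb_and negbK => /orP[|/orP[/forallP//|]].
    move/negP; case; near: t; apply: (cvgr_le _ eta_cvg); exact: r1P.
  move=> /forallPn[i]; rewrite -ltNge => h; exfalso; move: h.
  apply/negP; rewrite -leNgt; move: i; near: t; apply: filter_forall => i.
  apply: (cvgr_ge _ (lami i)); apply: lt_le_trans (ls_ge0 i).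
  by rewrite oppr_lt0 r3P.
exists (\row_i (ls 0 i - (if (m <= i)%N then rho else 0))); split.
- split=> [i|j]; first exact: (x0f (lshift l i)).
  have /eqP := comp (rshift m j); rewrite mulf_eq0 => /orP[/eqP h|/eqP//].
  by have := eq_mult j; rewrite h leNgt r2P.
- apply: (etrans _ stat); rewrite grad_penalized//.
  rewrite (eq_bigr (fun i => ls 0 i *: grad (c i) x0
    - (if (m <= i)%N then rho else 0) *: grad (c i) x0)); last first.
    by move=> i _; rewrite mxE scalerBl.
  by rewrite sumrB sum_penalty addrA [in RHS]addrAC.
- move=> i; rewrite mxE /= leqNgt ltn_ord /= subr0; split => //.
Unshelve. all: by end_near. Qed.

End StationaryLimits.

(** * Step lengths *)

Section StepLength.
Context {R : realType} {n m l : nat} {M : riemannianManifold R n}.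
Context (retr : M -> 'rV[R]_n -> M).
Context (f : M -> R) (c : 'I_(m + l) -> M -> R) (P : rqo_params R m l).
Hypothesis retrP : retraction retr.
Hypotheses (fC : C1_mfd f) (cC : forall i, C1_mfd (c i)).
Context {T : Type} {U : set_system T} {UU : UltraFilter U}.
Context (st st' : T -> rqo_state (m + l) M) (x0 : M) (a1 a2 rho : R).
Hypothesis st_valid : forall t, valid_state c P (st t).
Hypotheses (a1_gt0 : 0 < a1) (a2_gt0 : 0 < a2).
Hypothesis H_bounds : forall t xi,
  a1 * tnorm (st_x (st t)) xi ^+ 2
    <= metric (st_x (st t)) (st_H (st t) xi) xi
    <= a2 * tnorm (st_x (st t)) xi ^+ 2.
Hypothesis x_cvg : st_x (st t) @[t --> U] --> x0.
Hypothesis rhoE : \forall t \near U, st_rho (st t) = rho.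
Hypothesis licq : LICQ c x0.
Context (eta0 : T -> 'rV[R]_n) (lam0 : T -> 'rV[R]_(m + l)).
Context (D : T -> step_data (R := R) (n := n) (m := m) (l := l)).
Hypothesis LS0 : \forall t \near U, LS f c (st t) 0 (eta0 t) (lam0 t).
Hypothesis moving : \forall t \near U,
  moving_step retr f c P (st t) (eta0 t) (lam0 t) (D t) (st' t).

Local Notation x t := (st_x (st t)).
Local Notation eta t := (sd_eta f c P (st t) (D t)).
Local Notation lam t := (sd_lam f c P (st t) (D t)).
Local Notation th t := (sd_theta f c P (st t) (D t)).
Local Notation pred t :=
  (- metric (st_x (st t)) (gradF f c (st t)) (sd_eta1 (D t))).

Lemma min0_norm (y : R) : `|Num.min y 0| <= `|y|.
Proof.
rewrite /Num.min; case: ifPn => [//|_]; first by rewrite normr0.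
Qed.

Lemma first_multipliers_bounded : exists2 B : R, 0 <= B &
  \forall t \near U, forall i, `|lam0 t 0 i| <= B.
Proof.
have vw : \forall t \near U, forall i, (0 : 'rV[R]_(m + l)) 0 i
    = alpha c (st t) i * 0 /\ `|0 : R| <= 0.
  by apply: filterE => t i; rewrite mxE mulr0 normr0.
have [B HB] := LS_bounded (w := fun _ _ => 0) fC cC st_valid a1_gt0 a2_gt0
  H_bounds x_cvg licq rhoE LS0 vw (lexx 0).
exists (Num.max 0 B); first by rewrite le_max lexx.
by apply: filterS HB => t [_ lB] i; rewrite le_max lB orbT.
Qed.

(** The right-hand sides of the second and third systems are bounded in terms of
    the solutions already bounded, one system after the other. *)
Lemma directions_bounded : exists2 B : R, 0 < B &
  \forall t \near U, [/\ tnorm (x t) (sd_eta1 (D t)) + tnorm (x t) (sd_eta2 (D t)) <= B,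
    tnorm (x t) (eta t) <= B & forall i, `|lam t 0 i| <= B].
Proof.
have [B0 B00 lam0B] := first_multipliers_bounded.
have min3 (y : R) : `|y| <= B0 -> `|Num.min y 0 ^+ 3| <= B0 ^+ 3.
  move=> yB; rewrite normrX lerXn2r ?nnegrE//.
  exact: le_trans (min0_norm y) yB.
have LS1 : \forall t \near U, LS f c (st t) (v1 c (st t) (lam0 t))
    (sd_eta1 (D t)) (sd_lam1 (D t)) by apply: filterS moving => t [].
have vw1 : \forall t \near U, forall i, v1 c (st t) (lam0 t) 0 i
    = alpha c (st t) i * (Num.min (lam0 t 0 i) 0 ^+ 3)
    /\ `|Num.min (lam0 t 0 i) 0 ^+ 3| <= B0 ^+ 3.
  by apply: filterS lam0B => t lB i; rewrite mxE; split => //; exact: min3.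
have [B1 HB1] := LS_bounded (w := fun t i => Num.min (lam0 t 0 i) 0 ^+ 3)
  fC cC st_valid a1_gt0 a2_gt0 H_bounds x_cvg licq rhoE LS1 vw1 (exprn_ge0 3 B00).
have LS2 : \forall t \near U, LS f c (st t) (v2 c P (st t) (lam0 t) (sd_eta1 (D t)))
    (sd_eta2 (D t)) (sd_lam2 (D t)) by apply: filterS moving => t [].
have vw2 : \forall t \near U, forall i,
    v2 c P (st t) (lam0 t) (sd_eta1 (D t)) 0 i
    = alpha c (st t) i * (Num.min (lam0 t 0 i) 0 ^+ 3
        - tnorm (x t) (sd_eta1 (D t)) `^ nu P)
    /\ `|Num.min (lam0 t 0 i) 0 ^+ 3 - tnorm (x t) (sd_eta1 (D t)) `^ nu P|
       <= B0 ^+ 3 + B1 `^ nu P.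
  near=> t => i; rewrite !mxE mulrBr; split => //.
  apply: le_trans (ler_normB _ _) _; apply: lerD.
    apply: min3; move: i; near: t; exact: lam0B.
  rewrite ger0_norm ?powR_ge0//.
  have [e1B _] : tnorm (x t) (sd_eta1 (D t)) <= B1 /\
    forall i, `|sd_lam1 (D t) 0 i| <= B1 by near: t.
  apply: ge0_ler_powR => //; rewrite ?nnegrE ?tnorm_ge0//.
    by apply: ltW; apply: lt_trans (nuP P).
  exact: le_trans (tnorm_ge0 _ _) e1B.
have [B2 HB2] := LS_bounded
  (w := fun t i => Num.min (lam0 t 0 i) 0 ^+ 3 - tnorm (x t) (sd_eta1 (D t)) `^ nu P)
  fC cC st_valid a1_gt0 a2_gt0 H_bounds x_cvg licq rhoE LS2 vw2
  (addr_ge0 (exprn_ge0 3 B00) (powR_ge0 B1 (nu P))).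
exists (`|B1| + `|B2| + 1); first by rewrite ltr_wpDl ?addr_ge0.
near=> t.
have [e1B l1B] : tnorm (x t) (sd_eta1 (D t)) <= B1 /\
    forall i, `|sd_lam1 (D t) 0 i| <= B1 by near: t.
have [e2B l2B] : tnorm (x t) (sd_eta2 (D t)) <= B2 /\
    forall i, `|sd_lam2 (D t) 0 i| <= B2 by near: t.
have LS0t : LS f c (st t) 0 (eta0 t) (lam0 t) by near: t.
have LS1t : LS f c (st t) (v1 c (st t) (lam0 t)) (sd_eta1 (D t)) (sd_lam1 (D t)).
  by near: t.
have /andP[th0 th1] : 0 <= th t <= 1 := theta_bounds (st_valid t) LS0t LS1t _.
have B1le := ler_norm B1; have B2le := ler_norm B2.
have B1p := normr_ge0 B1; have B2p := normr_ge0 B2.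
split.
- lra.
- apply: le_trans (tnormD _ _ _) _; rewrite !tnormZ.
  rewrite (ger0_norm th0) (ger0_norm (_ : 0 <= 1 - th t)) ?subr_ge0//.
  have n1 := tnorm_ge0 (x t) (sd_eta1 (D t)); have n2 := tnorm_ge0 (x t) (sd_eta2 (D t)).
  nra.
- move=> i; rewrite !mxE; apply: le_trans (ler_normD _ _) _; rewrite !normrM.
  rewrite (ger0_norm th0) (ger0_norm (_ : 0 <= 1 - th t)) ?subr_ge0//.
  have := l1B i; have := l2B i.
  have := normr_ge0 (sd_lam1 (D t) 0 i); have := normr_ge0 (sd_lam2 (D t) 0 i).
  nra.
Unshelve. all: by end_near. Qed.

Lemma common_radius (I : finType) (d : I -> R) : (forall i, 0 < d i) ->
  exists2 r : R, 0 < r & forall i, r <= d i.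
Proof.
move=> d0; have s0 : 0 < 1 + \sum_i (d i)^-1.
  by rewrite ltr_pwDl// sumr_ge0// => i _; rewrite invr_ge0 ltW.
exists (1 + \sum_i (d i)^-1)^-1; first by rewrite invr_gt0.
move=> i; rewrite -[leRHS]invrK lef_pV2 ?posrE ?invr_gt0//.
rewrite (bigD1 i)//= addrCA lerDl addr_ge0// sumr_ge0// => j _.
by rewrite invr_ge0 ltW.
Qed.

Context (u eps : R).
Hypotheses (u_gt0 : 0 < u) (eps_gt0 : 0 < eps).
Hypothesis mu_ge : \forall t \near U, forall i, u <= st_mu (st t) 0 i.
Hypothesis pred_ge : \forall t \near U, eps <= pred t.

Lemma moving_slope t i : LS f c (st t) (v1 c (st t) (lam0 t)) (sd_eta1 (D t)) (sd_lam1 (D t)) ->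
  LS f c (st t) (v2 c P (st t) (lam0 t) (sd_eta1 (D t))) (sd_eta2 (D t)) (sd_lam2 (D t)) ->
  metric (x t) (grad (c i) (x t)) (eta t)
  = Num.min (lam0 t 0 i) 0 ^+ 3 - th t * tnorm (x t) (sd_eta1 (D t)) `^ nu P
    + Num.sqrt 2 * beta c (st t) i / alpha c (st t) i * lam t 0 i.
Proof.
move=> LS1 LS2; rewrite metricDr !metricZr.
rewrite (LS_slope (st_valid t) i LS1) (LS_slope (st_valid t) i LS2) !mxE.
by field; rewrite gt_eqF// (valid_alpha_gt0 (st_valid t)).
Qed.

(** The term in [nu] of the third system pushes away from the constraints. Since
    the smoothing parameters stay away from zero, [beta] tends to zero at the active
    ones, so that the multipliers cannot compensate for this push. *)
Lemma active_slope : exists2 q : R, 0 < q & \forall t \near U, forall i,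
  c i x0 = 0 -> metric (x t) (grad (c i) (x t)) (eta t) <= - q.
Proof.
have [B B0 HB] := directions_bounded.
have [G G0 HG] := gradF_bounded fC cC x_cvg rhoE.
have /andP[tau0 tau1] := tauP P.
pose th0 := Num.min 1 ((1 - tau P) * eps / (G * B)).
have th00 : 0 < th0.
  by rewrite lt_min ltr01 divr_gt0// mulr_gt0// subr_gt0.
pose p0 := (eps / G) `^ nu P.
have p00 : 0 < p0 by rewrite powR_gt0// divr_gt0.
pose q := th0 * p0 / 2.
have q0 : 0 < q by rewrite divr_gt0// mulr_gt0.
exists q => //; apply: filter_forall => i.
have [ci0|/eqP ci0] := eqVneq (c i x0) 0; last by apply: filterE.
(* the first bound makes [alpha] at least 1 / 2, the second one makes the term in
   [beta] at most half of the push th0 * p0 *)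
pose r := Num.min (1 / 2) (q / (4 * B)) * u.
have r0 : 0 < r by rewrite mulr_gt0// lt_min !divr_gt0// mulr_gt0.
have c_small : \forall t \near U, - r < c i (x t).
  apply: (cvgr_gt _ (@c_cvg _ _ _ _ _ _ cC _ _ _ _ _ x_cvg i)).
  by rewrite ci0 oppr_lt0.
near=> t => _.
have mt : moving_step retr f c P (st t) (eta0 t) (lam0 t) (D t) (st' t) by near: t.
have LS0t : LS f c (st t) 0 (eta0 t) (lam0 t) by near: t.
have [LS1t LS2t _ _ _] := mt.
have [e12B eB lB] : [/\ tnorm (x t) (sd_eta1 (D t)) + tnorm (x t) (sd_eta2 (D t)) <= B,
    tnorm (x t) (eta t) <= B & forall i, `|lam t 0 i| <= B] by near: t.
have Gt : tnorm (x t) (gradF f c (st t)) <= G by near: t.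
have et : eps <= pred t by near: t.
have ut : u <= st_mu (st t) 0 i.
  by have : forall i, u <= st_mu (st t) 0 i by near: t.
have cr : - r < c i (x t) by near: t.
have [cneg mupos _ _] := st_valid t; have /andP[mu0 _] := mupos i.
have ct := cneg i.
have th_ge : th0 <= th t.
  apply: (theta_lower (st_valid t) LS0t LS1t) => //.
  apply: le_trans (metric_cauchy_schwarz _ _ _) _.
  apply: ler_pM; rewrite ?tnorm_ge0//.
  by apply: le_trans (tnormD _ _ _) _; rewrite tnormN.
have e1_ge : eps / G <= tnorm (x t) (sd_eta1 (D t)).
  rewrite ler_pdivrMr//; apply: le_trans et _.
  apply: le_trans (ler_norm _) _; rewrite normrN.
  apply: le_trans (metric_cauchy_schwarz _ _ _) _.
  by rewrite mulrC ler_wpM2l ?tnorm_ge0.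
have p_ge : p0 <= tnorm (x t) (sd_eta1 (D t)) `^ nu P.
  apply: ge0_ler_powR => //; rewrite ?nnegrE ?tnorm_ge0 ?divr_ge0 ?(ltW eps_gt0) ?(ltW G0)//.
  by apply: ltW; apply: lt_trans (nuP P).
rewrite (moving_slope i LS1t LS2t).
have m3 : Num.min (lam0 t 0 i) 0 ^+ 3 <= 0.
  have mle : Num.min (lam0 t 0 i) 0 <= 0 by rewrite ge_min lexx orbT.
  by rewrite exprS mulr_le0_ge0 ?sqr_ge0.
have cu : - c i (x t) / u <= Num.min (1 / 2) (q / (4 * B)).
  rewrite ler_pdivrMr// -/r; lra.
have cu1 : - c i (x t) / u <= 1 / 2 by apply: le_trans cu _; rewrite ge_min lexx.
have cu2 : - c i (x t) / u <= q / (4 * B).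
  by apply: le_trans cu _; rewrite ge_min lexx orbT.
have al := alpha_lower ct mu0 u_gt0 ut.
have be := beta_upper ct mu0 u_gt0 ut.
have al2 : 1 / 2 <= alpha c (st t) i.
  by apply: le_trans al; rewrite -[_ / u]opprK -mulNr; lra.
have be0 := ltW (beta_gt0 ct mu0).
have k_le : Num.sqrt 2 * beta c (st t) i / alpha c (st t) i * lam t 0 i <= q.
  apply: le_trans (ler_norm _) _; rewrite normrM.
  rewrite ger0_norm; last exact: (coef_ge0 (st_valid t)).
  have s2 : Num.sqrt (2 : R) <= 2.
    rewrite -(@ler_pXn2r _ 2) ?nnegrE ?sqrtr_ge0// sqr_sqrtr//.
    by rewrite expr2 ler_peMl// ler1n.
  have al0 : 0 < alpha c (st t) i by exact: lt_le_trans al2.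
  have k4 : Num.sqrt 2 * beta c (st t) i / alpha c (st t) i <= q / B.
    rewrite ler_pdivrMr//; apply: (@le_trans _ _ (2 * (q / (4 * B)))).
      by apply: ler_pM; rewrite ?sqrtr_ge0//; exact: le_trans cu2.
    rewrite (_ : 2 * _ = q / B * (1 / 2)); last by field; rewrite gt_eqF.
    by rewrite ler_wpM2l// divr_ge0// ltW.
  apply: (@le_trans _ _ (q / B * B)); last by rewrite divfK// gt_eqF.
  by apply: ler_pM => //; exact: (coef_ge0 (st_valid t)).
have thp : th0 * p0 <= th t * tnorm (x t) (sd_eta1 (D t)) `^ nu P.
  by apply: ler_pM => //; exact: ltW.
have : q + q = th0 * p0 by rewrite /q; field.
lra.
Unshelve. all: by end_near. Qed.

(** Along the arc, an active constraint decreases at first order, uniformly; an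
    inactive one has room to vary. *)
Lemma arc_feasible i : exists2 d : R, 0 < d & \forall t \near U,
  forall s, 0 < s <= d -> c i (Defs.arc retr (st t) (eta t) (sd_teta (D t)) s) < 0.
Proof.
have [B B0 HB] := directions_bounded.
have expand e : 0 < e -> exists2 d : R, 0 < d & \forall t \near U,
    forall s, 0 < s <= d -> c i (Defs.arc retr (st t) (eta t) (sd_teta (D t)) s)
      <= c i (x t) + s * metric (x t) (grad (c i) (x t)) (eta t) + e * s.
  move=> e0; have [d d0 Hd] := arc_expansion retrP x0 (cC i) (ltW B0) e0.
  exists d => //; have Hd' := x_cvg Hd.
  near=> t => s /andP[s0 sd].
  have [_ eB _] : [/\ tnorm (x t) (sd_eta1 (D t)) + tnorm (x t) (sd_eta2 (D t)) <= B,
    tnorm (x t) (eta t) <= B & forall i, `|lam t 0 i| <= B] by near: t.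
  have [_ _ te _ _] : moving_step retr f c P (st t) (eta0 t) (lam0 t) (D t) (st' t).
    by near: t.
  have : forall v w r, tnorm (x t) v <= B -> tnorm (x t) w <= B -> 0 <= r <= d ->
      `|c i (retr (x t) (r *: v + r ^+ 2 *: w))
         - (c i (x t) + r * metric (x t) (grad (c i) (x t)) v)| <= e * r by near: t.
  move=> /(_ (eta t) (sd_teta (D t)) s eB (le_trans te eB)).
  rewrite (ltW s0) sd => /(_ isT); rewrite ler_norml => /andP[_].
  rewrite /Defs.arc; lra.
have [ci0|ci0] := eqVneq (c i x0) 0.
  have [q q0 Hq] := active_slope.
  have [d d0 Hd] := expand q q0; exists d => //; near=> t => s sd.
  have [cneg _ _ _] := st_valid t; have ct := cneg i.
  have sl : metric (x t) (grad (c i) (x t)) (eta t) <= - q.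
    have : forall i, c i x0 = 0 -> metric (x t) (grad (c i) (x t)) (eta t) <= - q by near: t.
    exact.
  have : forall s, 0 < s <= d -> c i (Defs.arc retr (st t) (eta t) (sd_teta (D t)) s)
      <= c i (x t) + s * metric (x t) (grad (c i) (x t)) (eta t) + q * s by near: t.
  move=> /(_ s sd) h; apply: le_lt_trans h _; have /andP[s0 _] := sd.
  by have := ler_wpM2l (ltW s0) sl; lra.
have ci : c i x0 < 0.
  rewrite lt_neqAle ci0 /=; apply: (limit_feasible cC st_valid x_cvg).
have [A A0 HA] := grad_bounded x_cvg (cC i).
have [d d0 Hd] := expand 1 ltr01.
pose K := A * B + 1; have K0 : 0 < K by rewrite addr_gt0// mulr_gt0.
exists (Num.min d (- c i x0 / (4 * K))).
  by rewrite lt_min d0 divr_gt0 ?oppr_gt0// mulr_gt0.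
have c_half : \forall t \near U, c i (x t) <= c i x0 / 2.
  apply: (cvgr_le _ (@c_cvg _ _ _ _ _ _ cC _ _ _ _ _ x_cvg i)).
  by rewrite ltr_pdivlMr//; lra.
near=> t => s; rewrite le_min => /and3P[s0 sd sK].
have [_ eB _] : [/\ tnorm (x t) (sd_eta1 (D t)) + tnorm (x t) (sd_eta2 (D t)) <= B,
  tnorm (x t) (eta t) <= B & forall i, `|lam t 0 i| <= B] by near: t.
have At : tnorm (x t) (grad (c i) (x t)) <= A by near: t.
have ch : c i (x t) <= c i x0 / 2 by near: t.
have : forall s, 0 < s <= d -> c i (Defs.arc retr (st t) (eta t) (sd_teta (D t)) s)
    <= c i (x t) + s * metric (x t) (grad (c i) (x t)) (eta t) + 1 * s by near: t.
move=> /(_ s); rewrite s0 sd => /(_ isT) h; apply: le_lt_trans h _.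
have sl : metric (x t) (grad (c i) (x t)) (eta t) <= A * B.
  apply: le_trans (metric_le _ _ _) _; apply: ler_pM; rewrite ?tnorm_ge0//.
have := ler_wpM2l (ltW s0) sl.
rewrite ler_pdivlMr ?mulr_gt0// in sK.
have : s * (4 * K) = 4 * (s * (A * B)) + 4 * s by rewrite /K; ring.
lra.
Unshelve. all: by end_near. Qed.

(** Armijo's condition asks for a fraction [sigma] < 1 of the first-order decrease,
    which leaves room for the error term of the expansion. *)
Lemma arc_decrease : exists2 d : R, 0 < d & \forall t \near U,
  forall s, 0 < s <= d ->
    penalized f c (st_rho (st t)) (Defs.arc retr (st t) (eta t) (sd_teta (D t)) s)
    <= penalized f c (st_rho (st t)) (x t)
       + sigma P * s * metric (x t) (gradF f c (st t)) (eta t).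
Proof.
have [B B0 HB] := directions_bounded.
have /andP[sig0 sig2] := sigmaP P; have /andP[tau0 tau1] := tauP P.
have sig1 : sigma P < 1 by lra.
pose e := (1 - sigma P) * (tau P * eps).
have e0 : 0 < e by rewrite !mulr_gt0// subr_gt0.
have pC := penalized_C1 rho fC cC.
have [d d0 Hd] := arc_expansion retrP x0 pC (ltW B0) e0.
exists d => //; have Hd' := x_cvg Hd.
near=> t => s /andP[s0 sd].
have rt : st_rho (st t) = rho by near: t.
have mt : moving_step retr f c P (st t) (eta0 t) (lam0 t) (D t) (st' t) by near: t.
have LS0t : LS f c (st t) 0 (eta0 t) (lam0 t) by near: t.
have et : eps <= pred t by near: t.
have [_ eB _] : [/\ tnorm (x t) (sd_eta1 (D t)) + tnorm (x t) (sd_eta2 (D t)) <= B,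
  tnorm (x t) (eta t) <= B & forall i, `|lam t 0 i| <= B] by near: t.
have [LS1t _ te _ _] := mt.
have : forall v w r, tnorm (x t) v <= B -> tnorm (x t) w <= B -> 0 <= r <= d ->
    `|penalized f c rho (retr (x t) (r *: v + r ^+ 2 *: w))
       - (penalized f c rho (x t) + r * metric (x t) (grad (penalized f c rho) (x t)) v)|
    <= e * r by near: t.
move=> /(_ (eta t) (sd_teta (D t)) s eB (le_trans te eB)).
rewrite (ltW s0) sd => /(_ isT); rewrite ler_norml => /andP[_].
have := theta_descent (st_valid t) LS0t LS1t (sd_eta2 (D t)).
rewrite -/(sd_theta f c P (st t) (D t)) -/(sd_eta f c P (st t) (D t)).
rewrite /gradF rt in et *; rewrite /Defs.arc.
set g := metric (x t) (grad _ (x t)) (eta t).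
set g1 := metric (x t) (grad _ (x t)) (sd_eta1 (D t)) in et *.
move=> gg1 h.
have g_le : g <= - (tau P * eps).
  by apply: le_trans gg1 _; rewrite -mulrN ler_wpM2l ?(ltW tau0)// lerNr.
have : e * s <= (1 - sigma P) * (- g) * s.
  apply: ler_wpM2r; first exact: ltW.
  by rewrite /e ler_wpM2l ?subr_ge0 ?(ltW sig1)// lerNr.
have : (1 - sigma P) * - g * s = sigma P * s * g - s * g by ring.
lra.
Unshelve. all: by end_near. Qed.

(** Backtracking accepts every small enough step, so the accepted ones are
    bounded below. *)
Lemma step_bounded_below : exists2 t0 : R, 0 < t0 & \forall t \near U, t0 <= sd_t (D t).
Proof.
have /choice[d dP] : forall i, exists d : R, 0 < d /\ \forall t \near U,
    forall s, 0 < s <= d -> c i (Defs.arc retr (st t) (eta t) (sd_teta (D t)) s) < 0.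
  by move=> i; have [d d0 Hd] := arc_feasible i; exists d.
have [r r0 rd] := common_radius (fun i => (dP i).1).
have [d' d'0 Hd'] := arc_decrease.
pose del := Num.min r d'.
have del0 : 0 < del by rewrite lt_min r0.
have /andP[vs0 vs1] := varsigmaP P.
exists (Num.min 1 (varsigma P * del)); first by rewrite lt_min ltr01 mulr_gt0.
near=> t.
have acc : forall s, 0 < s <= del ->
    arc_accept retr f c P (st t) (eta t) (sd_teta (D t)) s.
  move=> s /andP[s0]; rewrite le_min => /andP[sr sd']; split.
    have : forall s, 0 < s <= d' ->
      penalized f c (st_rho (st t)) (Defs.arc retr (st t) (eta t) (sd_teta (D t)) s)
      <= penalized f c (st_rho (st t)) (x t)
         + sigma P * s * metric (x t) (gradF f c (st t)) (eta t) by near: t.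
    by apply; rewrite s0.
  move=> i; have : forall i s, 0 < s <= d i ->
      c i (Defs.arc retr (st t) (eta t) (sd_teta (D t)) s) < 0.
    near: t; apply: filter_forall => j; exact: (dP j).2.
  by apply; rewrite s0 (le_trans sr).
have [_ _ _ [j [-> _ nacc]] _] :
  moving_step retr f c P (st t) (eta0 t) (lam0 t) (D t) (st' t) by near: t.
case: j nacc => [|j] nacc; first by rewrite expr0 ge_min lexx.
have := nacc j (ltnSn j); have [jd|dj] := leP (varsigma P ^+ j) del.
  by move=> []; apply: acc; rewrite exprn_gt0.
move=> _; rewrite ge_min; apply/orP; right.
by rewrite exprS ler_wpM2l ?(ltW vs0)// ltW.
Unshelve. all: by end_near. Qed.

End StepLength.

(** * Ultrafilters and subsequences *)

Section Subsequences.

Lemma unbounded_infinite (A : set nat) :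
  (forall N, exists2 k, (N <= k)%N & A k) -> infinite_set A.
Proof.
move=> often /finite_seqP[q qE]; have [k qk] := often (\max_(i <- q) i).+1.
by rewrite qE /= => /(@leq_bigmax_seq _ q xpredT id)/(_ isT) /=; rewrite leqNgt qk.
Qed.

Lemma within_infinite_proper (K : set nat) : infinite_set K ->
  ProperFilter (within K \oo).
Proof.
move=> Kinf; split; last exact: within_filter.
move=> [N _ HN]; apply: Kinf; apply: (@sub_finite_set _ _ `I_N); last exact: finite_II.
move=> k Kk /=; rewrite ltnNge; apply/negP => Nk; exact: (HN k Nk Kk).
Qed.

Lemma ultra_along (K : set nat) : infinite_set K ->
  exists2 U : set_system nat, UltraFilter U & within K \oo `<=` U.
Proof.
move=> /within_infinite_proper PK.
by have [U [UU KU]] := ultraFilterLemma PK; exists U.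
Qed.

Lemma ultra_often (U : set_system nat) (UU : UltraFilter U) (K A : set nat) N :
  within K \oo `<=` U -> U A -> exists k, [/\ K k, (N <= k)%N & A k].
Proof.
move=> KU UA; have UN : U [set k | (N <= k)%N].
  by apply: KU; exists N => // k Nk _.
have UK : U K by apply: KU; exists 0%N => // k _.
by have [k [[Ak Nk] Kk]] := filter_ex (filterI (filterI UA UN) UK); exists k.
Qed.

(** Infinitely many indices of [K] approach the limit to any precision; choose
    them increasing, with precision 1/(j+1) at the j-th choice. *)
Lemma ultra_subsequence (R : realType) (X : pseudoMetricType R)
    (U : set_system nat) (UU : UltraFilter U) (K : set nat) (a : nat -> X) (L : X) :
  within K \oo `<=` U -> a k @[k --> U] --> L ->
  exists K' : set nat,
    [/\ infinite_set K', K' `<=` K & a k @[k --> within K' \oo] --> L].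
Proof.
move=> KU aL.
have next (p : nat * nat) : exists k,
    [/\ K k, (p.1 < k)%N & ball L (p.2.+1%:R^-1 : R) (a k)].
  have near_L : U [set k | ball L (p.2.+1%:R^-1 : R) (a k)].
    by apply: (cvg_ball aL); rewrite invr_gt0 ltr0n.
  by have [k [Kk pk ak]] := ultra_often UU p.1.+1 KU near_L; exists k.
have [g Hg] := choice next.
pose phi := fix phi j := if j is j'.+1 then g (phi j', j) else g (0%N, 0%N).
have phi_in j : K (phi j) by case: j => [|j]; [have [] := Hg (0, 0)%N|have [] := Hg (phi j, j.+1)].
have phi_ball j : ball L (j.+1%:R^-1 : R) (a (phi j)).
  by case: j => [|j]; [have [] := Hg (0, 0)%N|have [] := Hg (phi j, j.+1)].
have phi_lt j : (phi j < phi j.+1)%N by have [] := Hg (phi j, j.+1).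
have phi_mono i j : (i <= j)%N -> (phi i <= phi j)%N.
  move=> /subnK <-; elim: (j - i)%N => [//|d ih].
  by rewrite addSn; apply: leq_trans ih (ltnW (phi_lt _)).
have phi_ge j : (j <= phi j)%N.
  by elim: j => [//|j ih]; exact: leq_ltn_trans ih (phi_lt j).
exists (range phi); split.
- apply: unbounded_infinite => N; exists (phi N); first exact: phi_ge.
  by exists N.
- by move=> _ [j _ <-].
- apply/cvg_ballP => e e0; have [j0 j0e] : exists j, (j.+1%:R^-1 : R) < e.
    exists (Num.truncn e^-1); rewrite invf_plt ?posrE ?ltr0n//; exact: truncnS_gt.
  exists (phi j0) => // k /= jk [j _ jE]; rewrite -jE.
  have jj : (j0 <= j)%N.
    rewrite leqNgt; apply/negP => jlt; have := phi_mono _ _ jlt.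
    by rewrite leqNgt (leq_ltn_trans _ (phi_lt j)) // jE.
  apply: le_ball (phi_ball j); apply: le_trans (ltW j0e).
  by rewrite lef_pV2 ?posrE ?ltr0n// ler_nat.
Qed.

End Subsequences.

(** * Convergence *)

Section Convergence.
Context {R : realType} {n m l : nat} {M : riemannianManifold R n}.
Context (retr : M -> 'rV[R]_n -> M) (f : M -> R) (c : 'I_(m + l) -> M -> R).
Context (P : rqo_params R m l) (s : nat -> rqo_state (m + l) M).
Context (eta0 : nat -> 'rV[R]_n) (lam0 : nat -> 'rV[R]_(m + l)).
Hypotheses (complete_M : @complete_manifold R n M) (retrP : retraction retr).
Hypotheses (l_gt0 : (0 < l)%N) (fC : C1_mfd f) (cC : forall i, C1_mfd (c i)).
Hypothesis run : rqo_free retr f c P s eta0 lam0.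
Hypothesis licq : forall x, feasible c x -> LICQ c x.
Hypothesis x_bounded : bounded_seq (fun k => st_x (s k)).
Context (a1 a2 : R).
Hypotheses (a1_gt0 : 0 < a1) (a2_gt0 : 0 < a2).
Hypothesis H_bounds : forall k xi,
  a1 * tnorm (st_x (s k)) xi ^+ 2
    <= metric (st_x (s k)) (st_H (s k) xi) xi
    <= a2 * tnorm (st_x (s k)) xi ^+ 2.
Hypothesis no_dual : forall x, feasible c x -> ~ feasible_P c x ->
  no_dual_combination c x.

Local Notation test k := (penalty_test P (s k) (eta0 k) (lam0 k)).

Let s_valid k : valid_state c P (s k) := run_valid l_gt0 run k.

Let LS0 k : LS f c (s k) 0 (eta0 k) (lam0 k).
Proof. by have [] := run_step run k. Qed.

(** Infinitely many updates would make the penalty parameter diverge along the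
    updating iterations, at a limit of which the test would have to fail. *)
Lemma penalty_updates_finite : exists kbar, forall k, (kbar <= k)%N -> ~~ test k.
Proof.
apply: contrapT => nfin.
have often k : exists2 j, (k <= j)%N & test j.
  apply: contrapT => nj; apply: nfin; exists k => j kj; apply/negP => tj.
  by apply: nj; exists j.
have Kinf : infinite_set [set k | test k] := unbounded_infinite often.
have [U UU KU] := ultra_along Kinf.
have [p [B xB]] := x_bounded.
have [x0 x_cvg] := bounded_ultra_cvg complete_M xB.
have feas : feasible c x0 by exact: (limit_feasible cC s_valid x_cvg).
have testU : \forall k \near U, test k by apply: KU; exists 0%N => // k _.
have LS0U : \forall k \near U, LS f c (s k) 0 (eta0 k) (lam0 k).
  by apply: filterE => k; exact: LS0.
have ndiv : ~ diverges (U := U) (fun k => st_rho (s k)).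
  exact: (penalty_bounded fC cC s_valid a1_gt0 a2_gt0 H_bounds x_cvg (licq feas)
    (no_dual feas) LS0U testU).
apply: ndiv => b.
have [N bN] := run_rho_unbounded l_gt0 run often b.
apply: KU; exists N => // k Nk _; exact: lt_le_trans bN (run_rho_ge l_gt0 run Nk).
Qed.

Section ConstantPenalty.
Context (kbar : nat).
Hypothesis ntest : forall k, (kbar <= k)%N -> ~~ test k.

Local Notation rhobar := (st_rho (s kbar)).

Lemma rho_constant k : (kbar <= k)%N -> st_rho (s k) = rhobar.
Proof.
move=> /subnK <-; elim: (k - kbar)%N => [//|i ih].
by rewrite addSn (run_rho run) (negbTE (ntest (leq_addl _ _))).
Qed.

Context (D : nat -> step_data (R := R) (n := n) (m := m) (l := l)).
Hypothesis moving : forall k, (kbar <= k)%N ->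
  moving_step retr f c P (s k) (eta0 k) (lam0 k) (D k) (s k.+1).

Local Notation F k := (penalized f c rhobar (st_x (s k))).
Local Notation pred k :=
  (- metric (st_x (s k)) (gradF f c (s k)) (sd_eta1 (D k))).

Lemma pred_ge0 k : (kbar <= k)%N -> 0 <= pred k.
Proof.
by move=> kk; have [LS1 _ _ _ _] := moving kk; exact: predicted_ge0 (LS0 k) LS1.
Qed.

Lemma value_decrease k : (kbar <= k)%N ->
  0 < sd_t (D k) /\ F k.+1 <= F k - sigma P * sd_t (D k) * (tau P * pred k).
Proof.
move=> kk; have [t0 slope dec] := moving_decrease (s_valid k) (LS0 k) (moving kk).
split=> //; rewrite (rho_constant kk) in dec; apply: le_trans dec _.
have /andP[s0 _] := sigmaP P.
rewrite lerD2l -mulrN; apply: ler_wpM2l; first by rewrite mulr_ge0 ?(ltW s0) ?(ltW t0).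
by rewrite mulrN opprK.
Qed.

Lemma value_noninc j k : (kbar <= j)%N -> (j <= k)%N -> F k <= F j.
Proof.
move=> kj /subnK <-; elim: (k - j)%N => [//|i ih].
have kij : (kbar <= i + j)%N by apply: leq_trans kj (leq_addl _ _).
have [t0 dec] := value_decrease kij; apply: le_trans ih.
apply: le_trans dec _; rewrite gerBl !mulr_ge0 ?(ltW t0) ?pred_ge0//.
  by have /andP[/ltW] := sigmaP P.
by have /andP[/ltW] := tauP P.
Qed.

Section AlongUltrafilter.
Context {U : set_system nat} {UU : UltraFilter U}.
Hypothesis U_free : \oo `<=` U.
Context (xs : M).
Hypothesis x_cvg : st_x (s k) @[k --> U] --> xs.

Let U_large N : \forall k \near U, (N <= k)%N.
Proof. by apply: U_free; exists N. Qed.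

(** Decreases bounded below along the ultrafilter would be subtracted infinitely
    often from the convergent values of the penalized objective. *)
Lemma no_persistent_decrease (q : R) : 0 < q ->
  ~ (\forall k \near U, F k.+1 <= F k - q).
Proof.
move=> q0 dec; have FU : F k @[k --> U] --> penalized f c rhobar xs.
  exact: (C1_cvg (penalized_C1 rhobar fC cC) x_cvg).
have Fle j : (kbar <= j)%N -> penalized f c rhobar xs <= F j.
  move=> kj; apply: (cvgr_to_le FU); near=> k; apply: value_noninc => //.
  by near: k.
have near_F : \forall k \near U, F k < penalized f c rhobar xs + q.
  by apply: (cvgr_lt _ FU); rewrite ltrDl.
have [k [[d Fk] kk]] := filter_ex (filterI (filterI dec near_F) (U_large kbar)).
have := Fle k.+1 (leqW kk); rewrite leNgt => /negP; apply.
by apply: le_lt_trans d _; rewrite ltrBlDr.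
Unshelve. all: by end_near. Qed.

(** Parameters [mu] and predictions that stay away from zero would force step
    lengths away from zero, hence a persistent decrease. *)
Lemma small_parameter (eps : R) : 0 < eps -> (\forall k \near U, eps <= pred k) ->
  forall u, 0 < u -> \forall k \near U, exists i, st_mu (s k) 0 i < u.
Proof.
move=> e0 pe u u0.
apply: contrapT => /ultra_notP muU.
have mu_ge : \forall k \near U, forall i, u <= st_mu (s k) 0 i.
  apply: filterS muU => k nmu i; rewrite leNgt; apply/negP => h.
  by apply: nmu; exists i.
have feas : feasible c xs by exact: (limit_feasible cC s_valid x_cvg).
have rhoE : \forall k \near U, st_rho (s k) = rhobar.
  by apply: filterS (U_large kbar) => k; exact: rho_constant.
have LS0U : \forall k \near U, LS f c (s k) 0 (eta0 k) (lam0 k).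
  by apply: filterE => k; exact: LS0.
have movU : \forall k \near U,
    moving_step retr f c P (s k) (eta0 k) (lam0 k) (D k) (s k.+1).
  by apply: filterS (U_large kbar) => k; exact: moving.
have [t0 t00 t0U] := step_bounded_below retrP fC cC s_valid a1_gt0 a2_gt0 H_bounds
  x_cvg rhoE (licq feas) LS0U movU u0 e0 mu_ge pe.
have /andP[s0 _] := sigmaP P; have /andP[ta0 _] := tauP P.
apply: (@no_persistent_decrease (sigma P * t0 * (tau P * eps))).
  by rewrite !mulr_gt0.
near=> k; have kk : (kbar <= k)%N by near: k; exact: U_large.
have [tk dec] := value_decrease kk; apply: le_trans dec _.
have tle : t0 <= sd_t (D k) by near: k.
have ple : eps <= pred k by near: k.
rewrite lerD2l lerN2; apply: ler_pM; rewrite ?mulr_ge0 ?(ltW s0) ?(ltW t00) ?(ltW ta0) ?(ltW e0)//.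
  by rewrite ler_wpM2l ?(ltW s0).
by rewrite ler_wpM2l ?(ltW ta0).
Unshelve. all: by end_near. Qed.

(** A parameter [mu] that becomes small reveals that the previous direction was
    small; the previous iterates then have the same limit and their predictions
    vanish. *)
Lemma previous_stationary :
  (forall u, 0 < u -> \forall k \near U, exists i, st_mu (s k) 0 i < u) ->
  exists lss : 'rV[R]_(m + l), [/\ lam0 k.-1 @[k --> U] --> lss,
    KKT_Prho f c rhobar xs lss & exists lam, KKT_P f c xs lam].
Proof.
move=> small; pose st k := s k.-1.
have prevU : \forall k \near U, (kbar <= k.-1)%N /\ k.-1.+1 = k.
  by apply: filterS (U_large kbar.+1); case.
pose eta k := sd_eta f c P (st k) (D k.-1).
have etaU : tnorm (st_x (st k)) (eta k) @[k --> U] --> (0 : R).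
  apply/cvgrPdist_lt => e e0.
  have h : 0 < Num.min e (mu_bar P) by rewrite lt_min e0 mu_barP.
  apply: filterS2 prevU (small _ h) => k [kk kE] [i].
  have [_ _ _ _ [_ _ /(_ i) muE _]] := moving kk.
  rewrite kE in muE; rewrite muE lt_min !gt_min !gt_max ltxx orbF.
  rewrite /= sub0r normrN ger0_norm ?tnorm_ge0//.
  (* the maximum defining the parameter bounds the norm, the cap being inactive *)
  move=> /andP[/orP[/andP[_ //]|he] /andP[_ hb]]; exact: lt_trans hb he.
have [p [B xB]] := x_bounded.
have xB' k : (rdist p (st_x (st k)) <= B%:E)%E by exact: xB.
have [y y_cvg] := bounded_ultra_cvg (U := U) complete_M xB'.
have rhoE : \forall k \near U, st_rho (st k) = rhobar.
  by apply: filterS prevU => k [kk _]; exact: rho_constant.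
have LS0U : \forall k \near U, LS f c (st k) 0 (eta0 k.-1) (lam0 k.-1).
  by apply: filterE => k; exact: LS0.
have movU : \forall k \near U,
    moving_step retr f c P (st k) (eta0 k.-1) (lam0 k.-1) (D k.-1) (s k).
  by apply: filterS prevU => k [kk kE]; have := moving kk; rewrite kE.
have st_valid k : valid_state c P (st k) by exact: s_valid.
have st_bounds k xi : a1 * tnorm (st_x (st k)) xi ^+ 2
    <= metric (st_x (st k)) (st_H (st k) xi) xi
    <= a2 * tnorm (st_x (st k)) xi ^+ 2 by exact: H_bounds.
pose v k : 'rV[R]_n := sd_t (D k.-1) *: eta k
  + sd_t (D k.-1) ^+ 2 *: sd_teta (D k.-1).
have vU : tnorm (st_x (st k)) (v k) @[k --> U] --> (0 : R).
  have bnd : 2 * tnorm (st_x (st k)) (eta k) @[k --> U] --> (0 : R).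
    by rewrite -[0](mulr0 2); exact: cvgMl_tmp.
  apply: (squeeze0 bnd); apply: filterS movU => k [_ _ teta_le [j [tE _ _]] _].
  have /andP[vs0 vs1] := varsigmaP P.
  have t0 : 0 <= sd_t (D k.-1) by rewrite tE exprn_ge0 ?(ltW vs0).
  have t1 : sd_t (D k.-1) <= 1 by rewrite tE exprn_ile1 ?(ltW vs0) ?(ltW vs1).
  rewrite ger0_norm ?tnorm_ge0//; apply: le_trans (tnormD _ _ _) _.
  rewrite !tnormZ (ger0_norm t0) ger0_norm ?exprn_ge0//.
  rewrite mulr2n mulrDl !mul1r; apply: lerD; first by rewrite ler_piMl ?tnorm_ge0.
  apply: le_trans teta_le; by rewrite ler_piMl ?tnorm_ge0 ?exprn_ile1.
have next_cvg : retr (st_x (st k)) (v k) @[k --> U] --> y.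
  exact: (retr_cvg retrP y_cvg vU).
have yE : y = xs.
  have x_cvg' : st_x (s k) @[k --> U] --> y.
    apply: (cvg_trans _ next_cvg); apply: near_eq_cvg.
    by apply: filterS movU => k [_ _ _ _ [-> _ _ _]].
  exact: (@cvg_unique M (@mfd_hausdorff _ _ M) (st_x (s k) @[k --> U]) _ y xs x_cvg' x_cvg).
rewrite {}yE in y_cvg.
have feas : feasible c xs by exact: (limit_feasible cC s_valid x_cvg).
have [C C0 lamC] := first_multipliers_bounded fC cC st_valid a1_gt0 a2_gt0 st_bounds
  y_cvg rhoE (licq feas) LS0U.
have [lss lss_cvg] : exists lss : 'rV[R]_(m + l), lam0 k.-1 @[k --> U] --> lss.
  apply: (@ultra_bounded_rV_cvg _ _ _ UU _ _ C) => i.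
  by apply: filterS lamC => k.
have predU : pred k.-1 @[k --> U] --> (0 : R).
  have [G G0 GU] := gradF_bounded fC cC y_cvg rhoE.
  have /andP[ta0 _] := tauP P.
  have bnd : (G / tau P) * tnorm (st_x (st k)) (eta k) @[k --> U] --> (0 : R).
    by rewrite -[0](mulr0 (G / tau P)); exact: cvgMl_tmp.
  apply: (squeeze0 bnd); near=> k.
  have [kk kE] : (kbar <= k.-1)%N /\ k.-1.+1 = k by near: k.
  have Gk : tnorm (st_x (st k)) (gradF f c (st k)) <= G by near: k.
  have [_ slope _] := moving_decrease (s_valid k.-1) (LS0 k.-1) (moving kk).
  rewrite ger0_norm ?pred_ge0// mulrAC ler_pdivlMr// mulrC mulrN lerNl.
  apply: le_trans slope; rewrite lerNl.
  apply: le_trans (ler_norm _) _; rewrite normrN.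
  by apply: le_trans (metric_cauchy_schwarz _ _ _) _; rewrite ler_wpM2r ?tnorm_ge0.
have LS1U : \forall k \near U, LS f c (st k) (v1 c (st k) (lam0 k.-1))
    (sd_eta1 (D k.-1)) (sd_lam1 (D k.-1)) by apply: filterS movU => k [].
have ntestU : \forall k \near U, ~~ penalty_test P (st k) (eta0 k.-1) (lam0 k.-1).
  by apply: filterS prevU => k [kk _]; exact: ntest.
exists lss; have [] := stationary_limit fC cC st_valid a1_gt0 a2_gt0 st_bounds y_cvg
  rhoE LS0U LS1U ntestU lss_cvg predU.
by split.
Unshelve. all: by end_near. Qed.
End AlongUltrafilter.
End ConstantPenalty.
End Convergence.

Theorem theorem4p1 (R : realType) (n m l : nat) (M : riemannianManifold R n)
    (retr : M -> 'rV[R]_n -> M) (f : M -> R) (c : 'I_(m + l) -> M -> R)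
    (P : rqo_params R m l) (s : nat -> rqo_state (m + l) M)
    (eta0 : nat -> 'rV[R]_n) (lam0 : nat -> 'rV[R]_(m + l))
    (complete_M : @complete_manifold R n M)
    (retr_retraction : retraction retr)
    (l_gt0 : (0 < l)%N)
    (f_C2 : C2_mfd f)
    (c_C2 : forall i, C2_mfd (c i))
    (run : rqo_free retr f c P s eta0 lam0)
    (licq : forall x, feasible c x -> LICQ c x)
    (x_bounded : bounded_seq (fun k => st_x (s k)))
    (H_bounds : exists a1 a2 : R, [/\ 0 < a1, 0 < a2 &
      forall (k : nat) (xi : 'rV[R]_n),
        a1 * tnorm (st_x (s k)) xi ^+ 2
          <= metric (st_x (s k)) (st_H (s k) xi) xi
          <= a2 * tnorm (st_x (s k)) xi ^+ 2])
    (no_dual : forall x, feasible c x -> ~ feasible_P c x ->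
      no_dual_combination c x) :
  exists rhobar : R,
    [/\ 0 < rhobar,
        exists kbar : nat, forall k, (kbar <= k)%N -> st_rho (s k) = rhobar &
        forall (K : set nat) (xs : M) (ls : 'rV[R]_(m + l)),
          infinite_set K ->
          (st_x (s k), lam0 k) @[k --> within K \oo] --> (xs, ls) ->
          (KKT_Prho f c rhobar xs ls \/
           exists (K' : set nat) (lss : 'rV[R]_(m + l)),
             [/\ infinite_set K', K' `<=` K,
                 lam0 k.-1 @[k --> within K' \oo] --> lss &
                 KKT_Prho f c rhobar xs lss])
          /\ exists lam, KKT_P f c xs lam].
Proof.
have fC := C2_C1_mfd f_C2; have cC i := C2_C1_mfd (c_C2 i).
have [a1 [a2 [a1_gt0 a2_gt0 Hb]]] := H_bounds.
have [kbar ntest] := penalty_updates_finite complete_M l_gt0 fC cC run licq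
  x_bounded a1_gt0 a2_gt0 Hb no_dual.
have /choice[D DP] : forall k, exists D, (kbar <= k)%N ->
    moving_step retr f c P (s k) (eta0 k) (lam0 k) D (s k.+1).
  move=> k; have [kk|_] := leqP kbar k.
    by have [D DP] := rqo_step_moving (run_step run k) (ntest k kk); exists D.
  by exists (StepData 0 0 0 0 0 0).
have s_valid k : valid_state c P (s k) := run_valid l_gt0 run k.
have rhoE := rho_constant run ntest.
have rho0 : 0 < st_rho (s kbar) by have [] := s_valid kbar.
exists (st_rho (s kbar)); split => //; first by exists kbar.
move=> K xs ls Kinf KP; have [U UU KU] := ultra_along Kinf.
have U_free : \oo `<=` U.
  by move=> A [N _ NA]; apply: KU; exists N => // k Nk _; exact: NA.
have kU : \forall k \near U, (kbar <= k)%N by apply: U_free; exists kbar.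
have KPU : (st_x (s k), lam0 k) @[k --> U] --> (xs, ls).
  by move=> A /KP; exact: KU.
have x_cvg : st_x (s k) @[k --> U] --> xs.
  exact: (cvg_comp _ _ KPU (@cvg_fst _ _ (nbhs xs) (nbhs ls) _)).
have lam_cvg : lam0 k @[k --> U] --> ls.
  exact: (cvg_comp _ _ KPU (@cvg_snd _ _ (nbhs xs) (nbhs ls) _)).
pose pred k : R := - metric (st_x (s k)) (gradF f c (s k)) (sd_eta1 (D k)).
(* the same ultrafilter serves both cases: vanishing predictions make the limit of
   the current multipliers a KKT multiplier, the others bring in the previous
   iterates *)
have [pred0|npred] := pselect (pred k @[k --> U] --> (0 : R)).
  have rhoU : \forall k \near U, st_rho (s k) = st_rho (s kbar).
    by apply: filterS kU => k; exact: rhoE.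
  have LS0U : \forall k \near U, LS f c (s k) 0 (eta0 k) (lam0 k).
    by apply: filterE => k; have [] := run_step run k.
  have LS1U : \forall k \near U, LS f c (s k) (v1 c (s k) (lam0 k))
      (sd_eta1 (D k)) (sd_lam1 (D k)) by apply: filterS kU => k /DP [].
  have ntestU : \forall k \near U, ~~ penalty_test P (s k) (eta0 k) (lam0 k).
    by apply: filterS kU.
  have [] := stationary_limit fC cC s_valid a1_gt0 a2_gt0 Hb x_cvg rhoU LS0U LS1U
    ntestU lam_cvg pred0.
  by split; [left|].
have [eps eps0 peps] : exists2 eps : R, 0 < eps & \forall k \near U, eps <= pred k.
  apply: contrapT => neps; apply: npred; apply/cvgrPdist_lt => e e0.
  have : ~ (\forall k \near U, e <= pred k) by move=> he; apply: neps; exists e.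
  move=> /ultra_notP; apply: filterS2 kU => k kk /negP; rewrite -ltNge.
  rewrite sub0r normrN ger0_norm//; exact: (pred_ge0 l_gt0 run DP kk).
have small u : 0 < u -> \forall k \near U, exists i, st_mu (s k) 0 i < u.
  exact: (small_parameter retr_retraction l_gt0 fC cC run licq a1_gt0 a2_gt0 Hb
    ntest DP U_free x_cvg eps0 peps).
have [lss [lss_cvg kkt kktP]] := previous_stationary complete_M retr_retraction l_gt0
  fC cC run licq x_bounded a1_gt0 a2_gt0 Hb ntest DP U_free x_cvg small.
split=> //; right.
have [K' [K'inf K'K K'lss]] := ultra_subsequence UU KU lss_cvg.
by exists K', lss.
Qed.
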